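(* Let $(L,h)$ be an acceptable line bundle on $\Delta^*$ and let $a\in\mathbb{R}$. Then ${}_aL={}_{\gamma({}_aL)}L$ and $\mathcal{P}ar_a(L,h)=\{\gamma({}_aL)\}$. Moreover, for all sufficiently small $\varepsilon>0$, $$\gamma({}_{-a+1-\varepsilon}(L^\vee))=-\gamma({}_aL).$$ In particular, $$\left({}_{\gamma({}_aL)}L\right)^\vee={}_{-\gamma({}_aL)}(L^\vee).$$
   Context: $\Delta=\{z\in\mathbb{C}: |z|<1\}$, $\Delta^*=\Delta\setminus\{0\}$, $j\colon\Delta^*\hookrightarrow\Delta$, $\omega_P=\frac{\sqrt{-1}\,dz\wedge d\bar z}{|z|^2(-\log|z|^2)^2}$. A holomorphic line bundle $L$ on $\Delta^*$ with a smooth Hermitian metric $h$ is acceptable if, writing its Chern curvature as $\sqrt{-1}\,\Theta_h(L)=f\,\omega_P$, $|f|$ is bounded on $\Delta^*$. The dual $L^\vee$ carries the dual metric $h^\vee$ (it is again acceptable). For $a\in\mathbb{R}$, ${}_aL$ is the sheaf of $\mathcal{O}_\Delta$-modules defined for open $U\subset\Delta$ by ${}_aL(U)=\{f\in L(U\setminus\{0\}) : |f|_h=O(|z|^{-(a+\varepsilon)})\text{ for every }\varepsilon>0\}$ (a growth condition as $z\to0$, vacuous if $0\notin U$). It is a holomorphic line bundle on $\Delta$. Define $\gamma({}_aL):=-\frac12\liminf_{z\to0}\frac{\log h(v,v)}{\log|z|}$, where $v$ is any local frame of ${}_aL$ near $0$; this is a finite real number independent of $v$. Put ${}_{<\lambda}L:=\bigcup_{\mu<\lambda}{}_\mu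 L$. $\mathcal{P}ar_a(L,h)$ is the multiset of $\lambda\in(a-1,a]$ with ${}_\lambda L/{}_{<\lambda}L\ne0$, each counted with multiplicity $\dim_{\mathbb{C}}({}_\lambda L/{}_{<\lambda}L)$. Equalities of sheaves are as subsheaves of $j_*L$ or $j_*(L^\vee)$. *)

(* Defs.v *)
From Stdlib Require Import Reals Lra List ClassicalEpsilon.
From Coquelicot Require Import Coquelicot.
Open Scope R_scope.

Definition disc (z : C) : Prop := Cmod z < 1.
Definition punctured_disc (z : C) : Prop := Cmod z < 1 /\ z <> RtoC 0.

Definition holomorphic_on (U : C -> Prop) (f : C -> C) : Prop :=
  forall z, U z -> ex_derive (K := C_AbsRing) (V := C_NormedModule) f z.

Definition dx (u : C -> R) (z : C) : R :=
  Derive (fun x => u (x, Im z)) (Re z).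
Definition dy (u : C -> R) (z : C) : R :=
  Derive (fun y => u (Re z, y)) (Im z).

Fixpoint Ck (n : nat) (U : C -> Prop) (u : C -> R) : Prop :=
  (forall z, U z -> continuous u z) /\
  match n with
  | O => True
  | S m =>
      (forall z, U z ->
         ex_derive (fun x => u (x, Im z)) (Re z) /\
         ex_derive (fun y => u (Re z, y)) (Im z)) /\
      Ck m U (dx u) /\ Ck m U (dy u)
  end.

Definition smooth_on (U : C -> Prop) (u : C -> R) : Prop :=
  forall n, Ck n U u.

Section CkTheory.

Variable U : C -> Prop.
Hypothesis openU : open U.

Lemma slice_x (P : C -> Prop) (z : C) :
  locally z P -> locally (Re z) (fun x => P (x, Im z)).
Proof.
intros [e He]; exists e; intros x Hx; apply He.
split; [exact Hx | apply ball_center].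
Qed.

Lemma slice_y (P : C -> Prop) (z : C) :
  locally z P -> locally (Im z) (fun y => P (Re z, y)).
Proof.
intros [e He]; exists e; intros y Hy; apply He.
split; [apply ball_center | exact Hy].
Qed.

Lemma Ck_ext n : forall u v : C -> R,
  (forall z, U z -> u z = v z) -> Ck n U u -> Ck n U v.
Proof.
assert (loc : forall u v : C -> R, (forall z, U z -> u z = v z) ->
  forall z, U z -> locally z (fun w => u w = v w)).
{ intros u v E z Uz. apply filter_imp with U; [exact E|]. now apply openU. }
induction n as [|n IH]; intros u v E [Hc H].
- split; [|exact I]. intros z Uz. apply continuous_ext_loc with u.
  + now apply loc.
  + now apply Hc.
- destruct H as [Hd [Hx Hy]]. split; [|split; [|split]].
  + intros z Uz. apply continuous_ext_loc with u.
    * now apply loc.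
    * now apply Hc.
  + intros z Uz. destruct (Hd z Uz) as [H1 H2]. split.
    * eapply ex_derive_ext_loc; [|exact H1].
      apply (slice_x (fun w => u w = v w)). now apply loc.
    * eapply ex_derive_ext_loc; [|exact H2].
      apply (slice_y (fun w => u w = v w)). now apply loc.
  + apply IH with (2 := Hx). intros z Uz. apply Derive_ext_loc.
    apply (slice_x (fun w => u w = v w)). now apply loc.
  + apply IH with (2 := Hy). intros z Uz. apply Derive_ext_loc.
    apply (slice_y (fun w => u w = v w)). now apply loc.
Qed.

Lemma Ck_S n : forall u, Ck (S n) U u -> Ck n U u.
Proof.
induction n as [|n IH]; intros u [Hc [Hd [Hx Hy]]].
- split; [exact Hc|exact I].
- split; [exact Hc|]. split; [exact Hd|]. split; now apply IH.
Qed.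

Lemma pair_Re_Im (z : C) : (Re z, Im z) = z.
Proof. now destruct z. Qed.

Lemma Ck_plus n : forall u v, Ck n U u -> Ck n U v ->
  Ck n U (fun z => u z + v z).
Proof.
induction n as [|n IH]; intros u v [Huc Hu] [Hvc Hv].
- split; [|exact I]. intros z Uz.
  now apply (continuous_plus u v); [apply Huc | apply Hvc].
- destruct Hu as [Hud [Hux Huy]], Hv as [Hvd [Hvx Hvy]].
  split; [|split; [|split]].
  + intros z Uz. now apply (continuous_plus u v); [apply Huc | apply Hvc].
  + intros z Uz. destruct (Hud z Uz), (Hvd z Uz).
    split; now apply @ex_derive_plus.
  + apply Ck_ext with (fun z => dx u z + dx v z); [|now apply IH].
    intros z Uz. destruct (Hud z Uz), (Hvd z Uz). unfold dx.
    now rewrite Derive_plus.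
  + apply Ck_ext with (fun z => dy u z + dy v z); [|now apply IH].
    intros z Uz. destruct (Hud z Uz), (Hvd z Uz). unfold dy.
    now rewrite Derive_plus.
Qed.

Lemma Ck_mult n : forall u v, Ck n U u -> Ck n U v ->
  Ck n U (fun z => u z * v z).
Proof.
induction n as [|n IH]; intros u v HCu HCv;
  destruct (HCu) as [Huc Hu], (HCv) as [Hvc Hv].
- split; [|exact I]. intros z Uz.
  now apply (continuous_mult u v); [apply Huc | apply Hvc].
- assert (HDu := Ck_S _ _ HCu). assert (HDv := Ck_S _ _ HCv).
  destruct Hu as [Hud [Hux Huy]], Hv as [Hvd [Hvx Hvy]].
  split; [|split; [|split]].
  + intros z Uz. now apply (continuous_mult u v); [apply Huc | apply Hvc].
  + intros z Uz. destruct (Hud z Uz), (Hvd z Uz).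
    split; now apply ex_derive_mult.
  + apply Ck_ext with (fun z => dx u z * v z + u z * dx v z);
      [|now apply Ck_plus; apply IH].
    intros z Uz. destruct (Hud z Uz), (Hvd z Uz). unfold dx.
    now rewrite Derive_mult, pair_Re_Im.
  + apply Ck_ext with (fun z => dy u z * v z + u z * dy v z);
      [|now apply Ck_plus; apply IH].
    intros z Uz. destruct (Hud z Uz), (Hvd z Uz). unfold dy.
    now rewrite Derive_mult, pair_Re_Im.
Qed.

Lemma Ck_opp n : forall u, Ck n U u -> Ck n U (fun z => - u z).
Proof.
induction n as [|n IH]; intros u [Huc Hu].
- split; [|exact I]. intros z Uz. now apply (continuous_opp u), Huc.
- destruct Hu as [Hud [Hux Huy]]. split; [|split; [|split]].
  + intros z Uz. now apply (continuous_opp u), Huc.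
  + intros z Uz. destruct (Hud z Uz). split; now apply @ex_derive_opp.
  + apply Ck_ext with (fun z => - dx u z); [|now apply IH].
    intros z Uz. unfold dx. now rewrite Derive_opp.
  + apply Ck_ext with (fun z => - dy u z); [|now apply IH].
    intros z Uz. unfold dy. now rewrite Derive_opp.
Qed.

Lemma Ck_inv n : forall u : C -> R, (forall z, U z -> u z <> 0) -> Ck n U u ->
  Ck n U (fun z => / u z).
Proof.
assert (cont : forall u : C -> R, (forall z, U z -> u z <> 0) ->
  (forall z, U z -> continuous u z) ->
  forall z, U z -> continuous (fun z => / u z) z).
{ intros u Hnz Hc z Uz. apply continuous_comp; [now apply Hc|].
  apply continuous_Rinv. now apply Hnz. }
induction n as [|n IH]; intros u Hnz HCu; destruct (HCu) as [Huc Hu].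
- split; [|exact I]. now apply cont.
- assert (HI := IH u Hnz (Ck_S _ _ HCu)). destruct Hu as [Hud [Hux Huy]].
  split; [|split; [|split]].
  + now apply cont.
  + intros z Uz. destruct (Hud z Uz).
    split; apply ex_derive_inv; trivial; rewrite pair_Re_Im; now apply Hnz.
  + apply Ck_ext with (fun z => - dx u z * (/ u z * / u z)).
    * intros z Uz. destruct (Hud z Uz). unfold dx.
      rewrite Derive_inv; trivial; rewrite pair_Re_Im; [|now apply Hnz].
      field. now apply Hnz.
    * apply Ck_mult; [now apply Ck_opp | now apply Ck_mult].
  + apply Ck_ext with (fun z => - dy u z * (/ u z * / u z)).
    * intros z Uz. destruct (Hud z Uz). unfold dy.
      rewrite Derive_inv; trivial; rewrite pair_Re_Im; [|now apply Hnz].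
      field. now apply Hnz.
    * apply Ck_mult; [now apply Ck_opp | now apply Ck_mult].
Qed.

End CkTheory.

(** A holomorphic line bundle on the punctured disc, presented by an open
    cover and a holomorphic cocycle.  A section is a family of local functions
    with [s i = trans i j * s j].  The field [chart_at] chooses, for each point,
    an open set of the cover containing it. *)
Record line_bundle : Type := {
  index : Type;
  chart : index -> C -> Prop;
  chart_at : C -> index;
  trans : index -> index -> C -> C;
  chart_open : forall i, open (chart i);
  chart_sub : forall i z, chart i z -> punctured_disc z;
  chart_cover : forall z, punctured_disc z -> chart (chart_at z) z;
  trans_holo : forall i j,
    holomorphic_on (fun z => chart i z /\ chart j z) (trans i j);
  trans_neq0 : forall i j z, chart i z -> chart j z -> trans i j z <> RtoC 0;
  trans_cocycle : forall i j k z, chart i z -> chart j z -> chart k z ->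
    Cmult (trans i j z) (trans j k z) = trans i k z
}.

(** [weight h i] is [h(e_i, e_i)] for the frame [e_i] of the chart [i]. *)
Record hermitian_metric (L : line_bundle) : Type := {
  weight : index L -> C -> R;
  weight_pos : forall i z, chart L i z -> 0 < weight i z;
  weight_smooth : forall i, smooth_on (chart L i) (weight i);
  weight_trans : forall i j z, chart L i z -> chart L j z ->
    weight j z = Cmod (trans L i j z) ^ 2 * weight i z
}.
Arguments weight {L} h _ _ : rename.

(** The Chern curvature [- d dbar log h] equals
    [- (d^2 log h / dz dzbar) dz /\ dzbar], and
    [d^2 / dz dzbar = (d^2/dx^2 + d^2/dy^2) / 4].  The following function is
    the coefficient of [sqrt(-1) dz /\ dzbar] in [sqrt(-1) Theta_h(L)]. *)
Definition curvature {L : line_bundle} (h : hermitian_metric L)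
    (i : index L) (z : C) : R :=
  let u := fun w => ln (weight h i w) in
  - (dx (dx u) z + dy (dy u) z) / 4.

(** The coefficient of [sqrt(-1) dz /\ dzbar] in [omega_P]. *)
Definition omegaP (z : C) : R :=
  / (Cmod z ^ 2 * (- ln (Cmod z ^ 2)) ^ 2).

Definition acceptable {L : line_bundle} (h : hermitian_metric L) : Prop :=
  exists f : C -> R,
    (forall i z, chart L i z -> curvature h i z = f z * omegaP z) /\
    exists M : R, forall z, punctured_disc z -> Rabs (f z) <= M.

Definition section (L : line_bundle) : Type := index L -> C -> C.

Definition is_section (L : line_bundle) (U : C -> Prop) (s : section L) : Prop :=
  (forall i, holomorphic_on (fun z => U z /\ chart L i z) (s i)) /\
  (forall i j z, U z -> chart L i z -> chart L j z ->
     s i z = Cmult (trans L i j z) (s j z)).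

(** [h(s, s)] at a point of the punctured disc. *)
Definition hsq {L : line_bundle} (h : hermitian_metric L)
    (s : section L) (z : C) : R :=
  weight h (chart_at L z) z * Cmod (s (chart_at L z) z) ^ 2.

(** The frame dual to [e_i] transforms by [(trans i j)^-1 = trans j i]. *)
Program Definition dual (L : line_bundle) : line_bundle := {|
  index := index L;
  chart := chart L;
  chart_at := chart_at L;
  trans := fun i j => trans L j i
|}.
Next Obligation. apply chart_open. Qed.
Next Obligation. eapply chart_sub; eassumption. Qed.
Next Obligation. now apply chart_cover. Qed.
Next Obligation. intros z [Hi Hj]. now apply trans_holo. Qed.
Next Obligation. now apply trans_neq0. Qed.
Next Obligation. rewrite Cmult_comm. now apply trans_cocycle. Qed.

Lemma trans_inv (L : line_bundle) i j z : chart L i z -> chart L j z ->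
  Cmult (trans L i j z) (trans L j i z) = RtoC 1.
Proof.
intros Hi Hj. rewrite trans_cocycle by trivial.
assert (E := trans_cocycle L i i i z Hi Hi Hi).
assert (N := trans_neq0 L i i z Hi Hi).
rewrite <- (Cinv_r _ N) at 1. rewrite <- E at 2.
rewrite <- Cmult_assoc, Cinv_r by trivial. now rewrite Cmult_1_r.
Qed.

Program Definition dual_metric {L : line_bundle} (h : hermitian_metric L) :
  hermitian_metric (dual L) := {| weight := fun i z => / weight h i z |}.
Next Obligation.
apply Rinv_0_lt_compat. now apply weight_pos.
Qed.
Next Obligation.
intros n. apply Ck_inv.
- apply chart_open.
- intros z Hz. apply Rgt_not_eq. now apply weight_pos.
- apply weight_smooth.
Qed.
Next Obligation.
rewrite (weight_trans L h i j z) by trivial.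
assert (E := f_equal Cmod (trans_inv L i j z H H0)).
rewrite Cmod_mult, Cmod_1 in E.
assert (P := weight_pos L h i z H).
assert (N : Cmod (trans L i j z) <> 0) by (intros K; rewrite K in E; lra).
replace (Cmod (trans L j i z)) with (/ Cmod (trans L i j z)).
- field. split; [lra | exact N].
- apply Rmult_eq_reg_l with (Cmod (trans L i j z)); trivial.
  rewrite E. now apply Rinv_r.
Qed.

(** A subsheaf of [j_* L]: a section over an open subset [U] of the disc is a
    section of [L] over [U] minus the origin. *)
Definition subsheaf (L : line_bundle) : Type := (C -> Prop) -> section L -> Prop.

Definition remove0 (U : C -> Prop) : C -> Prop := fun z => U z /\ z <> RtoC 0.

Definition open_in_disc (U : C -> Prop) : Prop :=
  open U /\ forall z, U z -> disc z.

Definition sheaf_eq {L : line_bundle} (F G : subsheaf L) : Prop :=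
  forall U, open_in_disc U -> forall s, F U s <-> G U s.

Definition prolong {L : line_bundle} (h : hermitian_metric L) (a : R) : subsheaf L :=
  fun U s => is_section L (remove0 U) s /\
    (U (RtoC 0) -> forall eps, 0 < eps -> exists M : R,
       locally' (RtoC 0) (fun z =>
         sqrt (hsq h s z) <= M * Rpower (Cmod z) (- (a + eps)))).

(** The presheaf union of the [prolong h mu] is already a sheaf, because the
    growth condition only concerns the germ at the origin. *)
Definition prolong_lt {L : line_bundle} (h : hermitian_metric L) (lam : R) :
  subsheaf L :=
  fun U s => exists mu, mu < lam /\ prolong h mu U s.

Definition local_frame0 {L : line_bundle} (F : subsheaf L) (v : section L) : Prop :=
  exists U, open_in_disc U /\ U (RtoC 0) /\ F U v /\
    forall V, open V -> (forall z, V z -> U z) -> forall t, F V t ->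
      exists f : C -> C,
        (holomorphic_on V f /\
         forall i z, V z -> chart L i z -> t i z = Cmult (f z) (v i z)) /\
        (forall f', holomorphic_on V f' ->
           (forall i z, V z -> chart L i z -> t i z = Cmult (f' z) (v i z)) ->
           forall z, V z -> f' z = f z).

(** The supremum of the eventual lower bounds of [u] as [z -> 0], [z <> 0]. *)
Definition liminf0 (u : C -> R) : Rbar :=
  Lub_Rbar (fun m => locally' (RtoC 0) (fun z => m <= u z)).

Definition some_frame0 {L : line_bundle} (F : subsheaf L) : section L :=
  epsilon (inhabits (fun _ _ => RtoC 0)) (local_frame0 F).

Definition gamma {L : line_bundle} (h : hermitian_metric L) (F : subsheaf L) : R :=
  - / 2 * real (liminf0 (fun z => ln (hsq h (some_frame0 F) z) / ln (Cmod z))).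

Definition sub_section {L : line_bundle} (s t : section L) : section L :=
  fun i z => Cminus (s i z) (t i z).

Definition lincomb {L : line_bundle} (n : nat) (c : nat -> C)
    (b : nat -> section L) : section L :=
  fun i z => fold_right Cplus (RtoC 0)
    (map (fun k => Cmult (c k) (b k i z)) (seq 0 n)).

(** [n] is the dimension of the stalk at the origin of [F / G], for sheaves [F]
    and [G] that agree away from the origin: there are germs [b 0], ...,
    [b (n-1)] of [F] such that every germ of [F] is, modulo a germ of [G], a
    unique linear combination of them. *)
Definition quotient_dim {L : line_bundle} (F G : subsheaf L) (n : nat) : Prop :=
  exists (U : C -> Prop) (b : nat -> section L),
    open_in_disc U /\ U (RtoC 0) /\ (forall k, (k < n)%nat -> F U (b k)) /\
    forall V t, open V -> V (RtoC 0) -> (forall z, V z -> U z) -> F V t ->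
      let zero_mod c := exists W, open W /\ W (RtoC 0) /\
        (forall z, W z -> V z) /\ G W (sub_section t (lincomb n c b)) in
      exists c, zero_mod c /\
        forall c', zero_mod c' -> forall k, (k < n)%nat -> c' k = c k.

(** Multisets of reals are given by their multiplicity function. *)
Definition is_Par {L : line_bundle} (h : hermitian_metric L) (a : R)
    (m : R -> nat) : Prop :=
  forall lam,
    (a - 1 < lam <= a ->
       quotient_dim (prolong h lam) (prolong_lt h lam) (m lam)) /\
    (~ (a - 1 < lam <= a) -> m lam = 0%nat).

Definition mset1 (x : R) : R -> nat :=
  fun y => if Req_EM_T y x then 1%nat else 0%nat.

Definition add_scal_section {L : line_bundle} (f : C -> C) (s t : section L) :
  section L := fun i z => Cplus (Cmult (f z) (s i z)) (t i z).

(** Morphisms of [O]-modules from [F] to [O] over [U]. *)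
Definition is_hom_to_O {L : line_bundle} (F : subsheaf L) (U : C -> Prop)
    (phi : (C -> Prop) -> section L -> C -> C) : Prop :=
  forall V, open V -> (forall z, V z -> U z) -> forall t, F V t ->
    holomorphic_on V (phi V t) /\
    (forall f t', holomorphic_on V f -> F V t' ->
       forall z, V z -> phi V (add_scal_section f t t') z =
         Cplus (Cmult (f z) (phi V t z)) (phi V t' z)) /\
    (forall W t', open W -> (forall z, W z -> V z) -> F W t' ->
       (forall i z, W z -> chart L i z -> t' i z = t i z) ->
       forall z, W z -> phi W t' z = phi V t z).

(** The dual [Hom(F, O)] as a subsheaf of [j_* (dual L)]: a morphism is sent to
    the section of [dual L] away from the origin that induces it there. *)
Definition dual_sheaf {L : line_bundle} (F : subsheaf L) : subsheaf (dual L) :=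
  fun U s => is_section (dual L) (remove0 U) s /\
    exists phi, is_hom_to_O F U phi /\
      forall V t, open V -> (forall z, V z -> remove0 U z) -> F V t ->
        forall i z, V z -> chart L i z -> phi V t z = Cmult (s i z) (t i z).

(* Main.v *)
(** Away from the puncture the Laplacian [g] of [log h] is globally defined and
    bounded by the Poincare density.  Summing Cauchy transforms of dyadic pieces
    of [g] gives a solution [D] of [(d/dx + i d/dy) D = g] with [D = o(1/|z|)].
    Hence [2 d(log h) - D dz] is holomorphic in every chart, and integrating it
    yields local holomorphic frames whose norm has logarithmic differential
    [Re (D dz)]; such frames are unique up to a constant.  They glue over the
    half-plane covering the punctured disc, where the deck transformation
    multiplies the resulting frame by a constant [exp (2 pi i beta)].  Twisting
    by [z^(-beta)] gives a single-valued frame [v] with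
    [log h(v, v) ~ - 2 Re(beta) log |z|], and [beta] may be shifted by an integer
    so that [gamma = Re beta] lies in [(a - 1, a]].  By the removable singularity
    theorem [v] is a frame of [prolong h lam] exactly for [lam] in
    [[gamma, gamma + 1)], and the dual frame plays the same role for the dual
    bundle with [- gamma]; all the claims follow. *)
Require Import Defs.
From Stdlib Require Import Reals Lra Lia Psatz ZArith ClassicalEpsilon FunctionalExtensionality.
From Coquelicot Require Import Coquelicot.
Open Scope R_scope.

(** * Complex and real derivatives *)

(** Everything aims at one number, the exact rate of log h(v, v) against log |z|, and the Poincare
    bound is what makes it available. On the annulus |z| ~ 2^-j the density g has size 4^j / j^2, so
    the transform of that piece is O(1 / (j^2 |z|)): the series has tail O(1 / (N |z|)) while each
    partial sum is bounded, whence z D(z) -> 0. Under z = exp w the form D dz becomes D(exp w) exp w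
    dw, whose coefficient tends to 0 as Re w -> -infinity. The logarithmic norm of the lifted frame
    is thus o(|Re w|) on a period strip, and only the twist by z^(-beta) contributes to the rate.

    The obstacle is that D is a uniform limit whose derivatives are not controlled. The equation is
    therefore used for the partial sums only, and the holomorphy of 2 d(log h) - D dz enters through
    the vanishing of its integrals over rectangles, which survives the limit and yields a primitive.
    One bisection principle for rectangles serves both for Goursat's theorem and for patching the
    local frames. *)

Definition Cder (f : C -> C) (z l : C) : Prop :=
  forall eps, 0 < eps -> exists del, 0 < del /\ forall w,
    Cmod (w - z)%C < del ->
    Cmod (f w - f z - l * (w - z))%C <= eps * Cmod (w - z)%C.

Definition Ccont (f : C -> C) (z : C) : Prop :=
  forall eps, 0 < eps -> exists del, 0 < del /\ forall w,
    Cmod (w - z)%C < del -> Cmod (f w - f z)%C < eps.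

Definition Copen (U : C -> Prop) : Prop :=
  forall z, U z -> exists del, 0 < del /\ forall w, Cmod (w - z)%C < del -> U w.

Lemma ball_Cmod (z w : C) e : Cmod (w - z)%C < e -> ball (M := C_UniformSpace) z e w.
Proof. intros H. exact (C_NormedModule_mixin_compat1 z w e H). Qed.

(** Balls of the product structure are squares, so the modulus can exceed the radius by the factor
    sqrt 2; 2 is a rounder upper bound. *)
Lemma Cmod_ball (z w : C) (e : posreal) :
  ball (M := C_UniformSpace) z e w -> Cmod (w - z)%C < 2 * e.
Proof.
intros H. assert (K := C_NormedModule_mixin_compat2 z w e H).
assert (sqrt 2 < 2).
{ rewrite <- (sqrt_square 2) at 2 by lra. apply sqrt_lt_1; lra. }
assert (E := cond_pos e). change (minus w z) with (w - z)%C in K. nra.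
Qed.

Lemma locally_Cmod (z : C) (P : C -> Prop) :
  locally (T := C_UniformSpace) z P <->
  exists del, 0 < del /\ forall w, Cmod (w - z)%C < del -> P w.
Proof.
split.
- intros [e He]. exists e. split; [apply cond_pos|].
  intros w Hw. apply He. now apply ball_Cmod.
- intros (d & Hd & H). assert (Hd2 : 0 < d / 2) by lra.
  exists (mkposreal _ Hd2). intros w Hw. apply H.
  apply Cmod_ball in Hw. simpl in Hw. lra.
Qed.

Lemma locally'_Cmod (z : C) (P : C -> Prop) :
  locally' (T := C_UniformSpace) z P <->
  exists del, 0 < del /\ forall w, Cmod (w - z)%C < del -> w <> z -> P w.
Proof.
unfold locally', within. rewrite locally_Cmod. reflexivity.
Qed.

Lemma open_Copen (U : C -> Prop) : open (T := C_UniformSpace) U <-> Copen U.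
Proof.
split; intros H z Hz.
- apply locally_Cmod. now apply H.
- apply locally_Cmod. now apply H.
Qed.

Lemma locally_K (z : C) (P : C -> Prop) :
  locally (T := AbsRing_UniformSpace C_AbsRing) z P <->
  exists del, 0 < del /\ forall w, Cmod (w - z)%C < del -> P w.
Proof.
split.
- intros [e He]. exists e. split; [apply cond_pos|]. exact He.
- intros (d & Hd & H). exists (mkposreal _ Hd). exact H.
Qed.

Lemma Cder_domin (f : C -> C) z l : Cder f z l <->
  forall eps : posreal, locally (T := AbsRing_UniformSpace C_AbsRing) z
   (fun w => Cmod (minus (minus (f w) (f z)) (mult (minus w z) l))
      <= eps * Cmod (minus w z)).
Proof.
split.
- intros H eps. apply locally_K.
  destruct (H eps (cond_pos eps)) as (d & Hd & K). exists d. split; trivial.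
  intros w Hw. specialize (K w Hw). rewrite (Cmult_comm l) in K. exact K.
- intros H eps He. specialize (H (mkposreal _ He)). apply locally_K in H.
  destruct H as (d & Hd & K). exists d. split; trivial.
  intros w Hw. specialize (K w Hw). rewrite (Cmult_comm l). exact K.
Qed.

Lemma Cder_is_derive (f : C -> C) z l :
  is_derive (K := C_AbsRing) (V := C_NormedModule) f z l <-> Cder f z l.
Proof.
rewrite Cder_domin. split.
- intros [_ H]. exact (H z (fun P HP => HP)).
- intros H. split; [exact (is_linear_scal_l (K := C_AbsRing) (V := C_NormedModule) l)|].
  intros x Hx eps.
  apply (is_filter_lim_locally_unique (K := C_AbsRing) (V := AbsRing_NormedModule C_AbsRing)) in Hx.
  subst x. exact (H eps).
Qed.

(** The complex numbers carry two normed-module structures over themselves. [holomorphic_on] refers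
    to the other one; products and compositions are differentiated in this one. *)
Lemma Cder_is_derive_K (f : C -> C) z l :
  is_derive (K := C_AbsRing) (V := AbsRing_NormedModule C_AbsRing) f z l <-> Cder f z l.
Proof.
rewrite Cder_domin. split.
- intros [_ H]. exact (H z (fun P HP => HP)).
- intros H. split; [exact (is_linear_scal_l (K := C_AbsRing) (V := AbsRing_NormedModule C_AbsRing) l)|].
  intros x Hx eps.
  apply (is_filter_lim_locally_unique (K := C_AbsRing) (V := AbsRing_NormedModule C_AbsRing)) in Hx.
  subst x. exact (H eps).
Qed.

Lemma ex_derive_Cder (f : C -> C) z :
  ex_derive (K := C_AbsRing) (V := C_NormedModule) f z <-> exists l, Cder f z l.
Proof.
split; intros [l H]; exists l; now apply Cder_is_derive.
Qed.

Lemma Cder_ext_loc (f g : C -> C) z l :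
  (exists d, 0 < d /\ forall w, Cmod (w - z)%C < d -> f w = g w) ->
  Cder f z l -> Cder g z l.
Proof.
intros (d & Hd & E) H eps He. destruct (H eps He) as (d' & Hd' & K).
exists (Rmin d d'). split; [now apply Rmin_glb_lt|].
intros w Hw. rewrite <- !E; [apply K| |].
- eapply Rlt_le_trans; [exact Hw|apply Rmin_r].
- unfold Cminus. rewrite Cplus_opp_r, Cmod_0. exact Hd.
- eapply Rlt_le_trans; [exact Hw|apply Rmin_l].
Qed.

Lemma Cder_ext (f g : C -> C) z l : (forall w, f w = g w) -> Cder f z l -> Cder g z l.
Proof. intros E. apply Cder_ext_loc. exists 1. split; [lra|auto]. Qed.

Lemma Cder_eq (f : C -> C) z l l' : l = l' -> Cder f z l -> Cder f z l'.
Proof. now intros ->. Qed.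

Lemma Cder_const (c z : C) : Cder (fun _ => c) z 0.
Proof. apply Cder_is_derive. exact (is_derive_const (K := C_AbsRing) (V := C_NormedModule) c z). Qed.

Lemma Cder_id (z : C) : Cder (fun w => w) z 1.
Proof. apply Cder_is_derive_K. exact (is_derive_id (K := C_AbsRing) z). Qed.

Lemma Cder_plus (f g : C -> C) z l m : Cder f z l -> Cder g z m ->
  Cder (fun w => f w + g w)%C z (l + m)%C.
Proof.
rewrite <- !Cder_is_derive.
exact (is_derive_plus (K := C_AbsRing) (V := C_NormedModule) f g z l m).
Qed.

Lemma Cder_minus (f g : C -> C) z l m : Cder f z l -> Cder g z m ->
  Cder (fun w => f w - g w)%C z (l - m)%C.
Proof.
rewrite <- !Cder_is_derive.
exact (is_derive_minus (K := C_AbsRing) (V := C_NormedModule) f g z l m).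
Qed.

Lemma Cder_mult (f g : C -> C) z l m : Cder f z l -> Cder g z m ->
  Cder (fun w => f w * g w)%C z (l * g z + f z * m)%C.
Proof.
rewrite <- !Cder_is_derive_K. intros H K.
exact (is_derive_mult (K := C_AbsRing) f g z l m H K Cmult_comm).
Qed.

Lemma Cder_comp (f g : C -> C) z l m : Cder f (g z) l -> Cder g z m ->
  Cder (fun w => f (g w)) z (l * m)%C.
Proof.
rewrite <- !Cder_is_derive_K. intros H K. rewrite Cmult_comm.
exact (is_derive_comp (K := C_AbsRing) (V := AbsRing_NormedModule C_AbsRing) f g z l m H K).
Qed.

Lemma Cder_scal (c : C) (f : C -> C) z l : Cder f z l ->
  Cder (fun w => c * f w)%C z (c * l)%C.
Proof.
intros H. eapply Cder_eq; [|apply Cder_mult; [apply Cder_const|exact H]]. cbv beta. ring.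
Qed.

Lemma Cder_cont (f : C -> C) z l : Cder f z l -> Ccont f z.
Proof.
intros H eps He. destruct (H 1 Rlt_0_1) as (d & Hd & K).
set (M := 1 + Cmod l). assert (HM : 0 < M) by (unfold M; generalize (Cmod_ge_0 l); lra).
exists (Rmin d (eps / M)). split.
- apply Rmin_glb_lt; trivial. now apply Rdiv_lt_0_compat.
- intros w Hw. specialize (K w (Rlt_le_trans _ _ _ Hw (Rmin_l _ _))).
  assert (H2 := Rlt_le_trans _ _ _ Hw (Rmin_r _ _)).
  replace (f w - f z)%C with ((f w - f z - l * (w - z)) + l * (w - z))%C by ring.
  eapply Rle_lt_trans; [apply Cmod_triangle|]. rewrite Cmod_mult.
  apply (Rmult_lt_compat_r M) in H2; trivial.
  replace (eps / M * M) with eps in H2 by (field; lra). unfold M in *. lra.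
Qed.

Lemma Cmod_sub_sym (z w : C) : Cmod (z - w)%C = Cmod (w - z)%C.
Proof. rewrite <- Cmod_opp. f_equal. ring. Qed.

Lemma Cmod_tri3 (a b c : C) : Cmod (a - c)%C <= Cmod (a - b)%C + Cmod (b - c)%C.
Proof. replace (a - c)%C with ((a - b) + (b - c))%C by ring. apply Cmod_triangle. Qed.

Lemma Cmod_rev_tri (a b : C) : Cmod a - Cmod b <= Cmod (a - b)%C.
Proof.
assert (H := Cmod_triangle (a - b)%C b). replace (a - b + b)%C with a in H by ring. lra.
Qed.

Lemma Ccont_neq0 (f : C -> C) z : Ccont f z -> f z <> 0 ->
  exists d, 0 < d /\ forall w, Cmod (w - z)%C < d -> f w <> 0.
Proof.
intros H N. apply Cmod_gt_0 in N. destruct (H _ N) as (d & Hd & K).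
exists d. split; trivial. intros w Hw E. specialize (K w Hw). rewrite E in K.
rewrite Cmod_sub_sym in K. replace (f z - 0)%C with (f z) in K by ring. lra.
Qed.

Lemma Cder_inv_id (z : C) : z <> 0 -> Cder (fun w => / w)%C z (- / (z * z))%C.
Proof.
intros N eps He. assert (P : 0 < Cmod z) by now apply Cmod_gt_0.
set (m := Cmod z) in *.
(* The error is (w - z)^2 / (z^2 w). The first bound keeps |w| above m / 2, the second makes the
   remaining factor |w - z| small against eps m^2 |w|. *)
exists (Rmin (m / 2) (eps * m * m * m / 2)). split.
{ apply Rmin_glb_lt; [lra|]. apply Rdiv_lt_0_compat; [|lra].
  repeat apply Rmult_lt_0_compat; trivial. }
intros w Hw. assert (H1 := Rlt_le_trans _ _ _ Hw (Rmin_l _ _)).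
assert (H2 := Rlt_le_trans _ _ _ Hw (Rmin_r _ _)).
assert (Hm : m / 2 <= Cmod w).
{ assert (K := Cmod_rev_tri z w). rewrite Cmod_sub_sym in K. fold m in K. lra. }
assert (Nw : w <> 0) by (apply Cmod_gt_0; lra).
replace (/ w - / z - - / (z * z) * (w - z))%C
  with ((w - z) * (w - z) * / (z * z * w))%C by (field; auto).
rewrite !Cmod_mult, Cmod_inv by (repeat apply Cmult_neq_0; trivial).
rewrite !Cmod_mult. fold m.
rewrite (Rmult_comm eps), Rmult_assoc. apply Rmult_le_compat_l; [apply Cmod_ge_0|].
apply Rle_div_l.
- repeat apply Rmult_gt_0_compat; trivial; lra.
- assert (0 < eps * m * m) by (repeat apply Rmult_lt_0_compat; trivial). nra.
Qed.

Lemma Cder_inv (f : C -> C) z l : f z <> 0 -> Cder f z l ->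
  Cder (fun w => / f w)%C z (- l / (f z * f z))%C.
Proof.
intros N H. eapply Cder_eq; [|apply (Cder_comp Cinv f); [now apply Cder_inv_id|exact H]].
cbv beta. field. exact N.
Qed.

Lemma Cder_div (f g : C -> C) z l m : g z <> 0 -> Cder f z l -> Cder g z m ->
  Cder (fun w => f w / g w)%C z ((l * g z - f z * m) / (g z * g z))%C.
Proof.
intros N H K. eapply Cder_eq; [|apply Cder_mult; [exact H|apply Cder_inv; [exact N|exact K]]].
cbv beta. field. exact N.
Qed.

Lemma Cder_unique (f : C -> C) z l m : Cder f z l -> Cder f z m -> l = m.
Proof.
intros H K. apply Ceq_minus. apply Cmod_eq_0. apply Rle_antisym; [|apply Cmod_ge_0].
apply Rnot_lt_le. intros P. set (e := Cmod (l - m)%C) in *.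
destruct (H (e / 3)) as (d & Hd & A); [lra|].
destruct (K (e / 3)) as (d' & Hd' & B); [lra|].
set (t := Rmin d d' / 2). assert (Ht : 0 < t).
{ unfold t. assert (0 < Rmin d d') by now apply Rmin_glb_lt. lra. }
assert (T : Cmod (z + RtoC t - z)%C = t).
{ replace (z + RtoC t - z)%C with (RtoC t) by ring. rewrite Cmod_R, Rabs_pos_eq; lra. }
assert (t < d) by (unfold t in *; generalize (Rmin_l d d'); lra).
assert (t < d') by (unfold t in *; generalize (Rmin_r d d'); lra).
specialize (A (z + RtoC t)%C). specialize (B (z + RtoC t)%C).
rewrite T in A, B. specialize (A H0). specialize (B H1).
assert (Q : Cmod ((l - m) * RtoC t)%C <= e / 3 * t + e / 3 * t).
{ eapply Rle_trans; [|apply Rplus_le_compat; [exact B|exact A]].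
  eapply Rle_trans; [|rewrite <- (Cmod_opp (f (z+RtoC t) - f z - l * _)%C); apply Cmod_triangle].
  right. f_equal. ring. }
rewrite Cmod_mult, Cmod_R, (Rabs_pos_eq t) in Q by lra. fold e in Q. nra.
Qed.

(** [Rder v z l] means [dv = Re (l dz)] at [z], i.e. [l = dv/dx - i dv/dy]. *)
Definition Rder (v : C -> R) (z l : C) : Prop :=
  forall eps, 0 < eps -> exists del, 0 < del /\ forall w,
    Cmod (w - z)%C < del ->
    Rabs (v w - v z - Re (l * (w - z))%C) <= eps * Cmod (w - z)%C.

Lemma Rder_ext_loc (f g : C -> R) z l :
  (exists d, 0 < d /\ forall w, Cmod (w - z)%C < d -> f w = g w) ->
  Rder f z l -> Rder g z l.
Proof.
intros (d & Hd & E) H eps He. destruct (H eps He) as (d' & Hd' & K).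
exists (Rmin d d'). split; [now apply Rmin_glb_lt|].
intros w Hw. rewrite <- !E; [apply K| |].
- eapply Rlt_le_trans; [exact Hw|apply Rmin_r].
- unfold Cminus. rewrite Cplus_opp_r, Cmod_0. exact Hd.
- eapply Rlt_le_trans; [exact Hw|apply Rmin_l].
Qed.

Lemma Rder_eq (f : C -> R) z l l' : l = l' -> Rder f z l -> Rder f z l'.
Proof. now intros ->. Qed.

Definition RCder (g : R -> C) (t : R) (l : C) : Prop :=
  forall eps, 0 < eps -> exists del, 0 < del /\ forall s, Rabs (s - t) < del ->
    Cmod (g s - g t - RtoC (s - t) * l)%C <= eps * Rabs (s - t).

Lemma norm_C_R (z : C) : norm (V := C_R_NormedModule) z = Cmod z.
Proof.
unfold norm. simpl. unfold prod_norm, Cmod, norm. simpl. unfold abs. simpl.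
f_equal. rewrite !Rmult_1_r, <- !Rabs_mult, !Rabs_pos_eq; trivial; apply Rle_0_sqr.
Qed.

Lemma filterdiff_locally_iff {U V : NormedModule R_AbsRing} (f : U -> V) z (l : U -> V) : is_linear l ->
  filterdiff f (locally z) l <-> forall eps : posreal, locally z (fun w =>
    norm (minus (minus (f w) (f z)) (l (minus w z))) <= eps * norm (minus w z)).
Proof.
intros Hl. split.
- intros [_ H]. exact (H z (fun P HP => HP)).
- intros H. split; trivial. intros x Hx eps. apply is_filter_lim_locally_unique in Hx. subst x. apply H.
Qed.

Lemma is_linear_Cmult (l : C) :
  is_linear (U := C_R_NormedModule) (V := C_R_NormedModule) (fun d : C => (l * d)%C).
Proof.
split.
- intros x y. apply Cmult_plus_distr_l.
- intros k x. rewrite !scal_R_Cmult. change (@eq C (l * (RtoC k * x)) (RtoC k * (l * x)))%C. ring.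
- exists (Cmod l + 1). assert (P := Cmod_ge_0 l). split; [lra|]. intros x.
  rewrite !norm_C_R, Cmod_mult. apply Rmult_le_compat_r; [apply Cmod_ge_0|lra].
Qed.

Lemma is_linear_Re :
  is_linear (U := C_R_NormedModule) (V := R_NormedModule) (fun d : C => Re d).
Proof. apply (is_linear_fst (U := R_NormedModule) (V := R_NormedModule)). Qed.

Lemma is_linear_Re_mult (l : C) :
  is_linear (U := C_R_NormedModule) (V := R_NormedModule) (fun d : C => Re (l * d)%C).
Proof.
apply (is_linear_comp (U := C_R_NormedModule) (V := C_R_NormedModule) (W := R_NormedModule)
  (fun d : C => (l * d)%C) (fun d : C => Re d)); [apply is_linear_Cmult|apply is_linear_Re].
Qed.

Lemma Rder_filterdiff (v : C -> R) z l : Rder v z l <->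
  filterdiff (U := C_R_NormedModule) (V := R_NormedModule) v
    (locally (T := C_UniformSpace) z) (fun d : C => Re (l * d)%C).
Proof.
rewrite (filterdiff_locally_iff (U := C_R_NormedModule) (V := R_NormedModule)) by apply is_linear_Re_mult.
split.
- intros H eps. apply locally_Cmod. destruct (H eps (cond_pos eps)) as (d & Hd & K).
  exists d. split; trivial. intros w Hw. rewrite norm_C_R. now apply K.
- intros H eps He. specialize (H (mkposreal _ He)). apply locally_Cmod in H.
  destruct H as (d & Hd & K). exists d. split; trivial. intros w Hw. specialize (K w Hw).
  rewrite norm_C_R in K. exact K.
Qed.

Lemma Cder_filterdiff (f : C -> C) z l : Cder f z l <->
  filterdiff (U := C_R_NormedModule) (V := C_R_NormedModule) f
    (locally (T := C_UniformSpace) z) (fun d : C => (l * d)%C).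
Proof.
rewrite (filterdiff_locally_iff (U := C_R_NormedModule) (V := C_R_NormedModule)) by apply is_linear_Cmult.
split.
- intros H eps. apply locally_Cmod. destruct (H eps (cond_pos eps)) as (d & Hd & K).
  exists d. split; trivial. intros w Hw. rewrite !norm_C_R. now apply K.
- intros H eps He. specialize (H (mkposreal _ He)). apply locally_Cmod in H.
  destruct H as (d & Hd & K). exists d. split; trivial. intros w Hw. specialize (K w Hw).
  rewrite !norm_C_R in K. exact K.
Qed.

Lemma RCder_is_derive (g : R -> C) t l :
  RCder g t l <-> is_derive (V := C_R_NormedModule) g t l.
Proof.
unfold is_derive. rewrite filterdiff_locally_iff by apply is_linear_scal_l. split.
- intros H eps. destruct (H eps (cond_pos eps)) as (d & Hd & K). exists (mkposreal _ Hd).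
  intros s Hs. rewrite norm_C_R, scal_R_Cmult. now apply K.
- intros H eps He. destruct (H (mkposreal _ He)) as [d K]. exists d. split; [apply cond_pos|].
  intros s Hs. specialize (K s Hs). rewrite norm_C_R, scal_R_Cmult in K. exact K.
Qed.

Lemma Rder_plus (f g : C -> R) z l m : Rder f z l -> Rder g z m ->
  Rder (fun w => f w + g w) z (l + m)%C.
Proof.
rewrite !Rder_filterdiff. intros H K.
apply (filterdiff_ext_lin _ _ _ (filterdiff_plus_fct _ _ _ _ H K)).
intros d. now rewrite Cmult_plus_distr_r, re_plus.
Qed.

Lemma Rder_scal (c : R) (f : C -> R) z l : Rder f z l ->
  Rder (fun w => c * f w) z (RtoC c * l)%C.
Proof.
rewrite !Rder_filterdiff. intros H.
apply (filterdiff_ext_lin _ _ _ (filterdiff_scal_r_fct c _ _ Rmult_comm H)).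
intros d. now rewrite <- Cmult_assoc, re_scal_l.
Qed.

Lemma Rder_minus (f g : C -> R) z l m : Rder f z l -> Rder g z m ->
  Rder (fun w => f w - g w) z (l - m)%C.
Proof.
intros H K. apply (Rder_scal (-1)) in K.
assert (A := Rder_plus _ _ _ _ _ H K).
replace (l - m)%C with (l + RtoC (-1) * m)%C by ring.
eapply Rder_ext_loc; [|exact A]. exists 1. split; [lra|]. intros; ring.
Qed.

Lemma Rder_Re (f : C -> C) z l : Cder f z l -> Rder (fun w => Re (f w)) z l.
Proof.
intros H eps He. destruct (H eps He) as (d & Hd & A). exists d. split; trivial.
intros w Hw. eapply Rle_trans; [|now apply A].
eapply Rle_trans; [|apply re_le_Cmod]. right. f_equal.
Qed.

Lemma Im_Re (z : C) : Im z = Re (- Ci * z)%C.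
Proof. destruct z as [x y]. simpl. ring. Qed.

(** The Cauchy-Riemann equations in the convention of [Rder]: since Im (l dz) = Re (- i l dz), the
    differential of the imaginary part must be represented by - i l. *)
Lemma Cder_of_Rder (p q : C -> R) z l :
  Rder p z l -> Rder q z (- Ci * l)%C -> Cder (fun w => (p w, q w)) z l.
Proof.
intros H K eps He. destruct (H (eps / 2)) as (d & Hd & A); [lra|].
destruct (K (eps / 2)) as (d' & Hd' & B); [lra|].
exists (Rmin d d'). split; [now apply Rmin_glb_lt|]. intros w Hw.
specialize (A w (Rlt_le_trans _ _ _ Hw (Rmin_l _ _))).
specialize (B w (Rlt_le_trans _ _ _ Hw (Rmin_r _ _))).
rewrite <- Cmult_assoc, <- Im_Re in B.
set (dl := (l * (w - z))%C) in *.
replace ((p w, q w) - (p z, q z) - dl)%C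
  with (RtoC (p w - p z - Re dl) + Ci * RtoC (q w - q z - Im dl))%C.
- eapply Rle_trans; [apply Cmod_triangle|].
  rewrite Cmod_mult, !Cmod_R, Cmod_Ci. lra.
- destruct dl as [a b]. unfold Cminus, Cplus, Copp, Cmult, Ci, RtoC, Re, Im. simpl. f_equal; ring.
Qed.

Lemma Rder_comp (v : C -> R) (g : C -> C) z l m : Rder v (g z) l -> Cder g z m ->
  Rder (fun w => v (g w)) z (l * m)%C.
Proof.
rewrite !Rder_filterdiff, Cder_filterdiff. intros H K.
apply (filterdiff_ext_lin _ _ _
  (filterdiff_comp' (U := C_R_NormedModule) (V := C_R_NormedModule) (W := R_NormedModule) g v z _ _ K H)).
intros d. now rewrite Cmult_assoc.
Qed.

Lemma Rder_comp1 (phi : R -> R) (v : C -> R) z l a : is_derive phi (v z) a -> Rder v z l ->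
  Rder (fun w => phi (v w)) z (RtoC a * l)%C.
Proof.
rewrite !Rder_filterdiff. intros H K.
apply (filterdiff_ext_lin _ _ _
  (filterdiff_comp' (U := C_R_NormedModule) (V := R_NormedModule) (W := R_NormedModule) v phi z _ _ K H)).
intros d. rewrite <- Cmult_assoc, re_scal_l. apply Rmult_comm.
Qed.

Lemma RCder_comp (f : C -> C) (g : R -> C) t l m :
  Cder f (g t) l -> RCder g t m -> RCder (fun s => f (g s)) t (l * m)%C.
Proof.
rewrite !RCder_is_derive, Cder_filterdiff. intros H K.
apply (filterdiff_ext_lin _ _ _
  (filterdiff_comp' (U := R_NormedModule) (V := C_R_NormedModule) (W := C_R_NormedModule) g f t _ _ K H)).
intros d. rewrite !scal_R_Cmult. change (@eq C (l * (RtoC d * m)) (RtoC d * (l * m)))%C. ring.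
Qed.

Lemma Rder_path (v : C -> R) (g : R -> C) t l m :
  Rder v (g t) l -> RCder g t m -> is_derive (fun s => v (g s)) t (Re (l * m)%C).
Proof.
rewrite Rder_filterdiff, RCder_is_derive. intros H K.
apply (filterdiff_ext_lin _ _ _
  (filterdiff_comp' (U := R_NormedModule) (V := C_R_NormedModule) (W := R_NormedModule) g v t _ _ K H)).
intros d. rewrite scal_R_Cmult.
replace (l * (RtoC d * m))%C with (RtoC d * (l * m))%C by ring. apply re_scal_l.
Qed.

(** The difference n = l - m represents the zero differential. Moving in the direction of the
    conjugate of n, where Re (n dz) is a positive multiple of |n|^2, contradicts this unless n =
    0. *)
Lemma Rder_unique (v : C -> R) z l m : Rder v z l -> Rder v z m -> l = m.
Proof.
intros H K.
assert (D := Rder_minus _ _ _ _ _ H K).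
apply Ceq_minus. set (n := (l - m)%C) in *.
apply Cmod_eq_0. apply Rle_antisym; [|apply Cmod_ge_0].
apply Rnot_lt_le. intros P.
destruct (D (Cmod n / 2)) as (d & Hd & A); [lra|].
set (t := d / (2 * Cmod n)). assert (Ht : 0 < t) by (apply Rdiv_lt_0_compat; lra).
specialize (A (z + RtoC t * Cconj n)%C).
replace (z + RtoC t * Cconj n - z)%C with (RtoC t * Cconj n)%C in A by ring.
rewrite Cmod_mult, Cmod_R, Cmod_conj, (Rabs_pos_eq t) in A by lra.
replace (t * Cmod n) with (d / 2) in A by (unfold t; field; lra).
specialize (A ltac:(lra)).
replace (n * (RtoC t * Cconj n))%C with (RtoC t * (n * Cconj n))%C in A by ring.
rewrite <- Cmod2_conj, <- RtoC_mult, re_RtoC in A.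
replace (v (z + t * Cconj n)%C - v (z + t * Cconj n)%C - (v z - v z) - t * Cmod n ^ 2)
  with (- (d / 2 * Cmod n)) in A by (unfold t; field; lra).
rewrite Rabs_Ropp, Rabs_pos_eq in A by nra. nra.
Qed.

Lemma Rder_real_line (v : C -> R) (z d l : C) t :
  Rder v (z + RtoC t * d)%C l ->
  is_derive (fun s : R => v (z + RtoC s * d)%C) t (Re (l * d)%C).
Proof.
intros H. apply (Rder_path v (fun s => z + RtoC s * d)%C); trivial.
intros eps He. exists 1. split; [lra|]. intros s _.
replace (z + RtoC s * d - (z + RtoC t * d) - RtoC (s - t) * d)%C with (RtoC 0)
  by (rewrite RtoC_minus; ring).
rewrite Cmod_0. apply Rmult_le_pos; [lra|apply Rabs_pos].
Qed.

Lemma Rder_MVT (v : C -> R) (dv : C -> C) (z w : C) M :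
  (forall t, 0 <= t <= 1 -> let p := (z + RtoC t * (w - z))%C in
     Rder v p (dv p) /\ Cmod (dv p) <= M) ->
  Rabs (v w - v z) <= M * Cmod (w - z)%C.
Proof.
intros H.
destruct (MVT_gen (fun s : R => v (z + RtoC s * (w - z))%C) 0 1
  (fun s => Re (dv (z + RtoC s * (w - z))%C * (w - z))%C)) as (c & Hc & E).
- intros t Ht. rewrite Rmin_left, Rmax_right in Ht by lra.
  apply Rder_real_line. apply H. lra.
- intros t Ht. rewrite Rmin_left, Rmax_right in Ht by lra.
  apply continuity_pt_filterlim.
  apply (ex_derive_continuous (K := R_AbsRing) (V := R_NormedModule)).
  eexists. apply Rder_real_line. now apply H.
- rewrite Rmin_left, Rmax_right in Hc by lra.
  replace (z + RtoC 1 * (w - z))%C with w in E by ring.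
  replace (z + RtoC 0 * (w - z))%C with z in E by ring.
  rewrite E, Rminus_0_r, Rmult_1_r.
  eapply Rle_trans; [apply re_le_Cmod|]. rewrite Cmod_mult.
  apply Rmult_le_compat_r; [apply Cmod_ge_0|]. now apply H.
Qed.

(** The mean value theorem fails for complex values, so it is applied to the real function Re (c f)
    with c the conjugate of f w - f z; its increment is |f w - f z|^2. *)
Lemma Cder_MVT (f df : C -> C) (z w : C) M :
  (forall t, 0 <= t <= 1 -> let p := (z + RtoC t * (w - z))%C in
     Cder f p (df p) /\ Cmod (df p) <= M) ->
  Cmod (f w - f z)%C <= M * Cmod (w - z)%C.
Proof.
intros H. destruct (Ceq_dec (f w - f z)%C 0) as [E|E].
- rewrite E, Cmod_0. apply Rmult_le_pos; [|apply Cmod_ge_0].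
  destruct (H 0) as [_ K]; [lra|]. eapply Rle_trans; [apply Cmod_ge_0|exact K].
- set (c := Cconj (f w - f z)%C).
  assert (P : 0 < Cmod (f w - f z)%C) by now apply Cmod_gt_0.
  assert (Q : Rabs (Re (c * f w)%C - Re (c * f z)%C) <= (Cmod c * M) * Cmod (w - z)%C).
  { apply (Rder_MVT (fun p => Re (c * f p)%C) (fun p => c * df p)%C).
    intros t Ht p. destruct (H t Ht) as [H1 H2]. split.
    - apply Rder_Re. now apply Cder_scal.
    - rewrite Cmod_mult. apply Rmult_le_compat_l; [apply Cmod_ge_0|exact H2]. }
  replace (Re (c * f w)%C - Re (c * f z)%C) with (Re ((f w - f z) * c)%C) in Q.
  + unfold c in Q. rewrite <- Cmod2_conj in Q. rewrite re_RtoC, Cmod_conj in Q.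
    rewrite Rabs_pos_eq in Q by apply pow2_ge_0.
    apply Rmult_le_reg_l with (1 := P). simpl in Q. lra.
  + replace ((f w - f z) * c)%C with (c * f w + - (c * f z))%C by ring.
    now rewrite re_plus, re_opp.
Qed.

(** * Integrals over the boundary of a rectangle *)

Lemma nested_limit (u : nat -> R) (w : R) : 0 <= w ->
  (forall n, u n <= u (S n) /\ u (S n) + w / 2 ^ S n <= u n + w / 2 ^ n) ->
  exists x, forall n, u n <= x <= u n + w / 2 ^ n.
Proof.
intros Hw H.
assert (P : forall n, 0 <= w / 2 ^ n).
{ intros n. apply Rdiv_le_0_compat; trivial. apply pow_lt; lra. }
assert (M : forall n k, u n <= u (n + k)%nat /\
   u (n + k)%nat + w / 2 ^ (n + k)%nat <= u n + w / 2 ^ n).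
{ intros n k. induction k as [|k IH].
  - rewrite Nat.add_0_r. lra.
  - rewrite Nat.add_succ_r. specialize (H (n + k)%nat). lra. }
assert (B : forall m n, u m <= u n + w / 2 ^ n).
{ intros m n. destruct (Nat.le_ge_cases m n) as [E|E].
  - replace n with (m + (n - m))%nat by lia.
    destruct (M m (n - m)%nat). specialize (P (m + (n - m))%nat). lra.
  - replace m with (n + (m - n))%nat by lia.
    destruct (M n (m - n)%nat). specialize (P (n + (m - n))%nat). lra. }
destruct (completeness (fun y => exists n, y = u n)) as [x [X1 X2]].
- exists (u 0%nat + w / 2 ^ 0). intros y [n ->]. apply B.
- exists (u 0%nat), 0%nat. reflexivity.
- exists x. intros n. split.
  + apply X1. now exists n.
  + apply X2. intros y [m ->]. apply B.
Qed.

Lemma pow2_small (w e : R) : 0 < e -> exists n, w / 2 ^ n < e.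
Proof.
intros He. destruct (pow_lt_1_zero (/ 2)) with (y := e / (Rabs w + 1)) as [N HN].
- rewrite Rabs_pos_eq; lra.
- apply Rdiv_lt_0_compat; trivial. generalize (Rabs_pos w); lra.
- exists N. specialize (HN N (Nat.le_refl N)).
  assert (P : 0 < 2 ^ N) by (apply pow_lt; lra).
  rewrite pow_inv in HN by lra. rewrite Rabs_pos_eq in HN by (left; now apply Rinv_0_lt_compat).
  assert (Q := Rabs_pos w). assert (Q2 := Rle_abs w).
  apply (Rmult_lt_compat_r (Rabs w + 1)) in HN; [|lra].
  replace (e / (Rabs w + 1) * (Rabs w + 1)) with e in HN by (field; lra).
  eapply Rle_lt_trans; [|exact HN]. unfold Rdiv. rewrite Rmult_comm.
  apply Rmult_le_compat_l; [left; now apply Rinv_0_lt_compat|lra].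
Qed.

(** If the property failed, a failing quarter could be chosen again and again; the failing
    rectangles shrink to a point (x, y), and the local hypothesis there contradicts them. This is
    the compactness argument behind both Goursat's theorem ([Goursat]) and the patching of local
    frames ([lift_rect]). *)
Lemma quartering (P : R -> R -> R -> R -> Prop) (a b c d : R) :
  a <= b -> c <= d ->
  (forall a' b' c' d', a <= a' <= b' -> b' <= b -> c <= c' <= d' -> d' <= d ->
    let m := (a' + b') / 2 in let n := (c' + d') / 2 in
    P a' m c' n -> P m b' c' n -> P a' m n d' -> P m b' n d' -> P a' b' c' d') ->
  (forall x y, a <= x <= b -> c <= y <= d -> exists e, 0 < e /\
     forall a' b' c' d', a <= a' <= x -> x <= b' <= b -> c <= c' <= y -> y <= d' <= d ->
       b' - a' < e -> d' - c' < e -> P a' b' c' d') ->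
  P a b c d.
Proof.
intros Hab Hcd Q L. apply NNPP. intros N.
set (w := b - a). set (h := d - c).
assert (p2 : forall n, 0 < 2 ^ n) by (intros; apply pow_lt; lra).
assert (half : forall t n, t / 2 ^ S n = t / 2 ^ n / 2).
{ intros t n. simpl. specialize (p2 n). field. lra. }
(* A rectangle of generation n is recorded by its lower left corner alone, since its sides are w /
   2^n and h / 2^n. *)
set (good := fun (n : nat) (s : R * R) => a <= fst s /\ fst s + w / 2 ^ n <= b /\
  c <= snd s /\ snd s + h / 2 ^ n <= d /\
  ~ P (fst s) (fst s + w / 2 ^ n) (snd s) (snd s + h / 2 ^ n)).
set (step := fun (n : nat) (s t : R * R) =>
  (fst s <= fst t /\ fst t + w / 2 ^ S n <= fst s + w / 2 ^ n) /\
  (snd s <= snd t /\ snd t + h / 2 ^ S n <= snd s + h / 2 ^ n)).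
assert (W : forall n, 0 <= w / 2 ^ n) by (intros; apply Rdiv_le_0_compat; trivial; unfold w; lra).
assert (H : forall n, 0 <= h / 2 ^ n) by (intros; apply Rdiv_le_0_compat; trivial; unfold h; lra).
assert (nx : forall n s, good n s -> exists t, good (S n) t /\ step n s t).
{ intros n [x y] (G1 & G2 & G3 & G4 & G5). simpl in G1, G2, G3, G4, G5. apply NNPP. intros K. apply G5.
  specialize (W n). specialize (H n).
  assert (T : forall x' y', (x' = x \/ x' = x + w / 2 ^ n / 2) ->
     (y' = y \/ y' = y + h / 2 ^ n / 2) ->
     P x' (x' + w / 2 ^ n / 2) y' (y' + h / 2 ^ n / 2)).
  { intros x' y' Hx Hy. apply NNPP. intros K2. apply K. exists (x', y').
    unfold good, step. simpl fst. simpl snd. rewrite (half w n), (half h n). destruct Hx as [->| ->], Hy as [->| ->]; repeat split; trivial; lra. }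
  apply Q; try lra;
    replace ((x + (x + w / 2 ^ n)) / 2) with (x + w / 2 ^ n / 2) by lra;
    replace ((y + (y + h / 2 ^ n)) / 2) with (y + h / 2 ^ n / 2) by lra.
  - apply T; auto.
  - replace (x + w / 2 ^ n) with (x + w / 2 ^ n / 2 + w / 2 ^ n / 2) by lra. apply T; auto.
  - replace (y + h / 2 ^ n) with (y + h / 2 ^ n / 2 + h / 2 ^ n / 2) by lra. apply T; auto.
  - replace (x + w / 2 ^ n) with (x + w / 2 ^ n / 2 + w / 2 ^ n / 2) by lra.
    replace (y + h / 2 ^ n) with (y + h / 2 ^ n / 2 + h / 2 ^ n / 2) by lra. apply T; auto. }
set (nxt := fun n s => epsilon (inhabits (0, 0)) (fun t => good (S n) t /\ step n s t)).
set (u := fix u n := match n with O => (a, c) | S m => nxt m (u m) end).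
assert (G : forall n, good n (u n) /\ step n (u n) (u (S n))).
{ assert (G0 : forall n, good n (u n) -> good (S n) (u (S n)) /\ step n (u n) (u (S n))).
  { intros n Hn. exact (epsilon_spec (inhabits (0, 0))
      (fun t => good (S n) t /\ step n (u n) t) (nx n (u n) Hn)). }
  assert (G1 : forall n, good n (u n)).
  { induction n; [|now apply G0]. unfold good, u; simpl fst; simpl snd.
    replace (a + w / 2 ^ 0) with b by (unfold w; simpl; field).
    replace (c + h / 2 ^ 0) with d by (unfold h; simpl; field). repeat split; trivial; lra. }
  intros n. split; [apply G1|]. now apply G0. }
destruct (nested_limit (fun n => fst (u n)) w) as [x X].
{ specialize (W 0%nat). simpl in W. lra. }
{ intros n. destruct (G n) as [_ [S1 _]]. exact S1. }
destruct (nested_limit (fun n => snd (u n)) h) as [y Y].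
{ specialize (H 0%nat). simpl in H. lra. }
{ intros n. destruct (G n) as [_ [_ S1]]. exact S1. }
assert (Hx : a <= x <= b).
{ specialize (X 0%nat). destruct (G 0%nat) as [(G1 & G2 & _) _]. lra. }
assert (Hy : c <= y <= d).
{ specialize (Y 0%nat). destruct (G 0%nat) as [(_ & _ & G1 & G2 & _) _]. lra. }
destruct (L x y Hx Hy) as (e & He & K).
destruct (pow2_small (w + h) e He) as [n Hn].
destruct (G n) as [(G1 & G2 & G3 & G4 & G5) _]. apply G5.
specialize (X n). specialize (Y n). specialize (W n). specialize (H n).
assert (Es : (w + h) / 2 ^ n = w / 2 ^ n + h / 2 ^ n) by (specialize (p2 n); field; lra).
apply K; lra.
Qed.

Definition RCcont (g : R -> C) (t : R) : Prop :=
  forall eps, 0 < eps -> exists del, 0 < del /\ forall s, Rabs (s - t) < del ->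
    Cmod (g s - g t)%C < eps.

Lemma RCcont_continuous (g : R -> C) t :
  RCcont g t <-> continuous (U := C_R_CompleteNormedModule) g t.
Proof.
unfold continuous. change (RCcont g t <-> filterlim g (locally t) (locally (T := C_UniformSpace) (g t))).
rewrite filterlim_locally. split.
- intros H eps. destruct (H eps (cond_pos eps)) as (d & Hd & K).
  exists (mkposreal _ Hd). intros s Hs. apply ball_Cmod. now apply K.
- intros H eps He. assert (He2 : 0 < eps / 2) by lra.
  specialize (H (mkposreal _ He2)).
  destruct H as [d K]. exists d. split; [apply cond_pos|]. intros s Hs.
  specialize (K s Hs). apply Cmod_ball in K. simpl in K. lra.
Qed.

Lemma RCder_cont g t l : RCder g t l -> RCcont g t.
Proof.
intros H. apply RCcont_continuous.
apply (ex_derive_continuous (K := R_AbsRing) (V := C_R_CompleteNormedModule)).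
exists l. now apply RCder_is_derive in H.
Qed.

Lemma RCcont_comp (f : C -> C) (g : R -> C) t :
  Ccont f (g t) -> RCcont g t -> RCcont (fun s => f (g s)) t.
Proof.
intros H K eps He. destruct (H eps He) as (d & Hd & A).
destruct (K d Hd) as (d' & Hd' & B). exists d'. split; auto.
Qed.

Lemma RCder_hline y t : RCder (fun s => (s, y)) t 1.
Proof.
intros eps He. exists 1. split; [lra|]. intros s _.
replace ((s, y) - (t, y) - RtoC (s - t) * 1)%C with (RtoC 0).
- rewrite Cmod_0. apply Rmult_le_pos; [lra|apply Rabs_pos].
- unfold Cminus, Cplus, Copp, Cmult, RtoC; simpl. f_equal; ring.
Qed.

Lemma RCder_vline x t : RCder (fun s => (x, s)) t Ci.
Proof.
intros eps He. exists 1. split; [lra|]. intros s _.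
replace ((x, s) - (x, t) - RtoC (s - t) * Ci)%C with (RtoC 0).
- rewrite Cmod_0. apply Rmult_le_pos; [lra|apply Rabs_pos].
- unfold Cminus, Cplus, Copp, Cmult, RtoC, Ci; simpl. f_equal; ring.
Qed.

Definition CI (f : R -> C) (a b : R) : C := RInt (V := C_R_CompleteNormedModule) f a b.

Definition CIex (f : R -> C) (a b : R) := ex_RInt (V := C_R_CompleteNormedModule) f a b.

Lemma CI_ex f a b : a <= b -> (forall t, a <= t <= b -> RCcont f t) -> CIex f a b.
Proof.
intros Hab H. apply ex_RInt_continuous. intros t. rewrite Rmin_left, Rmax_right by trivial.
intros Ht. apply RCcont_continuous. auto.
Qed.

Lemma CI_bound f a b M : a <= b -> CIex f a b ->
  (forall t, a <= t <= b -> Cmod (f t) <= M) -> Cmod (CI f a b) <= (b - a) * M.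
Proof.
intros Hab E H. rewrite <- norm_C_R.
apply (norm_RInt_le_const (V := C_R_CompleteNormedModule) f a b); trivial.
- intros x Hx. specialize (H x Hx). rewrite <- norm_C_R in H. exact H.
- exact (RInt_correct (V := C_R_CompleteNormedModule) f a b E).
Qed.

Lemma CI_Chasles f a b c : CIex f a b -> CIex f b c ->
  (CI f a b + CI f b c)%C = CI f a c.
Proof. exact (RInt_Chasles (V := C_R_CompleteNormedModule) f a b c). Qed.

Lemma CI_minus f g a b : CIex f a b -> CIex g a b ->
  CI (fun t => f t - g t)%C a b = (CI f a b - CI g a b)%C.
Proof. exact (RInt_minus (V := C_R_CompleteNormedModule) f g a b). Qed.

Lemma CI_plus f g a b : CIex f a b -> CIex g a b ->
  CI (fun t => f t + g t)%C a b = (CI f a b + CI g a b)%C.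
Proof. exact (RInt_plus (V := C_R_CompleteNormedModule) f g a b). Qed.

Lemma CI_ext f g a b : a <= b -> (forall t, a < t < b -> f t = g t) -> CI f a b = CI g a b.
Proof.
intros Hab H. apply (RInt_ext (V := C_R_CompleteNormedModule)). now rewrite Rmin_left, Rmax_right by trivial.
Qed.

Lemma CI_FTC (g dg : R -> C) a b : a <= b ->
  (forall t, a <= t <= b -> RCder g t (dg t)) ->
  (forall t, a <= t <= b -> RCcont dg t) -> CI dg a b = (g b - g a)%C.
Proof.
intros Hab H K.
apply (is_RInt_unique (V := C_R_CompleteNormedModule)). apply (is_RInt_derive (V := C_R_CompleteNormedModule) g dg).
- intros t. rewrite Rmin_left, Rmax_right by trivial. intros Ht. apply RCder_is_derive. auto.
- intros t. rewrite Rmin_left, Rmax_right by trivial. intros Ht. apply RCcont_continuous. auto.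
Qed.

Definition rect_int (f : C -> C) (a b c d : R) : C :=
  (CI (fun t => f (t, c)) a b + CI (fun t => Ci * f (b, t))%C c d
   - CI (fun t => f (t, d)) a b - CI (fun t => Ci * f (a, t))%C c d)%C.

Definition in_rect (a b c d : R) (z : C) := a <= Re z <= b /\ c <= Im z <= d.

Lemma RCcont_hline f y t : Ccont f (t, y) -> RCcont (fun s => f (s, y)) t.
Proof.
intros H. apply (RCcont_comp f (fun s => (s, y))); trivial.
eapply RCder_cont. apply RCder_hline.
Qed.

Lemma Ccont_scal (c : C) (f : C -> C) z : Ccont f z -> Ccont (fun w => c * f w)%C z.
Proof.
intros H eps He. assert (P : 0 < Cmod c + 1) by (generalize (Cmod_ge_0 c); lra).
destruct (H (eps / (Cmod c + 1))) as (d & Hd & A); [now apply Rdiv_lt_0_compat|].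
exists d. split; trivial. intros w Hw. specialize (A w Hw).
replace (c * f w - c * f z)%C with (c * (f w - f z))%C by ring. rewrite Cmod_mult.
apply (Rmult_lt_compat_l (Cmod c + 1)) in A; trivial.
replace ((Cmod c + 1) * (eps / (Cmod c + 1))) with eps in A by (field; lra).
generalize (Cmod_ge_0 (f w - f z)%C). lra.
Qed.

Lemma RCcont_vline f x t : Ccont f (x, t) -> RCcont (fun s => Ci * f (x, s))%C t.
Proof.
intros H. apply (RCcont_comp (fun z => Ci * f z)%C (fun s => (x, s))); [now apply Ccont_scal|].
eapply RCder_cont. apply RCder_vline.
Qed.

Lemma rect_ex_h f a b c d y : a <= b -> c <= y <= d ->
  (forall z, in_rect a b c d z -> Ccont f z) -> CIex (fun t => f (t, y)) a b.
Proof.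
intros Hab Hy H. apply CI_ex; trivial. intros t Ht. apply RCcont_hline. apply H. split; trivial.
Qed.

Lemma rect_ex_v f a b c d x : c <= d -> a <= x <= b ->
  (forall z, in_rect a b c d z -> Ccont f z) -> CIex (fun t => Ci * f (x, t))%C c d.
Proof.
intros Hab Hy H. apply CI_ex; trivial. intros t Ht. apply RCcont_vline. apply H. split; trivial.
Qed.

Lemma rect_int_quarter f a b c d : a <= b -> c <= d ->
  (forall z, in_rect a b c d z -> Ccont f z) ->
  let m := (a + b) / 2 in let n := (c + d) / 2 in
  rect_int f a b c d = (rect_int f a m c n + rect_int f m b c n +
     rect_int f a m n d + rect_int f m b n d)%C.
Proof.
intros Hab Hcd H m n. assert (a <= m <= b) by (unfold m; lra). assert (c <= n <= d) by (unfold n; lra).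
assert (sub : forall a' b' c' d', a <= a' -> b' <= b -> c <= c' -> d' <= d ->
  forall z, in_rect a' b' c' d' z -> Ccont f z).
{ intros a' b' c' d' ? ? ? ? z [? ?]. apply H. split; lra. }
unfold rect_int.
rewrite <- (CI_Chasles (fun t => f (t, c)) a m b); [| |].
rewrite <- (CI_Chasles (fun t => f (t, d)) a m b); [| |].
rewrite <- (CI_Chasles (fun t => Ci * f (a, t))%C c n d); [| |].
rewrite <- (CI_Chasles (fun t => Ci * f (b, t))%C c n d); [| |].
ring.
all: (apply (rect_ex_h f a b c d) || apply (rect_ex_v f a b c d) || idtac); try lra; try (intros; now apply H).
all: first [ apply (rect_ex_h f a m c d); try lra; now apply sub | idtac ].
all: first [ apply (rect_ex_h f m b c d); try lra; apply sub; lra | idtac ].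
all: first [ apply (rect_ex_v f a b c n); try lra; apply sub; lra | idtac ].
all: first [ apply (rect_ex_v f a b n d); try lra; apply sub; lra | idtac ].
Qed.

Lemma Cder_Ccont_rect f df a b c d :
  (forall z, in_rect a b c d z -> Cder f z (df z)) ->
  forall z, in_rect a b c d z -> Ccont f z.
Proof. intros H z Hz. eapply Cder_cont. now apply H. Qed.

Lemma rect_int_FTC (G g : C -> C) a b c d : a <= b -> c <= d ->
  (forall z, in_rect a b c d z -> Cder G z (g z)) ->
  (forall z, in_rect a b c d z -> Ccont g z) -> rect_int g a b c d = 0.
Proof.
intros Hab Hcd H K.
assert (Hh : forall y, c <= y <= d -> CI (fun t => g (t, y)) a b = (G (b, y) - G (a, y))%C).
{ intros y Hy. apply (CI_FTC (fun t => G (t, y))); trivial.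
  - intros t Ht. replace (g (t, y)) with (g (t, y) * 1)%C by ring.
    apply (RCder_comp G (fun t => (t, y))); [|apply RCder_hline]. apply H. now split.
  - intros t Ht. apply RCcont_hline. apply K. now split. }
assert (Hv : forall x, a <= x <= b -> CI (fun t => Ci * g (x, t))%C c d = (G (x, d) - G (x, c))%C).
{ intros x Hx. apply (CI_FTC (fun t => G (x, t))); trivial.
  - intros t Ht. rewrite Cmult_comm.
    apply (RCder_comp G (fun t => (x, t))); [|apply RCder_vline]. apply H. now split.
  - intros t Ht. apply RCcont_vline. apply K. now split. }
unfold rect_int. rewrite !Hh, !Hv by lra. ring.
Qed.

Lemma rect_int_minus f g a b c d : a <= b -> c <= d ->
  (forall z, in_rect a b c d z -> Ccont f z) ->
  (forall z, in_rect a b c d z -> Ccont g z) ->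
  rect_int (fun z => f z - g z)%C a b c d = (rect_int f a b c d - rect_int g a b c d)%C.
Proof.
intros Hab Hcd Hf Hg. unfold rect_int.
assert (V : forall x, a <= x <= b -> CI (fun t => Ci * (f (x, t) - g (x, t)))%C c d =
  (CI (fun t => Ci * f (x, t)) c d - CI (fun t => Ci * g (x, t)) c d)%C).
{ intros x Hx. rewrite <- CI_minus.
  - apply CI_ext; trivial. intros. ring.
  - apply (rect_ex_v f a b); trivial.
  - apply (rect_ex_v g a b); trivial. }
assert (Hh : forall y, c <= y <= d -> CI (fun t => f (t, y) - g (t, y))%C a b =
  (CI (fun t => f (t, y)) a b - CI (fun t => g (t, y)) a b)%C).
{ intros y Hy. apply CI_minus.
  - apply (rect_ex_h f a b c d); trivial.
  - apply (rect_ex_h g a b c d); trivial. }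
rewrite !Hh, !V by lra.
ring.
Qed.

Lemma rect_int_bound f a b c d M : a <= b -> c <= d ->
  (forall z, in_rect a b c d z -> Ccont f z) ->
  (forall z, in_rect a b c d z -> Cmod (f z) <= M) ->
  Cmod (rect_int f a b c d) <= 2 * ((b - a) + (d - c)) * M.
Proof.
intros Hab Hcd Hf HM. unfold rect_int.
assert (Hh : forall y, c <= y <= d -> Cmod (CI (fun t => f (t, y)) a b) <= (b - a) * M).
{ intros y Hy. apply CI_bound; trivial.
  - apply (rect_ex_h f a b c d); trivial.
  - intros t Ht. apply HM. now split. }
assert (Hv : forall x, a <= x <= b -> Cmod (CI (fun t => Ci * f (x, t))%C c d) <= (d - c) * M).
{ intros x Hx. apply CI_bound; trivial.
  - apply (rect_ex_v f a b c d); trivial.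
  - intros t Ht. rewrite Cmod_mult, Cmod_Ci, Rmult_1_l. apply HM. now split. }
unfold Cminus.
eapply Rle_trans; [apply Cmod_triangle|]. rewrite Cmod_opp.
eapply Rle_trans; [apply Rplus_le_compat_r, Cmod_triangle|]. rewrite Cmod_opp.
eapply Rle_trans; [apply Rplus_le_compat_r, Rplus_le_compat_r, Cmod_triangle|].
assert (H1 := Hh c ltac:(lra)). assert (H2 := Hh d ltac:(lra)).
assert (H3 := Hv a ltac:(lra)). assert (H4 := Hv b ltac:(lra)). lra.
Qed.

Lemma Cmod_Rabs_le (z : C) : Cmod z <= Rabs (Re z) + Rabs (Im z).
Proof.
destruct z as [x y]. simpl.
assert (E : (x, y) = (RtoC x + Ci * RtoC y)%C).
{ unfold Cplus, Cmult, Ci, RtoC. simpl. f_equal; ring. }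
rewrite E. eapply Rle_trans; [apply Cmod_triangle|].
rewrite Cmod_mult, !Cmod_R, Cmod_Ci. lra.
Qed.

Lemma Im_le_Cmod (z : C) : Rabs (Im z) <= Cmod z.
Proof. eapply Rle_trans; [|apply Rmax_Cmod]. apply Rmax_r. Qed.

Lemma in_rect_diff a b c d z p : in_rect a b c d z -> in_rect a b c d p ->
  Cmod (z - p)%C <= (b - a) + (d - c).
Proof.
intros [H1 H2] [H3 H4]. eapply Rle_trans; [apply Cmod_Rabs_le|].
destruct z as [x y], p as [u v]. simpl in H1, H2, H3, H4.
change (Rabs (x - u) + Rabs (y - v) <= b - a + (d - c)).
apply Rplus_le_compat; apply Rabs_le; split; lra.
Qed.

Lemma Ccont_minus (f g : C -> C) z : Ccont f z -> Ccont g z -> Ccont (fun w => f w - g w)%C z.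
Proof.
intros F G eps He. destruct (F (eps / 2)) as (d1 & Hd1 & K1); [lra|].
destruct (G (eps / 2)) as (d2 & Hd2 & K2); [lra|].
exists (Rmin d1 d2). split; [now apply Rmin_glb_lt|]. intros w Hw.
specialize (K1 w (Rlt_le_trans _ _ _ Hw (Rmin_l _ _))).
specialize (K2 w (Rlt_le_trans _ _ _ Hw (Rmin_r _ _))).
replace (f w - g w - (f z - g z))%C with ((f w - f z) + - (g w - g z))%C by ring.
eapply Rle_lt_trans; [apply Cmod_triangle|]. rewrite Cmod_opp. lra.
Qed.

Lemma RtoC_neq (x y : R) : x <> y -> RtoC x <> RtoC y.
Proof. intros H E. now apply H, RtoC_inj. Qed.

(** The bound 2 e s^2, with s the half-perimeter, is stable under quartering because the four
    quarters have half-perimeter s / 2. On small rectangles around p it holds because f differs from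
    an affine function, which has a primitive, by at most e |z - p| <= e s, while the perimeter is 2
    s. *)
Lemma Goursat (f df : C -> C) a b c d : a <= b -> c <= d ->
  (forall z, in_rect a b c d z -> Cder f z (df z)) -> rect_int f a b c d = 0.
Proof.
intros Hab Hcd H.
apply Cmod_eq_0. apply Rle_antisym; [|apply Cmod_ge_0].
set (s := (b - a) + (d - c)). assert (Hs : 0 <= s) by (unfold s; lra).
apply Rnot_lt_le. intros N.
set (r := Cmod (rect_int f a b c d)) in *.
(* With this e the bound 2 e s^2 is less than r / 2, which contradicts r > 0. *)
set (e := r / (4 * (s * s + 1))). assert (He : 0 < e) by (apply Rdiv_lt_0_compat; nra).
assert (Q : r <= 2 * e * (s * s)).
2:{ assert (e * (4 * (s * s + 1)) = r) by (unfold e; field; nra). nra. }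
assert (sub : forall a' b' c' d', a <= a' -> b' <= b -> c <= c' -> d' <= d ->
  forall z, in_rect a' b' c' d' z -> Cder f z (df z)).
{ intros a' b' c' d' ? ? ? ? z [? ?]. apply H. split; lra. }
unfold r, s.
apply (quartering (fun a b c d => Cmod (rect_int f a b c d) <=
  2 * e * (((b - a) + (d - c)) * ((b - a) + (d - c))))); trivial.
- intros a' b' c' d' H1 H2 H3 H4 m n P1 P2 P3 P4.
  rewrite rect_int_quarter; try lra.
  + fold m n.
    replace (m - a') with ((b' - a') / 2) in * by (unfold m; field).
    replace (b' - m) with ((b' - a') / 2) in * by (unfold m; field).
    replace (n - c') with ((d' - c') / 2) in * by (unfold n; field).
    replace (d' - n) with ((d' - c') / 2) in * by (unfold n; field).
    assert (T := Cmod_triangle (rect_int f a' m c' n) (rect_int f m b' c' n)).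
    assert (T2 := Cmod_triangle (rect_int f a' m c' n + rect_int f m b' c' n)%C (rect_int f a' m n d')).
    assert (T3 := Cmod_triangle (rect_int f a' m c' n + rect_int f m b' c' n + rect_int f a' m n d')%C (rect_int f m b' n d')).
    lra.
  + apply (Cder_Ccont_rect f df). apply sub; lra.
- intros x y Hx Hy. destruct (H (x, y) ltac:(now split) e He) as (del & Hd & K).
  exists (del / 2). split; [lra|]. intros a' b' c' d' H1 H2 H3 H4 H5 H6.
  set (p := (x, y) : C) in *. set (l := df p) in *.
  set (g := (fun z => f p + l * (z - p))%C).
  assert (Gc : forall z, Ccont g z).
  { intros z. eapply Cder_cont. apply Cder_plus; [apply Cder_const|].
    apply Cder_scal. apply Cder_minus; [apply Cder_id|apply Cder_const]. }
  assert (G0 : rect_int g a' b' c' d' = 0).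
  { apply (rect_int_FTC (fun z => f p * z + l * ((z - p) * (z - p)) / 2)%C); try lra; trivial.
    intros z _. eapply Cder_eq; [|apply Cder_plus; [apply Cder_scal, Cder_id|
      apply Cder_div; [|apply Cder_scal; apply Cder_mult; apply Cder_minus;
        [apply Cder_id|apply Cder_const|apply Cder_id|apply Cder_const]|apply Cder_const]]].
    - cbv beta. unfold g. field.
    - apply RtoC_neq. lra. }
  assert (Fc : forall z, in_rect a' b' c' d' z -> Ccont f z).
  { apply (Cder_Ccont_rect f df). apply sub; lra. }
  assert (E := rect_int_minus f g a' b' c' d' ltac:(lra) ltac:(lra) Fc (fun z _ => Gc z)).
  rewrite G0 in E. replace (rect_int f a' b' c' d' - 0)%C with (rect_int f a' b' c' d') in E by ring.
  rewrite <- E. set (t := b' - a' + (d' - c')).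
  replace (2 * e * (t * t)) with (2 * t * (e * t)) by ring.
  apply rect_int_bound; try lra.
  + intros z Hz. apply Ccont_minus; auto.
  + intros z Hz. assert (B : Cmod (z - p)%C <= t).
    { apply in_rect_diff; trivial. split; simpl; lra. }
    unfold g. replace (f z - (f p + l * (z - p)))%C with (f z - f p - l * (z - p))%C by ring.
    eapply Rle_trans; [apply K|]. * eapply Rle_lt_trans; [exact B|]. unfold t. lra.
    * apply Rmult_le_compat_l; lra.
Qed.

Lemma CIex_gen f a b : (forall t, Rmin a b <= t <= Rmax a b -> RCcont f t) -> CIex f a b.
Proof.
intros H. apply ex_RInt_continuous. intros t Ht. apply RCcont_continuous. auto.
Qed.

Lemma CI_bound_gen f a b M : CIex f a b ->
  (forall t, Rmin a b <= t <= Rmax a b -> Cmod (f t) <= M) -> Cmod (CI f a b) <= Rabs (b - a) * M.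
Proof.
intros E H. destruct (Rle_dec a b) as [L|L].
- rewrite Rmin_left, Rmax_right in H by trivial.
  rewrite Rabs_pos_eq by lra. now apply CI_bound.
- rewrite Rmin_right, Rmax_left in H by lra. rewrite Rabs_left1 by lra.
  unfold CI. rewrite <- (opp_RInt_swap (V := C_R_CompleteNormedModule)); [|now apply ex_RInt_swap].
  change (opp (RInt (V := C_R_CompleteNormedModule) f b a)) with (- (CI f b a))%C. rewrite Cmod_opp.
  replace (- (b - a)) with (a - b) by ring.
  apply CI_bound; [lra| |trivial]. now apply (ex_RInt_swap (V := C_R_NormedModule)).
Qed.

Lemma CI_const (k : C) a b : CI (fun _ => k) a b = (RtoC (b - a) * k)%C.
Proof.
unfold CI. rewrite (RInt_const (V := C_R_CompleteNormedModule)). apply scal_R_Cmult.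
Qed.

Lemma CIex_const (k : C) a b : CIex (fun _ => k) a b.
Proof. apply ex_RInt_const. Qed.

Lemma CI_osc f k a b M : CIex f a b ->
  (forall t, Rmin a b <= t <= Rmax a b -> Cmod (f t - k)%C <= M) ->
  Cmod (CI f a b - RtoC (b - a) * k)%C <= Rabs (b - a) * M.
Proof.
intros E H. rewrite <- CI_const, <- CI_minus by (trivial; apply CIex_const).
apply CI_bound_gen; trivial.
apply (ex_RInt_minus (V := C_R_NormedModule)); [exact E|apply CIex_const].
Qed.

Definition in_orect (a b c d : R) (z : C) := a < Re z < b /\ c < Im z < d.

(** F integrates f along the path from the corner (a, c) that goes right and then up. The vanishing
    integrals allow the path that goes up and then right as well. The increment from z to w is split
    at (x', y): the vertical part is read off the first path, the horizontal part off the second. *)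
Lemma primitive_rect (f : C -> C) a b c d : a <= b -> c <= d ->
  (forall z, in_rect a b c d z -> Ccont f z) ->
  (forall x y, a <= x <= b -> c <= y <= d -> rect_int f a x c y = 0) ->
  exists F, forall z, in_orect a b c d z -> Cder F z (f z).
Proof.
intros Hab Hcd Hf Z.
set (F := fun z : C => (CI (fun t => f (t, c)) a (Re z) + CI (fun s => Ci * f (Re z, s)) c (Im z))%C).
exists F. intros z [Hx Hy]. set (x := Re z) in *. set (y := Im z) in *.
assert (F2 : forall w, in_rect a b c d w ->
  F w = (CI (fun s => Ci * f (a, s)) c (Im w) + CI (fun t => f (t, Im w)) a (Re w))%C).
{ intros w [H1 H2]. specialize (Z (Re w) (Im w) H1 H2). unfold rect_int in Z. unfold F.
  match type of Z with (?A + ?B - ?K - ?D)%C = _ =>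
    transitivity ((A + B - K - D) + (D + K))%C; [ring|rewrite Z; ring] end. }
intros eps He. destruct (Hf z ltac:(split; fold x y; lra) (eps / 2)) as (d1 & Hd1 & K); [lra|].
set (e := Rmin (d1 / 2) (Rmin (Rmin (x - a) (b - x)) (Rmin (y - c) (d - y)))).
assert (He1 : 0 < e) by (unfold e; repeat apply Rmin_glb_lt; lra).
exists e. split; trivial. intros w Hw.
set (x' := Re w). set (y' := Im w).
assert (L1 : e <= d1 / 2) by apply Rmin_l.
assert (L2 : e <= x - a /\ e <= b - x /\ e <= y - c /\ e <= d - y).
{ unfold e. repeat split.
  - eapply Rle_trans; [apply Rmin_r|]. eapply Rle_trans; [apply Rmin_l|]. apply Rmin_l.
  - eapply Rle_trans; [apply Rmin_r|]. eapply Rle_trans; [apply Rmin_l|]. apply Rmin_r.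
  - eapply Rle_trans; [apply Rmin_r|]. eapply Rle_trans; [apply Rmin_r|]. apply Rmin_l.
  - eapply Rle_trans; [apply Rmin_r|]. eapply Rle_trans; [apply Rmin_r|]. apply Rmin_r. }
assert (Dx : Rabs (x' - x) <= Cmod (w - z)%C).
{ eapply Rle_trans; [|apply re_le_Cmod]. right. f_equal. }
assert (Dy : Rabs (y' - y) <= Cmod (w - z)%C).
{ eapply Rle_trans; [|apply Im_le_Cmod]. right. f_equal. }
assert (Bx : - e < x' - x < e) by (apply (proj1 (Rabs_lt_between _ _)); lra).
assert (By : - e < y' - y < e) by (apply (proj1 (Rabs_lt_between _ _)); lra).
assert (btw : forall u v t, Rmin u v <= t <= Rmax u v -> Rabs (t - u) <= Rabs (v - u)).
{ intros u v t. unfold Rmin, Rmax. destruct (Rle_dec u v); intros ?;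
  [rewrite !Rabs_pos_eq by lra|rewrite !Rabs_left1 by lra]; lra. }
assert (Near : forall t s, Rabs (t - x) <= Rabs (x' - x) -> Rabs (s - y) <= Rabs (y' - y) ->
   Cmod (f (t, s) - f z)%C <= eps / 2 /\ in_rect a b c d (t, s)).
{ intros t s Ht Hs. split.
  - left. apply K. eapply Rle_lt_trans; [apply Cmod_Rabs_le|].
    change (Re ((t, s) - z)%C) with (t - x). change (Im ((t, s) - z)%C) with (s - y). lra.
  - assert (- e < t - x < e) by (apply (proj1 (Rabs_lt_between _ _)); lra).
    assert (- e < s - y < e) by (apply (proj1 (Rabs_lt_between _ _)); lra). split; simpl; lra. }
assert (V : (F w - F (x', y))%C = CI (fun s => Ci * f (x', s))%C y y').
{ unfold F. simpl. fold x' y'. rewrite <- (CI_Chasles (fun s => Ci * f (x', s))%C c y y'); [ring| |].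
  - apply CI_ex; [lra|]. intros t Ht. apply RCcont_vline, Hf. split; simpl; lra.
  - apply CIex_gen. intros t Ht. apply RCcont_vline, Hf.
    apply btw in Ht. apply (Near x' t); lra. }
assert (Hh : (F (x', y) - F z)%C = CI (fun s => f (s, y)) x x').
{ rewrite !F2; [|split; fold x y; lra|split; simpl; lra]. simpl. fold x y.
  rewrite <- (CI_Chasles (fun s => f (s, y))%C a x x'); [ring| |].
  - apply CI_ex; [lra|]. intros t Ht. apply RCcont_hline, Hf. split; simpl; lra.
  - apply CIex_gen. intros t Ht. apply RCcont_hline, Hf.
    apply btw in Ht. apply (Near t y); trivial. rewrite Rminus_diag, Rabs_R0. apply Rabs_pos. }
replace (F w - F z - f z * (w - z))%C with
  ((CI (fun s => Ci * f (x', s)) y y' - RtoC (y' - y) * (Ci * f z)) +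
   (CI (fun s => f (s, y)) x x' - RtoC (x' - x) * f z))%C.
- eapply Rle_trans; [apply Cmod_triangle|].
  assert (B1 : Cmod (CI (fun s => Ci * f (x', s)) y y' - RtoC (y' - y) * (Ci * f z))%C <= Rabs (y' - y) * (eps / 2)).
  { apply CI_osc.
    - apply CIex_gen. intros t Ht. apply RCcont_vline, Hf.
      apply btw in Ht. apply (Near x' t); lra.
    - intros t Ht. apply btw in Ht.
      replace (Ci * f (x', t) - Ci * f z)%C with (Ci * (f (x', t) - f z))%C by ring.
      rewrite Cmod_mult, Cmod_Ci, Rmult_1_l. apply (Near x' t); lra. }
  assert (B2 : Cmod (CI (fun s => f (s, y)) x x' - RtoC (x' - x) * f z)%C <= Rabs (x' - x) * (eps / 2)).
  { assert (Y0 : Rabs (y - y) <= Rabs (y' - y)).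
    { rewrite Rminus_diag, Rabs_R0. apply Rabs_pos. }
    apply CI_osc.
    - apply CIex_gen. intros t Ht. apply RCcont_hline, Hf.
      apply btw in Ht. now apply (Near t y).
    - intros t Ht. apply btw in Ht. now apply (Near t y). }
  nra.
- rewrite <- V, <- Hh.
  assert (E : (w - z)%C = (RtoC (x' - x) + RtoC (y' - y) * Ci)%C).
  { unfold x, x', y, y'. destruct z, w. unfold Cminus, Cplus, Copp, Cmult, RtoC, Ci. simpl. f_equal; ring. }
  rewrite E. ring.
Qed.

Lemma primitive_holo (f df : C -> C) a b c d : a <= b -> c <= d ->
  (forall z, in_rect a b c d z -> Cder f z (df z)) ->
  exists F, forall z, in_orect a b c d z -> Cder F z (f z).
Proof.
intros Hab Hcd H. apply primitive_rect; trivial.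
- eapply Cder_Ccont_rect. exact H.
- intros x y Hx Hy. apply (Goursat f df); try lra.
  intros z [? ?]. apply H. split; lra.
Qed.

(** * Cauchy's formula and removable singularities *)

Lemma is_derive_eps (f : R -> R) t l : is_derive f t l ->
  forall eps, 0 < eps -> exists d, 0 < d /\ forall s, Rabs (s - t) < d ->
    Rabs (f s - f t - (s - t) * l) <= eps * Rabs (s - t).
Proof.
intros [_ H] eps He. destruct (H t (fun P HP => HP) (mkposreal _ He)) as [d K].
exists d. split; [apply cond_pos|]. intros s Hs. exact (K s Hs).
Qed.

Lemma RCder_pair (p q : R -> R) t l m : is_derive p t l -> is_derive q t m ->
  RCder (fun s => (p s, q s)) t (l, m).
Proof.
intros H K eps He.
destruct (is_derive_eps _ _ _ H (eps / 2)) as (d & Hd & A); [lra|].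
destruct (is_derive_eps _ _ _ K (eps / 2)) as (d' & Hd' & B); [lra|].
exists (Rmin d d'). split; [now apply Rmin_glb_lt|]. intros s Hs.
specialize (A s (Rlt_le_trans _ _ _ Hs (Rmin_l _ _))).
specialize (B s (Rlt_le_trans _ _ _ Hs (Rmin_r _ _))).
eapply Rle_trans; [apply Cmod_Rabs_le|].
change (Re ((p s, q s) - (p t, q t) - RtoC (s - t) * (l, m))%C)
  with (p s - p t - ((s - t) * l - 0 * m)).
change (Im ((p s, q s) - (p t, q t) - RtoC (s - t) * (l, m))%C)
  with (q s - q t - ((s - t) * m + 0 * l)).
rewrite !Rmult_0_l, Rminus_0_r, Rplus_0_r. lra.
Qed.

Definition circ (r t : R) : C := (r * cos t, r * sin t).

Lemma circ_der r t : RCder (circ r) t (Ci * circ r t)%C.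
Proof.
replace (Ci * circ r t)%C with (- (r * sin t), r * cos t).
- apply (RCder_pair (fun t => r * cos t) (fun t => r * sin t)); auto_derive; trivial; ring.
- unfold Ci, circ, Cmult. simpl. f_equal; ring.
Qed.

Lemma Cmod_circ r t : Cmod (circ r t) = Rabs r.
Proof.
unfold Cmod, circ. simpl. replace (r * cos t * (r * cos t * 1) + r * sin t * (r * sin t * 1))
  with (Rsqr r * (Rsqr (sin t) + Rsqr (cos t))) by (unfold Rsqr; ring).
rewrite sin2_cos2, Rmult_1_r. apply sqrt_Rsqr_abs.
Qed.

Lemma circ_2PI r : circ r (2 * PI) = circ r 0.
Proof. unfold circ. now rewrite cos_2PI, sin_2PI, cos_0, sin_0. Qed.

Lemma CI_pair f a b : CIex f a b ->
  CI f a b = (RInt (fun t => Re (f t)) a b, RInt (fun t => Im (f t)) a b)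
  /\ ex_RInt (fun t => Re (f t)) a b /\ ex_RInt (fun t => Im (f t)) a b.
Proof.
intros E. assert (K := RInt_correct (V := C_R_CompleteNormedModule) f a b E).
assert (K1 := is_RInt_fct_extend_fst (U := R_NormedModule) (V := R_NormedModule) f a b _ K).
assert (K2 := is_RInt_fct_extend_snd (U := R_NormedModule) (V := R_NormedModule) f a b _ K).
split; [|split].
- apply injective_projections; symmetry; apply is_RInt_unique; [exact K1|exact K2].
- eexists; exact K1.
- eexists; exact K2.
Qed.

Lemma CI_scal (k : C) f a b : CIex f a b ->
  CI (fun t => k * f t)%C a b = (k * CI f a b)%C /\ CIex (fun t => k * f t)%C a b.
Proof.
intros E. destruct (CI_pair f a b E) as (P & E1 & E2).
assert (Q : is_RInt (V := C_R_CompleteNormedModule) (fun t => k * f t)%C a b (k * CI f a b)%C).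
{ rewrite P. destruct k as [u v].
  assert (I1 := RInt_correct _ _ _ E1). assert (I2 := RInt_correct _ _ _ E2).
  apply (is_RInt_fct_extend_pair (U := R_NormedModule) (V := R_NormedModule)).
  - apply (is_RInt_minus (V := R_NormedModule) (fun t => u * Re (f t)) (fun t => v * Im (f t)));
    now apply (is_RInt_scal (V := R_NormedModule)).
  - apply (is_RInt_plus (V := R_NormedModule) (fun t => u * Im (f t)) (fun t => v * Re (f t)));
    now apply (is_RInt_scal (V := R_NormedModule)). }
split.
- now apply (is_RInt_unique (V := C_R_CompleteNormedModule)).
- eexists; exact Q.
Qed.

Lemma CIex_plus f g a b : CIex f a b -> CIex g a b -> CIex (fun t => f t + g t)%C a b.
Proof. apply (ex_RInt_plus (V := C_R_NormedModule)). Qed.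

Lemma CIex_minus f g a b : CIex f a b -> CIex g a b -> CIex (fun t => f t - g t)%C a b.
Proof. apply (ex_RInt_minus (V := C_R_NormedModule)). Qed.

(** A remainder that is quadratic in w - z, uniformly in t, survives integration; no exchange of
    limits has to be justified. *)
Lemma Cder_CI_param (K : C -> R -> C) (K1 : R -> C) (z : C) a b d M : a <= b -> 0 < d ->
  (forall w, Cmod (w - z)%C < d -> CIex (K w) a b) -> CIex K1 a b ->
  (forall w t, Cmod (w - z)%C < d -> a <= t <= b ->
     Cmod (K w t - K z t - (w - z) * K1 t)%C <= M * Cmod (w - z)%C ^ 2) ->
  Cder (fun w => CI (K w) a b) z (CI K1 a b).
Proof.
intros Hab Hd E E1 B eps He.
assert (P : 0 < (b - a) * Rabs M + 1).
{ assert (0 <= (b - a) * Rabs M) by (apply Rmult_le_pos; [lra|apply Rabs_pos]). lra. }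
exists (Rmin d (eps / ((b - a) * Rabs M + 1))). split.
{ apply Rmin_glb_lt; trivial. now apply Rdiv_lt_0_compat. }
intros w Hw. assert (H1 := Rlt_le_trans _ _ _ Hw (Rmin_l _ _)).
assert (H2 := Rlt_le_trans _ _ _ Hw (Rmin_r _ _)).
assert (Ez : CIex (K z) a b).
{ apply E. unfold Cminus. rewrite Cplus_opp_r, Cmod_0. exact Hd. }
destruct (CI_scal (w - z)%C K1 a b E1) as [S1 S2].
rewrite (Cmult_comm (CI K1 a b)), <- S1, <- CI_minus, <- CI_minus; auto using CIex_minus.
eapply Rle_trans; [apply (CI_bound _ _ _ (M * Cmod (w - z)%C ^ 2)); auto using CIex_minus|].
set (u := Cmod (w - z)%C) in *. assert (Hu : 0 <= u) by apply Cmod_ge_0.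
apply (Rmult_lt_compat_r ((b - a) * Rabs M + 1)) in H2; trivial.
replace (eps / ((b - a) * Rabs M + 1) * ((b - a) * Rabs M + 1)) with eps in H2 by (field; lra).
assert (M <= Rabs M) by apply Rle_abs.
replace ((b - a) * (M * u ^ 2)) with (((b - a) * M * u) * u) by ring.
apply Rmult_le_compat_r; trivial.
assert ((b - a) * M * u <= (b - a) * Rabs M * u).
{ apply Rmult_le_compat_r; trivial. apply Rmult_le_compat_l; lra. }
lra.
Qed.

(** Taylor's formula of order two at z: the remainder E has derivative G p - G z - g' (p - z) = o(|p
    - z|), so by the mean value inequality its increment is o(|w - z|^2), and division by w - z
    leaves o(|w - z|). *)
Lemma Cdist_quotient (F G : C -> C) (z g' : C) d0 : 0 < d0 ->
  (forall w, Cmod (w - z)%C < d0 -> Cder F w (G w)) -> Cder G z g' ->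
  Cder (fun w => if Ceq_dec w z then G z else ((F w - F z) / (w - z))%C) z (g' / 2)%C.
Proof.
intros Hd0 HF HG eps He. destruct (HG eps He) as (d & Hd & K).
exists (Rmin d d0). split; [now apply Rmin_glb_lt|]. intros w Hw.
assert (H1 := Rlt_le_trans _ _ _ Hw (Rmin_l _ _)).
assert (H2 := Rlt_le_trans _ _ _ Hw (Rmin_r _ _)).
destruct (Ceq_dec z z) as [_|N]; [|now elim N].
destruct (Ceq_dec w z) as [->|N].
{ replace (G z - G z - g' / 2 * (z - z))%C with (RtoC 0).
  - rewrite Cmod_0. apply Rmult_le_pos; [lra|apply Cmod_ge_0].
  - unfold Cdiv. ring. }
assert (N' : (w - z)%C <> 0) by now apply Cminus_eq_contra.
assert (P : 0 < Cmod (w - z)%C) by now apply Cmod_gt_0.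
set (E := fun p => (F p - G z * (p - z) - g' / 2 * ((p - z) * (p - z)))%C).
assert (Q : Cmod (E w - E z)%C <= (eps * Cmod (w - z)%C) * Cmod (w - z)%C).
{ apply (Cder_MVT E (fun p => G p - G z - g' * (p - z))%C).
  intros t Ht p.
  assert (T : Cmod (p - z)%C <= Cmod (w - z)%C).
  { unfold p. replace (z + RtoC t * (w - z) - z)%C with (RtoC t * (w - z))%C by ring.
    rewrite Cmod_mult, Cmod_R, Rabs_pos_eq by lra. rewrite <- (Rmult_1_l (Cmod (w - z)%C)) at 2.
    apply Rmult_le_compat_r; lra. }
  split.
  - eapply Cder_eq; [|apply Cder_minus; [apply Cder_minus; [apply HF; lra|
      apply Cder_scal, Cder_minus; [apply Cder_id|apply Cder_const]]|
      apply Cder_scal, Cder_mult; apply Cder_minus;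
       [apply Cder_id|apply Cder_const|apply Cder_id|apply Cder_const]]].
    cbv beta. field.
  - eapply Rle_trans; [apply K; lra|]. apply Rmult_le_compat_l; lra. }
replace ((F w - F z) / (w - z) - G z - g' / 2 * (w - z))%C with ((E w - E z) / (w - z))%C.
- rewrite Cmod_div by exact N'. apply Rle_div_l; trivial.
- unfold E. field. trivial.
Qed.

Lemma RCcont_mult (f g : R -> C) t : RCcont f t -> RCcont g t -> RCcont (fun s => f s * g s)%C t.
Proof.
intros H K eps He.
set (M := Cmod (f t) + Cmod (g t) + 1).
assert (HM : 1 <= M) by (unfold M; generalize (Cmod_ge_0 (f t)) (Cmod_ge_0 (g t)); lra).
assert (P : 0 < Rmin 1 (eps / 3 / M)).
{ apply Rmin_glb_lt; [lra|]. repeat apply Rdiv_lt_0_compat; lra. }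
destruct (H _ P) as (d & Hd & A). destruct (K _ P) as (d' & Hd' & B).
exists (Rmin d d'). split; [now apply Rmin_glb_lt|]. intros s Hs.
specialize (A s (Rlt_le_trans _ _ _ Hs (Rmin_l _ _))).
specialize (B s (Rlt_le_trans _ _ _ Hs (Rmin_r _ _))).
set (q := eps / 3 / M) in *.
assert (Eq : q * M = eps / 3) by (unfold q; field; lra).
assert (M1 := Rmin_l 1 q). assert (M2 := Rmin_r 1 q).
replace (f s * g s - f t * g t)%C with
  ((f s - f t) * (g s - g t) + (f s - f t) * g t + f t * (g s - g t))%C by ring.
eapply Rle_lt_trans; [apply Cmod_triangle|].
eapply Rle_lt_trans; [apply Rplus_le_compat_r, Cmod_triangle|]. rewrite !Cmod_mult.
assert (X := Cmod_ge_0 (f s - f t)%C). assert (Y := Cmod_ge_0 (g s - g t)%C).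
assert (X' := Cmod_ge_0 (f t)). assert (Y' := Cmod_ge_0 (g t)).
assert (Cmod (f s - f t)%C * Cmod (g s - g t)%C <= q * 1) by (apply Rmult_le_compat; lra).
assert (Cmod (f s - f t)%C * Cmod (g t) <= q * Cmod (g t)) by (apply Rmult_le_compat_r; lra).
assert (Cmod (f t) * Cmod (g s - g t)%C <= Cmod (f t) * q) by (apply Rmult_le_compat_l; lra).
unfold M in Eq. assert (0 < eps / 3) by lra. lra.
Qed.

Lemma RCcont_inv (f : R -> C) t : f t <> 0 -> RCcont f t -> RCcont (fun s => / f s)%C t.
Proof.
intros N H. apply (RCcont_comp Cinv f); trivial.
eapply Cder_cont. exact (Cder_inv_id (f t) N).
Qed.

Lemma RCcont_const (k : C) t : RCcont (fun _ => k) t.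
Proof.
intros eps He. exists 1. split; [lra|]. intros s _. unfold Cminus.
rewrite Cplus_opp_r, Cmod_0. exact He.
Qed.

Lemma RCcont_minus (f g : R -> C) t : RCcont f t -> RCcont g t -> RCcont (fun s => f s - g s)%C t.
Proof.
intros H K eps He. destruct (H (eps / 2)) as (d & Hd & A); [lra|].
destruct (K (eps / 2)) as (d' & Hd' & B); [lra|].
exists (Rmin d d'). split; [now apply Rmin_glb_lt|]. intros s Hs.
specialize (A s (Rlt_le_trans _ _ _ Hs (Rmin_l _ _))).
specialize (B s (Rlt_le_trans _ _ _ Hs (Rmin_r _ _))).
replace (f s - g s - (f t - g t))%C with ((f s - f t) + - (g s - g t))%C by ring.
eapply Rle_lt_trans; [apply Cmod_triangle|]. rewrite Cmod_opp. lra.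
Qed.

(** * Integrals of Cauchy type over a circle, for a continuous density *)

Section Cauchy.
Variables (psi : R -> C) (r : R).
Hypothesis Hr : 0 < r.
Hypothesis psi_cont : forall t, 0 <= t <= 2 * PI -> RCcont psi t.

Lemma two_PI_ge0 : 0 <= 2 * PI.
Proof. generalize PI_RGT_0. lra. Qed.

Lemma circ_far z t : Cmod z < r -> r - Cmod z <= Cmod (circ r t - z)%C.
Proof.
intros H. assert (K := Cmod_rev_tri (circ r t) z). rewrite Cmod_circ, Rabs_pos_eq in K; lra.
Qed.

Lemma circ_neq z t : Cmod z < r -> (circ r t - z)%C <> 0.
Proof. intros H. apply Cmod_gt_0. generalize (circ_far z t H). lra. Qed.

Lemma circ_kernel_cont z t : Cmod z < r -> RCcont (fun s => / (circ r s - z))%C t.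
Proof.
intros H. apply RCcont_inv; [now apply circ_neq|].
apply RCcont_minus; [|apply RCcont_const]. eapply RCder_cont, circ_der.
Qed.

Lemma psi_bounded : exists B, forall t, 0 <= t <= 2 * PI -> Cmod (psi t) <= B.
Proof.
destruct (continuity_ab_maj (fun t => Cmod (psi t)) 0 (2 * PI) two_PI_ge0) as (m & Hm & _).
- intros t Ht e He. destruct (psi_cont t Ht e He) as (d & Hd & K). exists d. split; trivial.
  intros s [_ Hs]. specialize (K s Hs).
  change (Rabs (Cmod (psi s) - Cmod (psi t)) < e).
  eapply Rle_lt_trans; [|exact K]. apply Rabs_le. split.
  + generalize (Cmod_rev_tri (psi t) (psi s)). rewrite Cmod_sub_sym. lra.
  + apply Cmod_rev_tri.
- exists (Cmod (psi m)). exact Hm.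
Qed.

(** The kernels of the three integrals are 1 / (u - z) and its first two derivatives in z. The
    tangent factor of the contour is absorbed in the density [psi]. *)
Definition cauchy1 z := CI (fun t => psi t * / (circ r t - z))%C 0 (2 * PI).
Definition cauchy2 z := CI (fun t => psi t * (/ (circ r t - z) * / (circ r t - z)))%C 0 (2 * PI).
Definition cauchy3 z := CI (fun t => psi t * (2 * (/ (circ r t - z) *
   (/ (circ r t - z) * / (circ r t - z)))))%C 0 (2 * PI).

Lemma cauchy1_ex z : Cmod z < r -> CIex (fun t => psi t * / (circ r t - z))%C 0 (2 * PI).
Proof.
intros H. apply CI_ex; [apply two_PI_ge0|]. intros t Ht.
apply RCcont_mult; auto using circ_kernel_cont.
Qed.

Lemma cauchy2_ex z : Cmod z < r ->
  CIex (fun t => psi t * (/ (circ r t - z) * / (circ r t - z)))%C 0 (2 * PI).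
Proof.
intros H. apply CI_ex; [apply two_PI_ge0|]. intros t Ht.
repeat apply RCcont_mult; auto using circ_kernel_cont.
Qed.

Lemma cauchy3_ex z : Cmod z < r ->
  CIex (fun t => psi t * (2 * (/ (circ r t - z) *
   (/ (circ r t - z) * / (circ r t - z)))))%C 0 (2 * PI).
Proof.
intros H. apply CI_ex; [apply two_PI_ge0|]. intros t Ht.
repeat apply RCcont_mult; auto using circ_kernel_cont, RCcont_const.
Qed.

Lemma cauchy_near z w : Cmod z < r -> Cmod (w - z)%C < (r - Cmod z) / 2 ->
  forall t, let q := 2 / (r - Cmod z) in
  Cmod w < r /\ Cmod (/ (circ r t - w))%C <= q /\ Cmod (/ (circ r t - z))%C <= q.
Proof.
intros Hz Hw t q.
assert (W : Cmod w < (r + Cmod z) / 2) by (generalize (Cmod_rev_tri w z); lra).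
assert (W' : Cmod w < r) by lra. split; trivial.
assert (I : forall u, 0 < u -> (r - Cmod z) / 2 <= u -> / u <= q).
{ intros u Hu K. unfold q. apply Rmult_le_reg_l with u; trivial. rewrite Rinv_r by lra.
  apply Rmult_le_reg_r with (r - Cmod z); [lra|].
  replace (u * (2 / (r - Cmod z)) * (r - Cmod z)) with (2 * u) by (field; lra). lra. }
rewrite !Cmod_inv by (now apply circ_neq).
assert (K1 := circ_far w t W'). assert (K2 := circ_far z t Hz).
split; apply I; lra.
Qed.

Lemma cauchy1_der z : Cmod z < r -> Cder cauchy1 z (cauchy2 z).
Proof.
intros Hz. destruct psi_bounded as [B HB].
set (q := 2 / (r - Cmod z)).
apply (Cder_CI_param (fun w t => psi t * / (circ r t - w))%C _ z 0 (2 * PI)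
  ((r - Cmod z) / 2) (B * (q * (q * q)))).
- apply two_PI_ge0.
- lra.
- intros w Hw. apply cauchy1_ex. now apply (cauchy_near z w Hz Hw 0).
- now apply cauchy2_ex.
- intros w t Hw Ht. destruct (cauchy_near z w Hz Hw t) as (W & Q1 & Q2). fold q in Q1, Q2.
  assert (N1 := circ_neq w t W). assert (N2 := circ_neq z t Hz).
  replace (psi t * / (circ r t - w) - psi t * / (circ r t - z) -
     (w - z) * (psi t * (/ (circ r t - z) * / (circ r t - z))))%C
  with ((psi t * (/ (circ r t - w) * (/ (circ r t - z) * / (circ r t - z)))) * ((w - z) * (w - z)))%C
  by (field; auto).
  rewrite !Cmod_mult. simpl. rewrite Rmult_1_r. apply Rmult_le_compat_r.
  { apply Rmult_le_pos; apply Cmod_ge_0. }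
  repeat (apply Rmult_le_compat; auto using Cmod_ge_0, Rmult_le_pos).
Qed.

Lemma cauchy2_der z : Cmod z < r -> Cder cauchy2 z (cauchy3 z).
Proof.
intros Hz. destruct psi_bounded as [B HB].
set (q := 2 / (r - Cmod z)).
apply (Cder_CI_param (fun w t => psi t * (/ (circ r t - w) * / (circ r t - w)))%C _ z 0 (2 * PI)
  ((r - Cmod z) / 2) (B * (3 * (q * (q * (q * q)))))).
- apply two_PI_ge0.
- lra.
- intros w Hw. apply cauchy2_ex. now apply (cauchy_near z w Hz Hw 0).
- now apply cauchy3_ex.
- intros w t Hw Ht. destruct (cauchy_near z w Hz Hw t) as (W & Q1 & Q2). fold q in Q1, Q2.
  assert (N1 := circ_neq w t W). assert (N2 := circ_neq z t Hz).
  set (a := (/ (circ r t - z))%C) in *. set (b := (/ (circ r t - w))%C) in *.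
  replace (psi t * (b * b) - psi t * (a * a) - (w - z) * (psi t * (2 * (a * (a * a)))))%C
  with ((psi t * (a * (a * (a * b)) + a * (a * (a * b)) + a * (a * (b * b)))) * ((w - z) * (w - z)))%C
  by (unfold a, b; field; auto).
  rewrite !Cmod_mult. simpl. rewrite Rmult_1_r. apply Rmult_le_compat_r.
  { apply Rmult_le_pos; apply Cmod_ge_0. }
  apply Rmult_le_compat; auto using Cmod_ge_0.
  eapply Rle_trans; [apply Cmod_triangle|].
  eapply Rle_trans; [apply Rplus_le_compat_r, Cmod_triangle|]. rewrite !Cmod_mult.
  assert (T : forall x y u v, Cmod x <= q -> Cmod y <= q -> Cmod u <= q -> Cmod v <= q ->
    Cmod x * (Cmod y * (Cmod u * Cmod v)) <= q * (q * (q * q))).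
  { intros. repeat (apply Rmult_le_compat; auto using Cmod_ge_0, Rmult_le_pos). }
  assert (T1 := T a a a b Q2 Q2 Q2 Q1). assert (T2 := T a a b b Q2 Q2 Q1 Q1). lra.
Qed.

End Cauchy.

Lemma RCder_mult_const (k : C) (g : R -> C) t l : RCder g t l ->
  RCder (fun s => k * g s)%C t (k * l)%C.
Proof.
intros H. apply (RCder_comp (fun z => k * z)%C g); trivial.
eapply Cder_eq; [|apply Cder_scal, Cder_id]. ring.
Qed.

Lemma RCder_eq (g : R -> C) t l l' : l = l' -> RCder g t l -> RCder g t l'.
Proof. now intros ->. Qed.

Lemma RCder_plus (f g : R -> C) t l m : RCder f t l -> RCder g t m ->
  RCder (fun s => f s + g s)%C t (l + m)%C.
Proof.
intros H K eps He. destruct (H (eps / 2)) as (d & Hd & A); [lra|].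
destruct (K (eps / 2)) as (d' & Hd' & B); [lra|].
exists (Rmin d d'). split; [now apply Rmin_glb_lt|]. intros s Hs.
specialize (A s (Rlt_le_trans _ _ _ Hs (Rmin_l _ _))).
specialize (B s (Rlt_le_trans _ _ _ Hs (Rmin_r _ _))).
replace (f s + g s - (f t + g t) - RtoC (s - t) * (l + m))%C with
  ((f s - f t - RtoC (s - t) * l) + (g s - g t - RtoC (s - t) * m))%C by ring.
eapply Rle_trans; [apply Cmod_triangle|]. lra.
Qed.

Lemma Cmod_box (z : C) r : Cmod z <= r -> in_rect (- r) r (- r) r z.
Proof.
intros H. split.
- generalize (re_le_Cmod z). intros K. apply Rabs_le_between. lra.
- generalize (Im_le_Cmod z). intros K. apply Rabs_le_between. lra.
Qed.

Lemma Cmod_obox (z : C) r : Cmod z < r -> in_orect (- r) r (- r) r z.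
Proof.
intros H. split.
- generalize (re_le_Cmod z). intros K. apply Rabs_lt_between. lra.
- generalize (Im_le_Cmod z). intros K. apply Rabs_lt_between. lra.
Qed.

Lemma orect_open a b c d z : in_orect a b c d z ->
  exists e, 0 < e /\ forall w, Cmod (w - z)%C < e -> in_orect a b c d w.
Proof.
intros [H1 H2].
exists (Rmin (Rmin (Re z - a) (b - Re z)) (Rmin (Im z - c) (d - Im z))). split.
- repeat apply Rmin_glb_lt; lra.
- intros w Hw.
  assert (A := re_le_Cmod (w - z)%C). assert (B := Im_le_Cmod (w - z)%C).
  change (Re (w - z)%C) with (Re w - Re z) in A. change (Im (w - z)%C) with (Im w - Im z) in B.
  set (m := Rmin _ _) in Hw.
  assert (m <= Re z - a /\ m <= b - Re z /\ m <= Im z - c /\ m <= d - Im z).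
  { unfold m. repeat split.
    - eapply Rle_trans; [apply Rmin_l|]; apply Rmin_l.
    - eapply Rle_trans; [apply Rmin_l|]; apply Rmin_r.
    - eapply Rle_trans; [apply Rmin_r|]; apply Rmin_l.
    - eapply Rle_trans; [apply Rmin_r|]; apply Rmin_r. }
  assert (A' : - m < Re w - Re z < m) by (apply Rabs_lt_between; lra).
  assert (B' : - m < Im w - Im z < m) by (apply Rabs_lt_between; lra).
  split; lra.
Qed.

(** With u on the circle, the kernel z / (u - z) has the primitive - i log (1 - z / u), which is
    periodic because 1 - z / u stays in a disc of radius q < 1 around 1. Since u / (u - z) = 1 + z /
    (u - z), this says that the circle winds once around z. *)
Lemma winding_kernel (z : C) r : Cmod z < r ->
  exists P : R -> C, P 0 = P (2 * PI) /\
    forall t, RCder P t (z * / (circ r t - z))%C.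
Proof.
intros Hz. assert (Hr : 0 < r) by (generalize (Cmod_ge_0 z); lra).
assert (Hq : Cmod z / r < 1) by (apply Rlt_div_l; lra).
assert (Hq0 : 0 <= Cmod z / r) by (apply Rdiv_le_0_compat; [apply Cmod_ge_0|lra]).
set (q := Cmod z / r) in *. set (e := (1 - q) / 2).
(* The branch of the logarithm is built on a rectangle in the right half-plane whose left side e =
   (1 - q) / 2 lies strictly between 0 and 1 - q. *)
destruct (primitive_holo (fun w => / w)%C (fun w => - / (w * w))%C e 3 (-2) 2) as [L HL].
- unfold e; lra.
- lra.
- intros w [H _]. apply Cder_inv_id. intros ->. simpl in H. unfold e in H. lra.
- exists (fun t => (- Ci) * L (1 - z / circ r t))%C. split.
  { now rewrite circ_2PI. }
  intros t. assert (N := circ_neq r Hr z t Hz).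
  assert (N0 : circ r t <> 0).
  { apply Cmod_gt_0. rewrite Cmod_circ, Rabs_pos_eq; lra. }
  assert (B : Cmod (z / circ r t)%C <= q).
  { rewrite Cmod_div, Cmod_circ, Rabs_pos_eq by (trivial; lra). apply Rle_refl. }
  eapply RCder_eq; [|apply RCder_mult_const; apply (RCder_comp L (fun t => 1 - z / circ r t)%C t
     (/ (1 - z / circ r t))%C);
    [|apply (RCder_comp (fun w => 1 - z / w)%C (circ r) t); [|apply circ_der]]].
  + instantiate (1 := (z / (circ r t * circ r t))%C).
    match goal with |- _ = ?rhs => transitivity ((- (Ci * Ci)) * rhs)%C end.
    * field. auto.
    * replace (Ci * Ci)%C with (- (1))%C; [ring|].
      unfold Ci, Cmult, RtoC, Copp. simpl. f_equal; ring.
  + apply HL. apply Cmod_box in B. destruct B as [B1 B2].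
    destruct (z / circ r t)%C as [x y]. simpl in B1, B2. unfold in_orect, e. simpl. lra.
  + eapply Cder_eq; [|apply Cder_minus; [apply Cder_const|apply Cder_div;
      [exact N0|apply Cder_const|apply Cder_id]]]. cbv beta. field. exact N0.
Qed.

(** Two derivatives of F are assumed, so that the difference quotient h of F at z is differentiable
    at z too and therefore has a primitive P. Along the circle the integrand then has the primitive
    - i P + F(z) (Q + t) with P and Q periodic, and only t contributes. The formula is applied to a
    primitive of a differentiable function, for which both derivatives are at hand. *)
Lemma Cauchy_formula (F G G' : C -> C) r R : 0 < r < R ->
  (forall w, in_rect (- R) R (- R) R w -> Cder F w (G w) /\ Cder G w (G' w)) ->
  forall z, Cmod z < r ->
  CI (fun t => F (circ r t) * (circ r t * / (circ r t - z)))%C 0 (2 * PI) = (RtoC (2 * PI) * F z)%C.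
Proof.
intros Hr H z Hz.
assert (H2pi := two_PI_ge0).
set (h := fun w => if Ceq_dec w z then G z else ((F w - F z) / (w - z))%C).
set (R1 := (r + R) / 2).
assert (bx : forall w, in_rect (- R1) R1 (- R1) R1 w -> in_orect (- R) R (- R) R w).
{ unfold R1. intros w [? ?]. split; lra. }
assert (Hh : forall w, exists l, in_rect (- R1) R1 (- R1) R1 w -> Cder h w l).
{ intros w. destruct (Ceq_dec w z) as [->|N].
  - exists (G' z / 2)%C. intros Hw. destruct (orect_open _ _ _ _ _ (bx _ Hw)) as (d & Hd & K).
    apply (Cdist_quotient F G z (G' z) d); trivial.
    + intros w K1. apply K in K1. apply H. destruct K1; split; lra.
    + apply H. destruct (bx _ Hw); split; lra.
  - exists ((G w * (w - z) - (F w - F z) * 1) / ((w - z) * (w - z)))%C. intros Hw.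
    assert (N' : (w - z)%C <> 0) by now apply Cminus_eq_contra.
    apply Cder_ext_loc with (fun w => (F w - F z) / (w - z))%C.
    + exists (Cmod (w - z)%C). split; [now apply Cmod_gt_0|].
      intros v Hv. unfold h. destruct (Ceq_dec v z) as [->|]; trivial.
      rewrite Cmod_sub_sym in Hv. lra.
    + eapply Cder_eq; [|apply Cder_div; [exact N'|apply Cder_minus;
        [apply (H w); destruct (bx _ Hw); split; lra|apply Cder_const]|
         apply Cder_minus; [apply Cder_id|apply Cder_const]]].
      cbv beta. field. exact N'. }
set (h' := fun w => epsilon (inhabits (RtoC 0)) (fun l => in_rect (- R1) R1 (- R1) R1 w -> Cder h w l)).
destruct (primitive_holo h h' (- R1) R1 (- R1) R1) as [P HP].
- unfold R1; lra.
- unfold R1; lra.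
- intros w. exact (epsilon_spec (inhabits (RtoC 0)) _ (Hh w)).
- destruct (winding_kernel z r Hz) as (Q & Q0 & HQ).
  assert (Fin : forall t, in_rect (- R) R (- R) R (circ r t)).
  { intros t. apply Cmod_box. rewrite Cmod_circ, Rabs_pos_eq; lra. }
  assert (Gc : forall t, RCcont (circ r) t) by (intros; eapply RCder_cont, circ_der).
  assert (der : forall t, RCder (fun t => - Ci * P (circ r t) + F z * (Q t + RtoC t))%C t
     (F (circ r t) * (circ r t * / (circ r t - z)))%C).
  { intros t. eapply RCder_eq; [|apply RCder_plus; [apply RCder_mult_const, RCder_comp;
      [apply HP, Cmod_obox; rewrite Cmod_circ, Rabs_pos_eq; unfold R1; lra|apply circ_der]|
       apply RCder_mult_const, RCder_plus; [apply HQ|apply (RCder_pair (fun s => s) (fun _ => 0) t 1 0);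
       auto_derive; trivial]]].
    unfold h. destruct (Ceq_dec (circ r t) z) as [E|E].
    { rewrite <- E in Hz. rewrite Cmod_circ, Rabs_pos_eq in Hz; lra. }
    change ((1, 0) : C) with (RtoC 1).
    assert (N := circ_neq r (proj1 Hr) z t Hz).
    match goal with |- _ = ?rhs => transitivity (rhs + (- (Ci * Ci) - 1) * ((F (circ r t) - F z) / (circ r t - z) * circ r t))%C end.
    - field. exact N.
    - replace (Ci * Ci)%C with (- (1))%C; [ring|].
      unfold Ci, Cmult, RtoC, Copp; simpl; f_equal; ring. }
  rewrite (CI_FTC _ _ _ _ H2pi (fun t _ => der t)).
  + rewrite circ_2PI, <- Q0. ring.
  + intros t _. apply RCcont_mult.
    * apply (RCcont_comp F (circ r)); trivial. eapply Cder_cont. apply (H (circ r t)). apply Fin.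
    * apply RCcont_mult; trivial. now apply (circ_kernel_cont r (proj1 Hr)).
Qed.

Lemma Cmod_small_0 (z : C) : (forall eps, 0 < eps -> Cmod z <= eps) -> z = 0.
Proof.
intros H. apply Cmod_eq_0. apply Rle_antisym; [|apply Cmod_ge_0].
apply Rnot_lt_le. intros P. specialize (H (Cmod z / 2)). lra.
Qed.

Lemma in_box_disc R r z : 0 < R -> 2 * R <= r -> in_rect (- R) R (- R) R z ->
  Cmod z <= r.
Proof.
intros HR Hr [H1 H2]. eapply Rle_trans; [apply Cmod_Rabs_le|].
assert (Rabs (Re z) <= R) by (apply Rabs_le; lra).
assert (Rabs (Im z) <= R) by (apply Rabs_le; lra). lra.
Qed.

(** Cauchy's formula for a primitive [F] of [z ^ 2 f(z)] expands [F] to third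
    order at the origin; the growth condition kills the coefficients that
    would give [f] a pole. *)
Lemma removable_singularity (f : C -> C) (r : R) : 0 < r ->
  (forall z, Cmod z < r -> z <> 0 -> exists l, Cder f z l) ->
  (forall eps, 0 < eps -> exists del, 0 < del /\ forall z, Cmod z < del -> z <> 0 ->
     Cmod (z * f z)%C <= eps) ->
  exists g : C -> C, (forall z : C, z <> 0 -> g z = f z) /\
    (forall z, Cmod z < r -> exists l, Cder g z l).
Proof.
intros Hr Hf Hs.
(* At the origin G has derivative 0, because G w / w = w f(w) tends to 0. *)
set (G := fun z => if Ceq_dec z 0 then RtoC 0 else (z * z * f z)%C).
assert (G0 : G 0 = 0) by (unfold G; destruct (Ceq_dec 0 0) as [_|N]; [trivial|now elim N]).
assert (GD : forall z, exists l, Cmod z < r -> Cder G z l).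
{ intros z. destruct (Ceq_dec z 0) as [->|N].
  - exists (RtoC 0). intros _ eps He. destruct (Hs eps He) as (d & Hd & K).
    exists d. split; trivial. intros w Hw. replace (w - 0)%C with w in * by ring.
    rewrite G0. unfold G. destruct (Ceq_dec w 0) as [->|Nw].
    + replace (0 - 0 - 0 * 0)%C with (RtoC 0) by ring. rewrite Cmod_0. lra.
    + replace (w * w * f w - 0 - 0 * w)%C with (w * (w * f w))%C by ring.
      rewrite Cmod_mult, Rmult_comm. apply Rmult_le_compat_r; [apply Cmod_ge_0|]. auto.
  - destruct (excluded_middle_informative (Cmod z < r)) as [Hz|Hz].
    + destruct (Hf z Hz N) as [l Hl].
      exists ((1 * z + z * 1) * f z + z * z * l)%C. intros _.
      apply Cder_ext_loc with (fun z => z * z * f z)%C.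
      * exists (Cmod z). split; [now apply Cmod_gt_0|]. intros w Hw. unfold G.
        destruct (Ceq_dec w 0) as [->|]; trivial. rewrite Cmod_sub_sym in Hw.
        replace (z - 0)%C with z in Hw by ring. lra.
      * apply (Cder_mult (fun z => z * z)%C); trivial.
        apply (Cder_mult (fun z => z)%C (fun z => z)); apply Cder_id.
    + exists (RtoC 0). intros; contradiction. }
set (G' := fun z => epsilon (inhabits (RtoC 0)) (fun l => Cmod z < r -> Cder G z l)).
assert (HG' : forall z, Cmod z < r -> Cder G z (G' z)).
{ intros z. exact (epsilon_spec (inhabits (RtoC 0)) _ (GD z)). }
assert (box : forall z, in_rect (- (r / 3)) (r / 3) (- (r / 3)) (r / 3) z -> Cmod z < r).
{ intros z Hz. assert (Cmod z <= 2 * r / 3) by (apply (in_box_disc (r / 3)); trivial; lra). lra. }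
destruct (primitive_holo G G' (- (r / 3)) (r / 3) (- (r / 3)) (r / 3)) as [F HF]; try lra; auto.
(* The square of half-side r / 3 lies in the disc of radius r; r / 4 and r / 5 leave room for the
   square and then the circle in Cauchy's formula. *)
set (R := r / 4). set (rho := r / 5).
assert (Hrho : 0 < rho) by (unfold rho; lra).
assert (bx : forall w, in_rect (- R) R (- R) R w -> Cder F w (G w) /\ Cder G w (G' w)).
{ unfold R. intros w [H1 H2]. split; [apply HF; split; lra|apply HG', box; split; lra]. }
assert (CF := Cauchy_formula F G G' rho R ltac:(unfold rho, R; lra) bx).
assert (Nc : forall t, circ rho t <> 0).
{ intros t. apply Cmod_gt_0. rewrite Cmod_circ, Rabs_pos_eq; lra. }
assert (Cc : forall t, RCcont (circ rho) t) by (intros; eapply RCder_cont, circ_der).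
assert (Fc : forall t, RCcont (fun t => F (circ rho t)) t).
{ intros t. apply (RCcont_comp F (circ rho)); trivial. eapply Cder_cont. apply (bx (circ rho t)).
  apply Cmod_box. rewrite Cmod_circ, Rabs_pos_eq; unfold rho, R; lra. }
set (q := fun t => (/ circ rho t)%C).
assert (qc : forall t, RCcont q t) by (intros; now apply RCcont_inv).
set (psi := fun t => (F (circ rho t) * (q t * q t))%C).
assert (pc : forall t, 0 <= t <= 2 * PI -> RCcont psi t).
{ intros t _. unfold psi. repeat apply RCcont_mult; trivial. }
set (A0 := CI (fun t => F (circ rho t)) 0 (2 * PI)).
set (A1 := CI (fun t => F (circ rho t) * q t)%C 0 (2 * PI)).
set (A2 := CI psi 0 (2 * PI)).
set (H1 := cauchy1 psi rho). set (H2 := cauchy2 psi rho). set (H3 := cauchy3 psi rho).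
(* The finite geometric expansion u / (u - z) = 1 + z / u + z^2 / u^2 + z^3 / (u^2 (u - z)) under
   the integral sign. *)
assert (E : forall z, Cmod z < rho ->
  (RtoC (2 * PI) * F z)%C = (A0 + z * A1 + z * z * A2 + z * z * z * H1 z)%C).
{ intros z Hz. rewrite <- CF by trivial.
  assert (e0 : CIex (fun t => F (circ rho t)) 0 (2 * PI)).
  { apply CI_ex; auto using two_PI_ge0. }
  assert (e1 : CIex (fun t => F (circ rho t) * q t)%C 0 (2 * PI)).
  { apply CI_ex; auto using two_PI_ge0. intros. apply RCcont_mult; auto. }
  assert (e2 : CIex psi 0 (2 * PI)).
  { apply CI_ex; auto using two_PI_ge0. }
  assert (e3 := cauchy1_ex psi rho Hrho pc z Hz).
  destruct (CI_scal z _ _ _ e1) as [s1 x1]. destruct (CI_scal (z * z)%C _ _ _ e2) as [s2 x2].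
  destruct (CI_scal (z * z * z)%C _ _ _ e3) as [s3 x3].
  unfold A0, A1, A2, H1, cauchy1. rewrite <- s1, <- s2, <- s3.
  rewrite <- !CI_plus; auto using CIex_plus.
  apply CI_ext; [apply two_PI_ge0|]. intros t _. unfold psi, q.
  assert (N := circ_neq rho Hrho z t Hz). specialize (Nc t). field. auto. }
assert (D1 : forall z, Cmod z < rho -> Cder H1 z (H2 z)) by (intros; now apply cauchy1_der).
assert (D2 : forall z, Cmod z < rho -> Cder H2 z (H3 z)) by (intros; now apply cauchy2_der).
(* The derivative of z^3 H1 is z^2 B, so differentiating the expansion of F gives one of G. *)
set (B := fun z => (3 * H1 z + z * H2 z)%C).
assert (DB : forall z, Cmod z < rho -> Cder B z (3 * H2 z + (1 * H2 z + z * H3 z))%C).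
{ intros z Hz. apply Cder_plus; [apply Cder_scal; auto|].
  apply (Cder_mult (fun z => z)); [apply Cder_id|auto]. }
assert (E2 : forall z, Cmod z < rho ->
  (RtoC (2 * PI) * G z)%C = (A1 + 2 * z * A2 + z * z * B z)%C).
{ intros z Hz. apply (Cder_unique (fun z => RtoC (2 * PI) * F z)%C z).
  - apply Cder_scal. apply bx, Cmod_box. unfold rho, R in *. lra.
  - apply Cder_ext_loc with (fun z => A0 + z * A1 + z * z * A2 + z * z * z * H1 z)%C.
    + exists (rho - Cmod z). split; [lra|]. intros w Hw. symmetry. apply E.
      generalize (Cmod_rev_tri w z). lra.
    + eapply Cder_eq; [|apply Cder_plus; [apply Cder_plus; [apply Cder_plus;
       [apply Cder_const|apply Cder_mult; [apply Cder_id|apply Cder_const]]|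
        apply Cder_mult; [apply (Cder_mult (fun z => z) (fun z => z)); apply Cder_id|apply Cder_const]]|
        apply Cder_mult; [apply (Cder_mult (fun z => z * z)%C (fun z => z));
          [apply (Cder_mult (fun z => z) (fun z => z)); apply Cder_id|apply Cder_id]|now apply D1]]].
      unfold B. cbv beta. ring. }
(* Evaluation at the origin, where G vanishes. *)
assert (Z1 : A1 = 0).
{ specialize (E2 0). rewrite Cmod_0 in E2. specialize (E2 Hrho). rewrite G0 in E2.
  transitivity (A1 + 2 * 0 * A2 + 0 * 0 * B 0)%C; [ring|]. rewrite <- E2. ring. }
assert (E3 : forall z, Cmod z < rho -> z <> 0 ->
  (RtoC (2 * PI) * (z * f z))%C = (2 * A2 + z * B z)%C).
{ intros z Hz N. specialize (E2 z Hz). rewrite Z1 in E2. unfold G in E2.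
  destruct (Ceq_dec z 0) as [|_]; [contradiction|].
  assert (X : (z * (RtoC (2 * PI) * (z * f z)))%C = (z * (2 * A2 + z * B z))%C).
  { transitivity (RtoC (2 * PI) * (z * z * f z))%C; [ring|]. rewrite E2. ring. }
  transitivity (/ z * (z * (RtoC (2 * PI) * (z * f z))))%C; [field; trivial|].
  rewrite X. field. trivial. }
assert (HPI := PI_RGT_0).
assert (N2 : RtoC (2 * PI) <> 0) by (apply RtoC_neq; lra).
(* By [E3] the number 2 A2 is the limit of 2 pi z f(z) at the origin. With A2 = 0 the function f
   equals B / (2 pi) off the origin, and B extends it. *)
assert (Z2 : A2 = 0).
{ apply Cmod_small_0. intros eps He.
  destruct (Hs (eps / (2 * PI))) as (d & Hd & K); [apply Rdiv_lt_0_compat; lra|].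
  assert (Bc : Ccont (fun z => z * B z)%C 0).
  { eapply Cder_cont. apply (Cder_mult (fun z => z)); [apply Cder_id|apply DB].
    rewrite Cmod_0. exact Hrho. }
  destruct (Bc eps He) as (d' & Hd' & K').
  set (t := Rmin rho (Rmin d d') / 2).
  assert (Ht : 0 < t) by (unfold t; assert (0 < Rmin rho (Rmin d d')) by (repeat apply Rmin_glb_lt; lra); lra).
  assert (T : t < rho /\ t < d /\ t < d').
  { unfold t in *. generalize (Rmin_l rho (Rmin d d')) (Rmin_r rho (Rmin d d')) (Rmin_l d d') (Rmin_r d d'). lra. }
  assert (Mt : Cmod (RtoC t) = t) by (rewrite Cmod_R, Rabs_pos_eq; lra).
  assert (Nt : RtoC t <> 0) by (apply RtoC_neq; lra).
  assert (E3t := E3 (RtoC t) ltac:(lra) Nt).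
  assert (Kt := K (RtoC t) ltac:(lra) Nt).
  assert (Kt' := K' (RtoC t)). cbv beta in Kt'.
  replace (RtoC t - 0)%C with (RtoC t) in Kt' by ring.
  replace (RtoC t * B (RtoC t) - 0 * B 0)%C with (RtoC t * B (RtoC t))%C in Kt' by ring.
  specialize (Kt' ltac:(lra)).
  assert (Q : (2 * A2)%C = (RtoC (2 * PI) * (RtoC t * f (RtoC t)) - RtoC t * B (RtoC t))%C).
  { rewrite E3t. ring. }
  assert (Q2 : Cmod (2 * A2)%C <= 2 * eps).
  { rewrite Q. unfold Cminus. eapply Rle_trans; [apply Cmod_triangle|].
    rewrite Cmod_opp, Cmod_mult, Cmod_R, Rabs_pos_eq by lra.
    apply (Rmult_le_compat_l (2 * PI)) in Kt; [|lra].
    replace (2 * PI * (eps / (2 * PI))) with eps in Kt by (field; lra). lra. }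
  rewrite Cmod_mult, Cmod_R, Rabs_pos_eq in Q2 by lra. lra. }
exists (fun z => if Ceq_dec z 0 then (/ RtoC (2 * PI) * B 0)%C else f z). split.
- intros z N. destruct (Ceq_dec z 0) as [E0|_]; [now elim N|trivial].
- intros z Hz. destruct (Ceq_dec z 0) as [->|N].
  + eexists. apply Cder_ext_loc with (fun z => / RtoC (2 * PI) * B z)%C.
    * exists rho. split; trivial. intros w Hw. replace (w - 0)%C with w in Hw by ring.
      destruct (Ceq_dec w 0) as [->|Nw]; trivial.
      specialize (E3 w Hw Nw). rewrite Z2 in E3.
      transitivity (/ (RtoC (2 * PI) * w) * (2 * 0 + w * B w))%C; [field; auto|].
      rewrite <- E3. field. auto.
    * apply Cder_scal, DB. rewrite Cmod_0. exact Hrho.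
  + destruct (Hf z Hz N) as [l Hl]. exists l.
    apply Cder_ext_loc with f; trivial. exists (Cmod z). split; [now apply Cmod_gt_0|].
    intros w Hw. destruct (Ceq_dec w 0) as [->|]; trivial. rewrite Cmod_sub_sym in Hw.
    replace (z - 0)%C with z in Hw by ring. lra.
Qed.

(** * The Cauchy transform in polar coordinates *)

Definition jcont (F : R -> R -> R) : Prop :=
  forall x y, continuous (T := prod_UniformSpace R_UniformSpace R_UniformSpace)
    (fun q : R * R => F (fst q) (snd q)) (x, y).

Lemma jcont_2d F : jcont F -> forall x y, continuity_2d_pt F x y.
Proof. intros H x y. apply continuity_2d_pt_filterlim. exact (H x y). Qed.

Lemma jcont_snd F : jcont F -> forall x y, continuous (F x) y.
Proof.
intros H x y. apply (filterlim_locally (F x)). intros eps.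
destruct (jcont_2d F H x y eps) as [d K]. exists d. intros v Hv.
apply K; [|exact Hv]. rewrite Rminus_diag, Rabs_R0. apply cond_pos.
Qed.

Lemma jcont_inner F x a b : jcont F -> ex_RInt (F x) a b.
Proof. intros H. apply (ex_RInt_continuous (V := R_CompleteNormedModule)). intros y _. now apply jcont_snd. Qed.

Lemma RInt_bound f a b M : a <= b -> ex_RInt f a b ->
  (forall t, a <= t <= b -> Rabs (f t) <= M) -> Rabs (RInt f a b) <= (b - a) * M.
Proof.
intros Hab E H.
apply (norm_RInt_le_const (V := R_NormedModule) f a b _ M Hab H).
exact (RInt_correct (V := R_CompleteNormedModule) f a b E).
Qed.

Lemma RInt_minus_R f g a b : ex_RInt f a b -> ex_RInt g a b ->
  RInt (fun t => f t - g t) a b = RInt f a b - RInt g a b.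
Proof. exact (RInt_minus (V := R_CompleteNormedModule) f g a b). Qed.

Lemma RInt_plus_R f g a b : ex_RInt f a b -> ex_RInt g a b ->
  RInt (fun t => f t + g t) a b = RInt f a b + RInt g a b.
Proof. exact (RInt_plus (V := R_CompleteNormedModule) f g a b). Qed.

Lemma RInt_scal_R k f a b : ex_RInt f a b ->
  RInt (fun t => k * f t) a b = k * RInt f a b.
Proof. exact (RInt_scal (V := R_CompleteNormedModule) f a b k). Qed.

Lemma RInt_const_R (k a b : R) : RInt (fun _ => k) a b = (b - a) * k.
Proof. exact (RInt_const (V := R_CompleteNormedModule) a b k). Qed.

Lemma jcont_outer F a b : a <= b -> jcont F ->
  forall x, continuous (fun x => RInt (F x) a b) x.
Proof.
intros Hab H x. apply (filterlim_locally (fun x => RInt (F x) a b)). intros eps.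
assert (He : 0 < eps / (b - a + 1)) by (apply Rdiv_lt_0_compat; [apply cond_pos|lra]).
destruct (uniform_continuity_2d_1d' F a b x (fun y _ => jcont_2d F H x y) (mkposreal _ He)) as [d K].
exists d. intros v Hv. change (Rabs (v - x) < d) in Hv.
change (Rabs (RInt (F v) a b - RInt (F x) a b) < eps).
rewrite <- RInt_minus_R by now apply jcont_inner.
eapply Rle_lt_trans; [apply (RInt_bound _ a b (eps / (b - a + 1))); trivial|].
- apply (ex_RInt_minus (V := R_NormedModule)); now apply jcont_inner.
- intros t Ht. left. assert (Dp := cond_pos d). apply Rabs_def2 in Hv.
  apply (K t x t v); try lra. rewrite Rminus_diag, Rabs_R0. lra.
- replace ((b - a) * (eps / (b - a + 1))) with (eps - eps / (b - a + 1)) by (field; lra). lra.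
Qed.

(** Polar integration over radii up to 2: for |z| < 1 and a density supported in the unit disc, z -
    rho e^(i t) has left the support at rho = 2, so nothing is cut off. *)
Definition DI (F : R -> R -> R) : R := RInt (fun x => RInt (F x) 0 (2 * PI)) 0 2.

Lemma DI_ex F : jcont F -> ex_RInt (fun x => RInt (F x) 0 (2 * PI)) 0 2.
Proof.
intros H. apply (ex_RInt_continuous (V := R_CompleteNormedModule)). intros x _.
apply jcont_outer; trivial. generalize PI_RGT_0; lra.
Qed.

Lemma jcont_plus F G : jcont F -> jcont G -> jcont (fun x y => F x y + G x y).
Proof. intros H K x y. now apply (continuous_plus (V := R_NormedModule)). Qed.

Lemma jcont_mult F G : jcont F -> jcont G -> jcont (fun x y => F x y * G x y).
Proof. intros H K x y. now apply (continuous_mult (K := R_AbsRing)). Qed.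

Lemma jcont_minus F G : jcont F -> jcont G -> jcont (fun x y => F x y - G x y).
Proof. intros H K x y. now apply (continuous_minus (V := R_NormedModule)). Qed.

Lemma jcont_const k : jcont (fun _ _ => k).
Proof. intros x y. apply continuous_const. Qed.

Lemma DI_plus F G : jcont F -> jcont G -> DI (fun x y => F x y + G x y) = DI F + DI G.
Proof.
intros H K. unfold DI. rewrite <- RInt_plus_R by now apply DI_ex.
apply RInt_ext. intros x _. apply RInt_plus_R; now apply jcont_inner.
Qed.

Lemma DI_minus F G : jcont F -> jcont G -> DI (fun x y => F x y - G x y) = DI F - DI G.
Proof.
intros H K. unfold DI. rewrite <- RInt_minus_R by now apply DI_ex.
apply RInt_ext. intros x _. apply RInt_minus_R; now apply jcont_inner.
Qed.

Lemma DI_scal k F : jcont F -> DI (fun x y => k * F x y) = k * DI F.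
Proof.
intros H. unfold DI. rewrite <- RInt_scal_R by now apply DI_ex.
apply RInt_ext. intros x _. apply RInt_scal_R; now apply jcont_inner.
Qed.

Lemma DI_bound F M : jcont F -> (forall x y, 0 <= x <= 2 -> Rabs (F x y) <= M) ->
  Rabs (DI F) <= 2 * (2 * PI * M).
Proof.
intros H B. assert (HPI := PI_RGT_0). unfold DI.
apply Rle_trans with ((2 - 0) * ((2 * PI - 0) * M)); [|right; ring].
apply RInt_bound; [lra|now apply DI_ex|]. intros x Hx.
apply RInt_bound; [lra|now apply jcont_inner|]. intros; auto.
Qed.

(** [z - rho e^(i t)], with [rho] and [t] as separate real arguments. *)
Definition shifted (p : C -> R) (z : C) (k : R -> R) : R -> R -> R :=
  fun rho t => p (Re z - rho * cos t, Im z - rho * sin t) * k t.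

Lemma shifted_jcont p z k : (forall w, continuous (T := C_UniformSpace) p w) ->
  (forall t, continuous k t) -> jcont (shifted p z k).
Proof.
intros Hp Hk x y.
assert (c1 : continuous (T := prod_UniformSpace R_UniformSpace R_UniformSpace)
  (fun q : R * R => fst q) (x, y)) by apply continuous_fst.
assert (c2 : continuous (T := prod_UniformSpace R_UniformSpace R_UniformSpace)
  (fun q : R * R => snd q) (x, y)) by apply continuous_snd.
assert (cc : forall g : R -> R, (forall t, continuous g t) ->
  continuous (T := prod_UniformSpace R_UniformSpace R_UniformSpace) (fun q : R * R => g (snd q)) (x, y)).
{ intros g Hg. now apply (continuous_comp (fun q : R * R => snd q) g). }
assert (tr : forall (c : R) (g : R -> R), (forall t, continuous g t) ->
  continuous (T := prod_UniformSpace R_UniformSpace R_UniformSpace)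
   (fun q : R * R => c - fst q * g (snd q)) (x, y)).
{ intros c g Hg. apply (continuous_minus (V := R_NormedModule)); [apply continuous_const|].
  apply (continuous_mult (K := R_AbsRing)); auto. }
apply (continuous_mult (K := R_AbsRing)); [|now apply cc].
apply (continuous_comp_2 (fun q : R * R => Re z - fst q * cos (snd q))
  (fun q : R * R => Im z - fst q * sin (snd q)) (fun a b => p (a, b))).
- apply tr. apply continuous_cos.
- apply tr. apply continuous_sin.
- eapply (continuous_ext_loc _ p); [|apply Hp]. apply filter_forall. intros [a b]. reflexivity.
Qed.

(** Convolution with 1 / u in polar coordinates u = rho e^(i t): the area element rho d(rho) dt
    cancels the singularity and leaves the bounded kernel e^(- i t). Taking [cos] and [sin] for k
    gives its real part and minus its imaginary part. *)
Definition CT (k : R -> R) (p : C -> R) (z : C) : R := DI (shifted p z k).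

Lemma slope_bound (phi : R -> R) (s t L e : R) :
  (forall u, Rmin s t <= u <= Rmax s t -> ex_derive phi u /\ Rabs (Derive phi u - L) <= e) ->
  Rabs (phi t - phi s - (t - s) * L) <= e * Rabs (t - s).
Proof.
intros H.
destruct (MVT_gen phi s t (Derive phi)) as (c & Hc & E).
- intros u Hu. apply Derive_correct. apply H. lra.
- intros u Hu. apply continuity_pt_filterlim.
  apply (ex_derive_continuous (K := R_AbsRing) (V := R_NormedModule)). now apply H.
- rewrite E. replace (Derive phi c * (t - s) - (t - s) * L) with ((Derive phi c - L) * (t - s)) by ring.
  rewrite Rabs_mult. apply Rmult_le_compat_r; [apply Rabs_pos|]. now apply H.
Qed.

(** This is twice the derivative of u with respect to z, the number that represents du in the sense
    of [Rder]. *)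
Definition grad (u : C -> R) (z : C) : C := (dx u z, - dy u z).

Lemma C1_increment (u : C -> R) (z w : C) e :
  (forall v, Rabs (Re v - Re z) <= Rabs (Re w - Re z) -> Rabs (Im v - Im z) <= Rabs (Im w - Im z) ->
     ex_derive (fun x => u (x, Im v)) (Re v) /\ ex_derive (fun y => u (Re v, y)) (Im v) /\
     Rabs (dx u v - dx u z) <= e /\ Rabs (dy u v - dy u z) <= e) ->
  Rabs (u w - u z - Re (grad u z * (w - z))%C) <= 2 * e * Cmod (w - z)%C.
Proof.
intros H. destruct z as [x y], w as [x' y'].
change (Re (grad u (x, y) * ((x', y') - (x, y)))%C) with
  (dx u (x, y) * (x' - x) - (- dy u (x, y)) * (y' - y)).
simpl in H.
assert (btw : forall a b t, Rmin a b <= t <= Rmax a b -> Rabs (t - a) <= Rabs (b - a)).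
{ intros a b t. unfold Rmin, Rmax. destruct (Rle_dec a b); intros ?;
  [rewrite !Rabs_pos_eq by lra|rewrite !Rabs_left1 by lra]; lra. }
assert (Z : forall a b : R, Rabs (a - a) <= Rabs b) by (intros; rewrite Rminus_diag, Rabs_R0; apply Rabs_pos).
assert (A : Rabs (u (x', y') - u (x, y') - (x' - x) * dx u (x, y)) <= e * Rabs (x' - x)).
{ apply (slope_bound (fun a => u (a, y'))). intros t Ht. apply btw in Ht.
  destruct (H (t, y')) as (H1 & _ & H2 & _); simpl; auto using Rle_refl. }
assert (B : Rabs (u (x, y') - u (x, y) - (y' - y) * dy u (x, y)) <= e * Rabs (y' - y)).
{ apply (slope_bound (fun a => u (x, a))). intros t Ht. apply btw in Ht.
  destruct (H (x, t)) as (_ & H1 & _ & H2); simpl; auto. }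
assert (He : 0 <= e).
{ destruct (H (x, y)) as (_ & _ & H2 & _); simpl; auto. eapply Rle_trans; [apply Rabs_pos|exact H2]. }
assert (P := re_le_Cmod ((x', y') - (x, y))%C). assert (Q := Im_le_Cmod ((x', y') - (x, y))%C).
change (Rabs (x' - x) <= Cmod ((x', y') - (x, y))%C) in P.
change (Rabs (y' - y) <= Cmod ((x', y') - (x, y))%C) in Q.
replace (u (x', y') - u (x, y) - (dx u (x, y) * (x' - x) - - dy u (x, y) * (y' - y)))
  with ((u (x', y') - u (x, y') - (x' - x) * dx u (x, y)) +
        (u (x, y') - u (x, y) - (y' - y) * dy u (x, y))) by ring.
eapply Rle_trans; [apply Rabs_triang|]. nra.
Qed.

Lemma continuous_2d (u : C -> R) z : continuous (T := C_UniformSpace) u z ->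
  continuity_2d_pt (fun a b => u (a, b)) (Re z) (Im z).
Proof.
intros H. apply continuity_2d_pt_filterlim.
rewrite pair_Re_Im. apply (filterlim_ext u); [|now destruct z].
intros [a b]. reflexivity.
Qed.

Lemma continuous_Cmod (u : C -> R) z : continuous (T := C_UniformSpace) u z ->
  forall eps, 0 < eps -> exists d, 0 < d /\ forall w, Cmod (w - z)%C < d -> Rabs (u w - u z) < eps.
Proof.
intros H eps He. apply locally_Cmod.
exact (proj1 (filterlim_locally u (u z)) H (mkposreal _ He)).
Qed.

Lemma C1_Rder (U : C -> Prop) (u : C -> R) z : open U -> Ck 1 U u -> U z ->
  Rder u z (grad u z).
Proof.
intros HU (_ & Hd & [Hx _] & [Hy _]) Hz eps He.
destruct (proj1 (open_Copen U) HU z Hz) as (d & Hd0 & K).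
destruct (continuous_Cmod _ z (Hx z Hz) (eps / 2)) as (d1 & Hd1 & K1); [lra|].
destruct (continuous_Cmod _ z (Hy z Hz) (eps / 2)) as (d2 & Hd2 & K2); [lra|].
set (m := Rmin d (Rmin d1 d2)).
assert (Hm : 0 < m) by (unfold m; repeat apply Rmin_glb_lt; lra).
exists (m / 2). split; [lra|]. intros w Hw.
replace eps with (2 * (eps / 2)) by field. apply C1_increment. intros v V1 V2.
assert (V : Cmod (v - z)%C < m).
{ eapply Rle_lt_trans; [apply Cmod_Rabs_le|].
  assert (P := re_le_Cmod (w - z)%C). assert (Q := Im_le_Cmod (w - z)%C).
  change (Rabs (Re w - Re z) <= Cmod (w - z)%C) in P.
  change (Rabs (Im w - Im z) <= Cmod (w - z)%C) in Q.
  change (Rabs (Re v - Re z) + Rabs (Im v - Im z) < m). lra. }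
assert (T : m <= d /\ m <= d1 /\ m <= d2).
{ unfold m. generalize (Rmin_l d (Rmin d1 d2)) (Rmin_r d (Rmin d1 d2)) (Rmin_l d1 d2) (Rmin_r d1 d2). lra. }
assert (Uv : U v) by (apply K; lra).
destruct (Hd v Uv) as [E1 E2]. repeat split; trivial; left; [apply K1|apply K2]; lra.
Qed.

Definition everywhere (z : C) : Prop := True.

Lemma open_everywhere : open everywhere.
Proof. intros z _. apply filter_forall. now intros. Qed.

Lemma Cmod_minus_rot z rho t : 0 <= rho ->
  rho - Cmod z <= Cmod ((Re z - rho * cos t, Im z - rho * sin t) : C).
Proof.
intros H. replace ((Re z - rho * cos t, Im z - rho * sin t) : C) with (z - circ rho t)%C.
- rewrite Cmod_sub_sym. assert (K := Cmod_rev_tri (circ rho t) z).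
  rewrite Cmod_circ, Rabs_pos_eq in K; lra.
- destruct z. reflexivity.
Qed.

(** * The Cauchy transform inverts the Cauchy-Riemann operator *)

Section CauchyTransform.
Variable p : C -> R.
Hypothesis Cp : Ck 1 everywhere p.
Hypothesis supp : forall z, 1 <= Cmod z -> p z = 0.

Lemma p_cont w : continuous (T := C_UniformSpace) p w.
Proof. destruct Cp as [H _]. now apply H. Qed.
Lemma px_cont w : continuous (T := C_UniformSpace) (dx p) w.
Proof. destruct Cp as (_ & _ & [H _] & _). now apply H. Qed.
Lemma py_cont w : continuous (T := C_UniformSpace) (dy p) w.
Proof. destruct Cp as (_ & _ & _ & [H _]). now apply H. Qed.

Lemma CT_Rder k z : (forall t, continuous k t) -> (forall t, Rabs (k t) <= 1) ->
  Cmod z < 1 -> Rder (CT k p) z (CT k (dx p) z, - CT k (dy p) z).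
Proof.
intros kc kb Hz eps He. assert (HPI := PI_RGT_0).
(* The parameter domain has area 4 pi and [C1_increment] costs a factor 2. *)
set (e := eps / (8 * PI)). assert (Hep : 0 < e) by (apply Rdiv_lt_0_compat; lra).
(* For |z| < 1 and rho <= 2 the shifted points have coordinates of size at most 3, and increments
   are kept below 1; the square of half-side 5 contains all of them. *)
destruct (uniform_continuity_2d (fun a b => dx p (a, b)) (-5) 5 (-5) 5
  (fun x y _ _ => continuous_2d (dx p) (x, y) (px_cont _)) (mkposreal _ Hep)) as [d1 K1].
destruct (uniform_continuity_2d (fun a b => dy p (a, b)) (-5) 5 (-5) 5
  (fun x y _ _ => continuous_2d (dy p) (x, y) (py_cont _)) (mkposreal _ Hep)) as [d2 K2].
set (m := Rmin 1 (Rmin d1 d2)).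
assert (Hm : 0 < m).
{ unfold m. apply Rmin_glb_lt; [lra|]. apply Rmin_glb_lt; apply cond_pos. }
assert (T : m <= 1 /\ m <= d1 /\ m <= d2).
{ unfold m. generalize (Rmin_l 1 (Rmin d1 d2)) (Rmin_r 1 (Rmin d1 d2)) (Rmin_l d1 d2) (Rmin_r d1 d2). lra. }
exists m. split; trivial. intros w Hw.
assert (jp : forall v, jcont (shifted p v k)) by (intros; apply shifted_jcont; auto using p_cont).
assert (jx : jcont (shifted (dx p) z k)) by (apply shifted_jcont; auto using px_cont).
assert (jy : jcont (shifted (dy p) z k)) by (apply shifted_jcont; auto using py_cont).
set (a := Re w - Re z). set (b := Im w - Im z).
assert (Ha : Rabs a <= Cmod (w - z)%C) by exact (re_le_Cmod (w - z)%C).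
assert (Hb : Rabs b <= Cmod (w - z)%C) by exact (Im_le_Cmod (w - z)%C).
assert (ja : jcont (fun x y => a * shifted (dx p) z k x y + b * shifted (dy p) z k x y)).
{ apply jcont_plus; apply jcont_mult; auto using jcont_const. }
replace (CT k p w - CT k p z - Re ((CT k (dx p) z, (- CT k (dy p) z)%R) * (w - z))%C)
  with (DI (fun x y => shifted p w k x y - shifted p z k x y -
     (a * shifted (dx p) z k x y + b * shifted (dy p) z k x y))).
2:{ rewrite DI_minus, DI_minus, DI_plus, !DI_scal; auto using jcont_minus, jcont_mult, jcont_const.
  unfold CT. change (Re ((DI (shifted (dx p) z k), (- DI (shifted (dy p) z k))%R) * (w - z))%C)
   with (DI (shifted (dx p) z k) * a - (- DI (shifted (dy p) z k)) * b). ring. }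
apply Rle_trans with (2 * (2 * PI * (2 * e * Cmod (w - z)%C))).
2:{ right. unfold e. field. lra. }
apply DI_bound; [auto using jcont_minus|]. intros r t Hr. unfold shifted.
set (s := (Re z - r * cos t, Im z - r * sin t) : C).
set (s' := (Re w - r * cos t, Im w - r * sin t) : C).
replace (p s' * k t - p s * k t - (a * (dx p s * k t) + b * (dy p s * k t)))
  with ((p s' - p s - Re (grad p s * (s' - s))%C) * k t).
2:{ change (Re (grad p s * (s' - s))%C) with
     (dx p s * (Re w - r * cos t - (Re z - r * cos t)) - (- dy p s) * (Im w - r * sin t - (Im z - r * sin t))).
  unfold a, b. ring. }
rewrite Rabs_mult.
assert (Ess : (s' - s)%C = (w - z)%C).
{ unfold s, s'. destruct w, z. unfold Cminus, Cplus, Copp. simpl. f_equal; ring. }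
assert (Q : Rabs (p s' - p s - Re (grad p s * (s' - s))%C) <= 2 * e * Cmod (s' - s)%C).
{ apply C1_increment. intros v V1 V2.
  change (Rabs (Re v - Re s) <= Rabs (Re w - r * cos t - (Re z - r * cos t))) in V1.
  change (Rabs (Im v - Im s) <= Rabs (Im w - r * sin t - (Im z - r * sin t))) in V2.
  replace (Re w - r * cos t - (Re z - r * cos t)) with a in V1 by (unfold a; ring).
  replace (Im w - r * sin t - (Im z - r * sin t)) with b in V2 by (unfold b; ring).
  destruct Cp as (_ & Hd & _). destruct (Hd v I) as [E1 E2].
  assert (B : -3 <= Re s <= 3 /\ -3 <= Im s <= 3).
  { assert (R1 := re_le_Cmod z). assert (R2 := Im_le_Cmod z).
    assert (A1 : -1 <= Re z <= 1) by (apply Rabs_le_between; lra).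
    assert (A2 : -1 <= Im z <= 1) by (apply Rabs_le_between; lra).
    assert (C1 := COS_bound t). assert (S1 := SIN_bound t). simpl. split; nra. }
  assert (V1' : -1 <= Re v - Re s <= 1) by (apply Rabs_le_between; lra).
  assert (V2' : -1 <= Im v - Im s <= 1) by (apply Rabs_le_between; lra).
  assert (Ev : v = (Re v, Im v)) by now destruct v.
  assert (Es : s = (Re s, Im s)) by reflexivity.
  repeat split; trivial; left; rewrite Ev, Es; [apply K1|apply K2]; lra. }
rewrite Ess in Q. rewrite Ess.
assert (P0 := Rabs_pos (p s' - p s - Re (grad p s * (w - z))%C)).
specialize (kb t). assert (P1 := Rabs_pos (k t)). nra.
Qed.

Lemma radial_der z t s :
  is_derive (fun s => p (Re z - s * cos t, Im z - s * sin t)) s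
   (- (dx p (Re z - s * cos t, Im z - s * sin t) * cos t +
       dy p (Re z - s * cos t, Im z - s * sin t) * sin t)).
Proof.
set (d := (- cos t, - sin t) : C).
assert (E : forall s, (z + RtoC s * d)%C = (Re z - s * cos t, Im z - s * sin t)).
{ intros u. unfold d. destruct z. unfold Cplus, Cmult, RtoC. simpl. f_equal; ring. }
apply (is_derive_ext (fun s => p (z + RtoC s * d)%C)). { intros u. now rewrite E. }
rewrite <- E.
replace (- _) with (Re (grad p (z + RtoC s * d)%C * d)%C).
- apply Rder_real_line. apply (C1_Rder everywhere); trivial; [apply open_everywhere|exact I].
- unfold grad, d. simpl. ring.
Qed.

(** The integrand is minus the radial derivative of p (z - rho e^(i t)). Hence the double integral
    is M 0 - M 2 for the angular integral M of p over circles around z: M 0 is 2 pi p(z), and M 2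
    vanishes by the support condition. *)
Lemma CT_div z : Cmod z < 1 -> CT cos (dx p) z + CT sin (dy p) z = 2 * PI * p z.
Proof.
intros Hz. assert (HPI := PI_RGT_0). unfold CT.
assert (cc := continuous_cos). assert (cs := continuous_sin).
assert (jx : jcont (shifted (dx p) z cos)) by (apply shifted_jcont; auto using px_cont).
assert (jy : jcont (shifted (dy p) z sin)) by (apply shifted_jcont; auto using py_cont).
assert (jp := shifted_jcont p z (fun _ => 1) p_cont (fun t => continuous_const 1 t)).
rewrite <- DI_plus by trivial.
set (G := fun x y => shifted (dx p) z cos x y + shifted (dy p) z sin x y).
assert (jG : jcont G) by now apply jcont_plus.
set (f := fun r t => p (Re z - r * cos t, Im z - r * sin t)).
assert (Ef : forall r t, f r t = shifted p z (fun _ => 1) r t) by (intros; unfold f, shifted; ring).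
assert (fi : forall r a b, ex_RInt (f r) a b).
{ intros r a b. apply (ex_RInt_ext (shifted p z (fun _ => 1) r)); [intros; now rewrite Ef|].
  now apply jcont_inner. }
set (M := fun r => RInt (f r) 0 (2 * PI)).
assert (Df : forall r t, is_derive (fun r => f r t) r (- G r t)) by (intros; apply radial_der).
assert (DM : forall r, is_derive M r (- RInt (G r) 0 (2 * PI))).
{ intros r. replace (- RInt (G r) 0 (2 * PI)) with (RInt (fun t => Derive (fun u => f u t) r) 0 (2 * PI)).
  - apply is_derive_RInt_param.
    + apply filter_forall. intros x t _. eexists; apply Df.
    + intros t _. apply (continuity_2d_pt_ext (fun u v => (-1) * G u v)).
      * intros u v. replace (-1 * G u v) with (- G u v) by ring. symmetry.
        apply is_derive_unique, Df.
      * apply (jcont_2d (fun u v => (-1) * G u v)). apply jcont_mult; trivial. apply jcont_const.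
    + apply filter_forall. intros y. apply fi.
  - transitivity (RInt (fun t => (-1) * G r t) 0 (2 * PI)).
    + apply RInt_ext. intros t _. replace (-1 * G r t) with (- G r t) by ring.
      apply is_derive_unique, Df.
    + rewrite RInt_scal_R by now apply jcont_inner. change (@eq R (-1 * RInt (G r) 0 (2 * PI)) (- RInt (G r) 0 (2 * PI))). ring. }
assert (FT : RInt (fun r => - RInt (G r) 0 (2 * PI)) 0 2 = M 2 - M 0).
{ apply is_RInt_unique. apply (is_RInt_derive (V := R_CompleteNormedModule) M).
  - intros r _. apply DM.
  - intros r _. apply (continuous_opp (V := R_NormedModule) (fun r => RInt (G r) 0 (2 * PI))).
    apply jcont_outer; trivial. lra. }
assert (EM : DI G = M 0 - M 2).
{ unfold DI. transitivity (- RInt (fun r => - RInt (G r) 0 (2 * PI)) 0 2); [|rewrite FT; ring].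
  assert (X := RInt_opp (V := R_CompleteNormedModule) (fun r => RInt (G r) 0 (2 * PI)) 0 2 (DI_ex G jG)).
  change (@eq R (RInt (fun r => - RInt (G r) 0 (2 * PI)) 0 2) (- RInt (fun r => RInt (G r) 0 (2 * PI)) 0 2)) in X.
  rewrite X. symmetry. apply Ropp_involutive. }
rewrite EM.
assert (M2 : M 2 = 0).
{ unfold M. rewrite (RInt_ext _ (fun _ => 0)).
  - rewrite RInt_const_R. apply Rmult_0_r.
  - intros t _. apply supp. generalize (Cmod_minus_rot z 2 t). lra. }
assert (M0 : M 0 = 2 * PI * p z).
{ unfold M. rewrite (RInt_ext _ (fun _ => p z)).
  - rewrite RInt_const_R. now rewrite Rminus_0_r.
  - intros t _. unfold f. f_equal. rewrite !Rmult_0_l, !Rminus_0_r. now destruct z. }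
rewrite M2, M0. ring.
Qed.

(** Up to the factor - rho the integrand is the angular derivative of p (z - rho e^(i t)), whose
    integral over a period is 0. *)
Lemma CT_curl z : CT cos (dy p) z - CT sin (dx p) z = 0.
Proof.
assert (HPI := PI_RGT_0). unfold CT.
assert (cc := continuous_cos). assert (cs := continuous_sin).
assert (jx : jcont (shifted (dx p) z sin)) by (apply shifted_jcont; auto using px_cont).
assert (jy : jcont (shifted (dy p) z cos)) by (apply shifted_jcont; auto using py_cont).
rewrite <- DI_minus by trivial. unfold DI.
set (G := fun x y => shifted (dy p) z cos x y - shifted (dx p) z sin x y).
assert (jG : jcont G) by now apply jcont_minus.
rewrite (RInt_ext _ (fun _ => 0)).
{ rewrite RInt_const_R. apply Rmult_0_r. }
intros r Hr. rewrite Rmin_left, Rmax_right in Hr by lra.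
assert (Dt : forall t, is_derive (fun t => p (z - circ r t)%C) t (- r * G r t)).
{ intros t.
  assert (H : Rder p (z - circ r t)%C (grad p (z - circ r t)%C)).
  { apply (C1_Rder everywhere); trivial; [apply open_everywhere|exact I]. }
  replace (- r * G r t) with (Re (grad p (z - circ r t)%C * (- (Ci * circ r t)))%C).
  2:{ replace (z - circ r t)%C with ((Re z - r * cos t, Im z - r * sin t) : C) by (now destruct z).
    unfold G, shifted, grad, circ, Ci. simpl. ring. }
  assert (K : RCder (fun t => z - circ r t)%C t (- (Ci * circ r t))%C).
  { intros e He. destruct (circ_der r t e He) as (d & Hd & A). exists d. split; trivial.
    intros s Hs. specialize (A s Hs). rewrite <- Cmod_opp.
    replace (- (z - circ r s - (z - circ r t) - RtoC (s - t) * - (Ci * circ r t)))%C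
      with (circ r s - circ r t - RtoC (s - t) * (Ci * circ r t))%C by ring. exact A. }
  now apply (Rder_path p (fun t => z - circ r t)%C). }
assert (FT : RInt (fun t => - r * G r t) 0 (2 * PI) = p (z - circ r (2 * PI))%C - p (z - circ r 0)%C).
{ apply is_RInt_unique. apply (is_RInt_derive (V := R_CompleteNormedModule) (fun t => p (z - circ r t)%C)).
  - intros t _. apply Dt.
  - intros t _. apply (continuous_scal_r (V := R_NormedModule) (- r) (G r)). now apply jcont_snd. }
rewrite RInt_scal_R, circ_2PI in FT by now apply jcont_inner.
assert (N : - r <> 0) by lra.
assert (Z : - r * RInt (G r) 0 (2 * PI) = - r * 0).
{ rewrite Rmult_0_r. etransitivity; [exact FT|]. apply Rminus_diag. }
exact (Rmult_eq_reg_l _ _ _ Z N).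
Qed.

End CauchyTransform.

(** The majorant [2 B s^2 / (s^2 + (t - m)^2)] dominates [f] and has an
    explicit primitive, which avoids splitting the interval. *)
Lemma RInt_support_bound (f : R -> R) a b m s B : a <= b -> 0 < s -> 0 <= B ->
  ex_RInt f a b ->
  (forall t, a <= t <= b -> Rabs (f t) <= B) ->
  (forall t, a <= t <= b -> s < Rabs (t - m) -> f t = 0) ->
  Rabs (RInt f a b) <= 2 * PI * s * B.
Proof.
intros Hab Hs HB E H1 H2. assert (HPI := PI_RGT_0).
set (g := fun t => 2 * B * s ^ 2 / (s ^ 2 + (t - m) ^ 2)).
set (G := fun t => 2 * B * s * atan ((t - m) / s)).
assert (D : forall t, 0 < s ^ 2 + (t - m) ^ 2).
{ intros t. assert (0 < s ^ 2) by (apply pow_lt; lra).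
  assert (0 <= (t - m) ^ 2) by apply pow2_ge_0. lra. }
assert (Ig : is_RInt g a b (G b - G a)).
{ apply (is_RInt_derive (V := R_CompleteNormedModule) G).
  - intros t _. unfold G, g. auto_derive; trivial. specialize (D t). field.
    split; lra.
  - intros t _. apply (ex_derive_continuous (K := R_AbsRing) (V := R_NormedModule)).
    unfold g. auto_derive. specialize (D t). lra. }
apply Rle_trans with (G b - G a).
- apply (norm_RInt_le (V := R_NormedModule) f g a b); trivial.
  + intros t Ht. change (Rabs (f t) <= g t). assert (P := D t).
    destruct (Rle_dec (Rabs (t - m)) s) as [L|L].
    * eapply Rle_trans; [now apply H1|]. unfold g. apply Rle_div_r; trivial.
      assert ((t - m) ^ 2 <= s ^ 2).
      { rewrite <- (pow2_abs (t - m)). apply pow_incr. split; [apply Rabs_pos|trivial]. }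
      nra.
    * rewrite H2, Rabs_R0 by (trivial; lra). unfold g.
      apply Rdiv_le_0_compat; trivial. assert (0 <= s ^ 2) by nra. nra.
  + exact (RInt_correct (V := R_CompleteNormedModule) f a b E).
- unfold G. assert (A := atan_bound ((b - m) / s)). assert (A' := atan_bound ((a - m) / s)).
  replace (2 * B * s * atan ((b - m) / s) - 2 * B * s * atan ((a - m) / s))
    with (2 * B * s * (atan ((b - m) / s) - atan ((a - m) / s))) by ring.
  replace (2 * PI * s * B) with (2 * B * s * PI) by ring.
  apply Rmult_le_compat_l; [nra|lra].
Qed.

(** * Size and decay of the Cauchy transform of a density with small support *)

Lemma RInt_periodic (f : R -> R) c : (forall t, continuous f t) ->
  (forall t, f (t + 2 * PI) = f t) -> RInt f 0 (2 * PI) = RInt f c (c + 2 * PI).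
Proof.
intros Hc Hp.
assert (E : forall a b, ex_RInt f a b).
{ intros. apply (ex_RInt_continuous (V := R_CompleteNormedModule)). auto. }
assert (S : RInt f (2 * PI) (c + 2 * PI) = RInt f 0 c).
{ assert (X := RInt_comp_lin (V := R_CompleteNormedModule) f 1 (2 * PI) 0 c (E _ _)).
  replace (1 * 0 + 2 * PI) with (2 * PI) in X by ring.
  replace (1 * c + 2 * PI) with (c + 2 * PI) in X by ring.
  rewrite <- X. apply RInt_ext. intros t _.
  change (1 * f (1 * t + 2 * PI) = f t). rewrite Rmult_1_l, Rmult_1_l. apply Hp. }
assert (C1 := RInt_Chasles (V := R_CompleteNormedModule) f 0 c (c + 2 * PI) (E _ _) (E _ _)).
assert (C2 := RInt_Chasles (V := R_CompleteNormedModule) f 0 (2 * PI) (c + 2 * PI) (E _ _) (E _ _)).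
rewrite <- C2, S in C1. 
change (@eq R (RInt f 0 c + RInt f c (c + 2 * PI)) (RInt f 0 (2 * PI) + RInt f 0 c)) in C1.
change (@eq R (RInt f 0 (2 * PI)) (RInt f c (c + 2 * PI))). lra.
Qed.

Lemma polar (z : C) : exists a, z = circ (Cmod z) a.
Proof.
destruct (Ceq_dec z 0) as [->|N].
{ exists 0. rewrite Cmod_0. unfold circ. now rewrite !Rmult_0_l. }
assert (P : 0 < Cmod z) by now apply Cmod_gt_0.
set (r := Cmod z) in *. destruct z as [x y].
assert (Er : r * r = x * x + y * y).
{ unfold r, Cmod. simpl. rewrite sqrt_sqrt by nra. ring. }
set (u := x / r). set (v := y / r).
assert (Eu : x = r * u) by (unfold u; field; lra).
assert (Ev : y = r * v) by (unfold v; field; lra).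
assert (E1 : u * u + v * v = 1).
{ unfold u, v. replace (x / r * (x / r) + y / r * (y / r)) with ((x * x + y * y) / (r * r)) by (field; lra).
  rewrite <- Er. field. lra. }
assert (Hu : -1 <= u <= 1) by nra.
assert (S : sin (acos u) = Rabs v).
{ rewrite sin_acos by trivial. rewrite <- sqrt_Rsqr_abs. f_equal. unfold Rsqr. lra. }
destruct (Rle_dec 0 v) as [L|L].
- exists (acos u). unfold circ. rewrite cos_acos, S, Rabs_pos_eq by trivial. now rewrite <- Eu, <- Ev.
- exists (- acos u). unfold circ. rewrite cos_neg, sin_neg, cos_acos, S, Rabs_left1 by (trivial; lra).
  rewrite Ropp_involutive. now rewrite <- Eu, <- Ev.
Qed.

Lemma x_cos_le_sin t : 0 <= t <= PI -> t * cos t <= sin t.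
Proof.
intros Ht. destruct (MVT_gen (fun t => sin t - t * cos t) 0 t (fun t => t * sin t)) as (c & Hc & E).
- intros u _. auto_derive; trivial. ring.
- intros u _. apply continuity_pt_filterlim.
  apply (ex_derive_continuous (K := R_AbsRing) (V := R_NormedModule)
    (fun t => sin t - t * cos t)). auto_derive. trivial.
- rewrite Rmin_left, Rmax_right in Hc by lra. rewrite sin_0 in E.
  assert (0 <= sin c) by (apply sin_ge_0; lra). 
  assert (0 <= c * sin c * (t - 0)) by (apply Rmult_le_pos; [apply Rmult_le_pos|]; lra). lra.
Qed.

Lemma abs_cos_le_sin t : Rabs t <= PI -> Rabs t * cos t <= Rabs (sin t).
Proof.
intros Ht. assert (K := x_cos_le_sin (Rabs t) (conj (Rabs_pos t) Ht)).
unfold Rabs in *. destruct (Rcase_abs t).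
- rewrite cos_neg, sin_neg in K. destruct (Rcase_abs (sin t)); lra.
- destruct (Rcase_abs (sin t)); lra.
Qed.

(** The disc of radius s around a point at distance m, seen from the origin. With tau = t - a, the
    two components of the difference give rho cos tau >= m - s and rho |sin tau| <= s. Then |tau|
    cos tau <= |sin tau| yields |tau| (m - s) <= s, and m - s >= m / 2. *)
Lemma angle_bound (m rho s a t : R) : 0 < s -> 2 * s <= m -> 0 <= rho -> Rabs (t - a) <= PI ->
  Cmod (circ m a - circ rho t)%C <= s -> Rabs (t - a) <= 2 * s / m.
Proof.
intros Hs Hm Hr Ht H.
set (tau := t - a) in *.
assert (E : Cmod (circ m a - circ rho t)%C ^ 2 = (m - rho * cos tau) ^ 2 + (rho * sin tau) ^ 2).
{ rewrite Cmod2_alt. unfold circ. simpl Re. simpl Im. unfold tau. rewrite cos_minus, sin_minus.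
  replace (m * cos a + - (rho * cos t)) with (m * cos a - rho * cos t) by ring.
  assert (S1 := sin2_cos2 a). assert (S2 := sin2_cos2 t). unfold Rsqr in S1, S2.
  transitivity (m ^ 2 * (sin a * sin a + cos a * cos a) + rho ^ 2 * (sin t * sin t + cos t * cos t)
    - 2 * m * rho * (cos a * cos t + sin a * sin t)); [ring|].
  transitivity (m ^ 2 + rho ^ 2 * ((sin t * sin t + cos t * cos t) * (sin a * sin a + cos a * cos a))
    - 2 * m * rho * (cos a * cos t + sin a * sin t)); [|ring].
  rewrite S1, S2. ring. }
assert (H2 : Cmod (circ m a - circ rho t)%C ^ 2 <= s ^ 2) by (apply pow_incr; split; [apply Cmod_ge_0|trivial]).
rewrite E in H2.
assert (A : m - s <= rho * cos tau).
{ apply Rnot_lt_le. intros N. assert (s < m - rho * cos tau) by lra. nra. }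
assert (B : rho * Rabs (sin tau) <= s).
{ apply Rnot_lt_le. intros N. assert (X : (rho * sin tau) ^ 2 = (rho * Rabs (sin tau)) ^ 2).
  { rewrite !Rpow_mult_distr, pow2_abs. reflexivity. }
  rewrite X in H2. assert (0 <= (m - rho * cos tau) ^ 2) by apply pow2_ge_0. nra. }
assert (K := abs_cos_le_sin tau Ht).
assert (T := Rabs_pos tau).
apply Rle_div_r; [lra|].
assert (rho * (Rabs tau * cos tau) <= rho * Rabs (sin tau)) by (apply Rmult_le_compat_l; lra).
assert (Rabs tau * (m - s) <= Rabs tau * (rho * cos tau)) by (apply Rmult_le_compat_l; lra).
nra.
Qed.

Section Bounds.
Variables (p : C -> R) (S s : R) (k : R -> R).
Hypothesis pc : forall w, continuous (T := C_UniformSpace) p w.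
Hypothesis Hs : 0 < s.
Hypothesis pS : forall z, Rabs (p z) <= S.
Hypothesis ps : forall z, s < Cmod z -> p z = 0.
Hypothesis kc : forall t, continuous k t.
Hypothesis kb : forall t, Rabs (k t) <= 1.
Hypothesis kp : forall t, k (t + 2 * PI) = k t.

Lemma S_ge0 : 0 <= S.
Proof. eapply Rle_trans; [apply Rabs_pos|apply (pS 0)]. Qed.

Lemma shifted_bound z rho t : Rabs (shifted p z k rho t) <= S.
Proof.
unfold shifted. rewrite Rabs_mult, <- (Rmult_1_r S).
apply Rmult_le_compat; auto using Rabs_pos.
Qed.

Lemma shifted_zero z rho t : s < Cmod (z - circ rho t)%C -> shifted p z k rho t = 0.
Proof.
intros H. unfold shifted.
replace ((Re z - rho * cos t, Im z - rho * sin t) : C) with (z - circ rho t)%C by now destruct z.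
rewrite ps by trivial. ring.
Qed.

(** Only radii with | rho - |z| | <= s contribute, by the triangle inequality; B bounds the angular
    integral over each circle. *)
Lemma CT_outer z B : 0 <= B ->
  (forall rho, 0 <= rho <= 2 -> Rabs (RInt (shifted p z k rho) 0 (2 * PI)) <= B) ->
  Rabs (CT k p z) <= 2 * PI * s * B.
Proof.
intros HB H. assert (J := shifted_jcont p z k pc kc). unfold CT, DI.
apply (RInt_support_bound _ 0 2 (Cmod z)); trivial; [lra|now apply DI_ex|].
intros rho Hr L.
rewrite (RInt_ext _ (fun _ => 0)).
- rewrite RInt_const_R. apply Rmult_0_r.
- intros t _. apply shifted_zero. eapply Rlt_le_trans; [exact L|].
  assert (A := Cmod_rev_tri z (circ rho t)). assert (A' := Cmod_rev_tri (circ rho t) z).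
  rewrite Cmod_sub_sym in A'. rewrite Cmod_circ, Rabs_pos_eq in A, A' by lra.
  apply Rabs_le. lra.
Qed.

Lemma CT_bound z : Rabs (CT k p z) <= 4 * PI ^ 2 * S * s.
Proof.
assert (HPI := PI_RGT_0). assert (HS := S_ge0).
replace (4 * PI ^ 2 * S * s) with (2 * PI * s * ((2 * PI - 0) * S)) by ring.
apply CT_outer; [apply Rmult_le_pos; lra|]. intros rho Hr.
apply RInt_bound; [lra|apply jcont_inner; now apply shifted_jcont|]. intros t _. apply shifted_bound.
Qed.

(** The transform is bounded by the mass S s^2 divided by |z|. Far out, for |z| >= 2 s, both
    variables are confined: the radius to a window of half-width s, the angle to one of half-width 2
    s / |z|. Closer in, the plain bound [CT_bound] already suffices. *)
Lemma CT_decay z : Cmod z * Rabs (CT k p z) <= 8 * PI ^ 2 * S * s ^ 2.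
Proof.
assert (HPI := PI_RGT_0). assert (HS := S_ge0).
assert (J := shifted_jcont p z k pc kc).
destruct (Rlt_dec (Cmod z) (2 * s)) as [L|L].
- apply Rle_trans with (2 * s * (4 * PI ^ 2 * S * s)).
  + apply Rmult_le_compat; [apply Cmod_ge_0|apply Rabs_pos|lra|apply CT_bound].
  + right. ring.
- set (m := Cmod z) in *. assert (Hm : 2 * s <= m) by lra.
  destruct (polar z) as [a Ea]. fold m in Ea.
  assert (X : Rabs (CT k p z) <= 2 * PI * s * (2 * PI * (2 * s / m) * S)).
  { assert (Q : 0 < 2 * s / m) by (apply Rdiv_lt_0_compat; lra).
    apply CT_outer. { apply Rmult_le_pos; [apply Rmult_le_pos|]; lra. }
    (* The period is recentred at the argument a of z, so that |t - a| <= pi on it. *)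
    intros rho Hr. rewrite (RInt_periodic _ (a - PI)).
    - apply (RInt_support_bound _ _ _ a); trivial; [lra|now apply jcont_inner| |].
      + intros t _. apply shifted_bound.
      + intros t Ht Lt. apply shifted_zero. apply Rnot_le_lt. intros N. apply (Rlt_not_le _ _ Lt).
        apply angle_bound with rho; trivial; [lra| |rewrite <- Ea; exact N].
        apply Rabs_le. lra.
    - intros t. now apply jcont_snd.
    - intros t. unfold shifted. now rewrite kp, (cos_plus t), (sin_plus t), cos_2PI, sin_2PI, !Rmult_1_r, !Rmult_0_r, Rminus_0_r, Rplus_0_r. }
  apply Rle_trans with (m * (2 * PI * s * (2 * PI * (2 * s / m) * S))).
  + apply Rmult_le_compat_l; lra.
  + right. field. lra.
Qed.

End Bounds.

(** * Smooth cutoffs *)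

Lemma Ck_ln n (U : C -> Prop) (w : C -> R) : open U -> (forall z, U z -> 0 < w z) ->
  Ck n U w -> Ck n U (fun z => ln (w z)).
Proof.
intros HU. revert w. induction n as [|n IH]; intros w P Hw; destruct (Hw) as [Hc H].
- split; [|exact I]. intros z Hz. apply continuous_comp; [now apply Hc|].
  apply continuous_ln. auto.
- assert (Pi : forall z, U z -> w (Re z, Im z) = w z) by (intros; now rewrite pair_Re_Im).
  destruct H as [Hd [Hx Hy]]. split; [|split; [|split]].
  + intros z Hz. apply continuous_comp; [now apply Hc|]. apply continuous_ln. auto.
  + intros z Hz. destruct (Hd z Hz) as [E1 E2].
    split; [apply (ex_derive_comp ln)|apply (ex_derive_comp ln)]; trivial;
    (eexists; apply is_derive_ln; rewrite Pi; auto).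
  + apply (Ck_ext U HU) with (fun z => dx w z * / w z).
    * intros z Hz. destruct (Hd z Hz) as [E1 E2]. unfold dx at 2. symmetry.
      apply is_derive_unique. rewrite <- (Pi z Hz).
      apply (is_derive_comp ln (fun x => w (x, Im z)));
      [apply is_derive_ln; rewrite Pi; auto|now apply Derive_correct].
    * apply Ck_mult; trivial. apply Ck_inv; trivial.
      { intros z Hz. apply Rgt_not_eq, P, Hz. } now apply Ck_S.
  + apply (Ck_ext U HU) with (fun z => dy w z * / w z).
    * intros z Hz. destruct (Hd z Hz) as [E1 E2]. unfold dy at 2. symmetry.
      apply is_derive_unique. rewrite <- (Pi z Hz).
      apply (is_derive_comp ln (fun y => w (Re z, y)));
      [apply is_derive_ln; rewrite Pi; auto|now apply Derive_correct].
    * apply Ck_mult; trivial. apply Ck_inv; trivial.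
      { intros z Hz. apply Rgt_not_eq, P, Hz. } now apply Ck_S.
Qed.

Lemma Ck_local n (U : C -> Prop) : forall u : C -> R,
  (forall z, U z -> exists V : C -> Prop, V z /\ Ck n V u) -> Ck n U u.
Proof.
induction n as [|n IH]; intros u H.
- split; [|exact I]. intros z Hz. destruct (H z Hz) as (V & Vz & K & _). auto.
- split; [|split; [|split]].
  + intros z Hz. destruct (H z Hz) as (V & Vz & K & _). auto.
  + intros z Hz. destruct (H z Hz) as (V & Vz & _ & K & _). auto.
  + apply IH. intros z Hz. destruct (H z Hz) as (V & Vz & _ & _ & K & _). eauto.
  + apply IH. intros z Hz. destruct (H z Hz) as (V & Vz & _ & _ & _ & K). eauto.
Qed.

Lemma Ck_sub n (U V : C -> Prop) u : (forall z, V z -> U z) -> Ck n U u -> Ck n V u.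
Proof. intros S H. apply Ck_local. intros z Hz. exists U. auto. Qed.

Lemma Ck_0 n (U : C -> Prop) : Ck n U (fun _ => 0).
Proof.
revert U. induction n as [|n IH]; intros U.
- split; [|exact I]. intros. apply continuous_const.
- split; [intros; apply continuous_const|]. split.
  + intros. split; apply ex_derive_const.
  + split; apply (Ck_sub _ everywhere); try (intros; exact I).
    * apply (Ck_ext everywhere open_everywhere) with (fun _ => 0); trivial.
      intros z _. symmetry. exact (Derive_const 0 (Re z)).
    * apply (Ck_ext everywhere open_everywhere) with (fun _ => 0); trivial.
      intros z _. symmetry. exact (Derive_const 0 (Im z)).
Qed.

Lemma Lipschitz_continuous (f : R -> R) K : (forall s t, Rabs (f s - f t) <= K * Rabs (s - t)) ->
  forall t, continuous f t.
Proof.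
intros H t. apply (filterlim_locally f). intros eps.
assert (P : 0 < Rabs K + 1) by (generalize (Rabs_pos K); lra).
assert (Q : 0 < eps / (Rabs K + 1)) by (apply Rdiv_lt_0_compat; [apply cond_pos|lra]).
exists (mkposreal _ Q). intros s Hs. change (Rabs (s - t) < eps / (Rabs K + 1)) in Hs.
change (Rabs (f s - f t) < eps). specialize (H s t).
apply (Rmult_lt_compat_r (Rabs K + 1)) in Hs; trivial.
replace (eps / (Rabs K + 1) * (Rabs K + 1)) with (pos eps) in Hs by (field; lra).
assert (A := Rle_abs K). assert (B := Rabs_pos (s - t)). nra.
Qed.

Definition clamp (t : R) : R := Rmax 0 (Rmin 1 t).

Lemma clamp_cases t : (t <= 0 /\ clamp t = 0) \/ (0 <= t <= 1 /\ clamp t = t) \/ (1 <= t /\ clamp t = 1).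
Proof. unfold clamp, Rmax, Rmin. destruct (Rle_dec 1 t), (Rle_dec 0 _); lra. Qed.

(** The cubic step 3 x^2 - 2 x^3. Its derivative vanishes at both ends, so it is of class C^1, the
    regularity that the Cauchy transform asks of a density. *)
Definition cutoff (t : R) : R := clamp t ^ 2 * (3 - 2 * clamp t).
Definition dcutoff (t : R) : R := 6 * clamp t * (1 - clamp t).

Lemma dcutoff_cont t : continuous dcutoff t.
Proof.
apply (Lipschitz_continuous dcutoff 6). intros a b. unfold dcutoff.
replace (6 * clamp a * (1 - clamp a) - 6 * clamp b * (1 - clamp b))
 with (6 * ((clamp a - clamp b) * (1 - clamp a - clamp b))) by ring.
rewrite Rabs_mult, (Rabs_pos_eq 6) by lra. apply Rmult_le_compat_l; [lra|].
rewrite Rabs_mult. rewrite <- (Rmult_1_r (Rabs (a - b))).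
apply Rmult_le_compat; try apply Rabs_pos;
 destruct (clamp_cases a) as [[? ->]|[[? ->]|[? ->]]], (clamp_cases b) as [[? ->]|[[? ->]|[? ->]]];
 unfold Rabs; repeat destruct Rcase_abs; lra.
Qed.

Lemma clamp_lip s t : Rabs (clamp s - clamp t) <= Rabs (s - t).
Proof.
destruct (clamp_cases s) as [[? ->]|[[? ->]|[? ->]]], (clamp_cases t) as [[? ->]|[[? ->]|[? ->]]];
 unfold Rabs; repeat destruct Rcase_abs; lra.
Qed.

Lemma clamp_range t : 0 <= clamp t <= 1.
Proof. destruct (clamp_cases t) as [[? ->]|[[? ->]|[? ->]]]; lra. Qed.

(** A quadratic remainder valid across the corners of [clamp] gives the derivative everywhere at
    once. The constant is 3 + 6: the first for the Taylor remainder of the cubic in the clamped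
    variables, the second for the error of clamping, which is tamed by the factor b (1 - b). *)
Lemma cutoff_quad s t : Rabs (cutoff s - cutoff t - (s - t) * dcutoff t) <= 9 * (s - t) ^ 2.
Proof.
set (a := clamp s). set (b := clamp t).
assert (A := clamp_range s). assert (B := clamp_range t). fold a in A. fold b in B.
assert (Q1 : (a - b) ^ 2 <= (s - t) ^ 2).
{ rewrite <- (pow2_abs (a - b)), <- (pow2_abs (s - t)). apply pow_incr.
  split; [apply Rabs_pos|apply clamp_lip]. }
assert (Q2 : Rabs (b * (1 - b) * ((a - b) - (s - t))) <= (s - t) ^ 2).
{ unfold a, b. destruct (clamp_cases t) as [[? ->]|[[? ->]|[? ->]]].
  - rewrite !Rmult_0_l, Rabs_R0. apply pow2_ge_0.
  - apply Rabs_le. destruct (clamp_cases s) as [[? ->]|[[? ->]|[? ->]]].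
    + assert (0 <= t * (1 - t) * (- s)) by (repeat apply Rmult_le_pos; lra).
      assert (t * (1 - t) * (- s) <= 1 * (t * (- s))).
      { replace (t * (1 - t) * - s) with ((1 - t) * (t * - s)) by ring.
        apply Rmult_le_compat_r; nra. }
      split; nra.
    + replace (s - t - (s - t)) with 0 by ring. rewrite Rmult_0_r.
      generalize (pow2_ge_0 (s - t)). lra.
    + assert (0 <= t * (1 - t) * (s - 1)) by (repeat apply Rmult_le_pos; lra).
      assert (t * (1 - t) * (s - 1) <= 1 * ((1 - t) * (s - 1))).
      { rewrite Rmult_assoc. apply Rmult_le_compat_r; nra. }
      split; nra.
  - replace (1 * (1 - 1) * (clamp s - 1 - (s - t))) with 0 by ring.
    rewrite Rabs_R0. apply pow2_ge_0. }
unfold cutoff, dcutoff. fold a b.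
replace (a ^ 2 * (3 - 2 * a) - b ^ 2 * (3 - 2 * b) - (s - t) * (6 * b * (1 - b)))
  with ((a - b) ^ 2 * (3 - 4 * b - 2 * a) + 6 * (b * (1 - b) * ((a - b) - (s - t)))) by ring.
set (X := b * (1 - b) * (a - b - (s - t))) in *.
eapply Rle_trans; [apply Rabs_triang|]. rewrite (Rabs_mult 6), (Rabs_pos_eq 6) by lra.
rewrite Rabs_mult, (Rabs_pos_eq ((a - b) ^ 2)) by apply pow2_ge_0.
assert (Rabs (3 - 4 * b - 2 * a) <= 3) by (apply Rabs_le; lra).
assert (0 <= (a - b) ^ 2) by apply pow2_ge_0.
assert ((a - b) ^ 2 * Rabs (3 - 4 * b - 2 * a) <= (a - b) ^ 2 * 3) by (apply Rmult_le_compat_l; lra).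
lra.
Qed.

Lemma cutoff_der t : is_derive cutoff t (dcutoff t).
Proof.
split; [apply is_linear_scal_l|].
intros x Hx. apply (is_filter_lim_locally_unique (K := R_AbsRing) (V := R_NormedModule)) in Hx.
subst x. intros eps. assert (He := cond_pos eps).
assert (Q : 0 < eps / 9) by lra. exists (mkposreal _ Q).
intros s Hs. change (Rabs (s - t) < eps / 9) in Hs.
change (Rabs (cutoff s - cutoff t - (s - t) * dcutoff t) <= eps * Rabs (s - t)).
eapply Rle_trans; [apply cutoff_quad|].
rewrite <- (pow2_abs (s - t)). assert (P := Rabs_pos (s - t)). nra.
Qed.

Lemma cutoff_range t : 0 <= cutoff t <= 1.
Proof.
unfold cutoff. assert (B := clamp_range t). set (x := clamp t) in *.
assert (0 <= (1 - x) ^ 2 * (1 + 2 * x)) by (apply Rmult_le_pos; [apply pow2_ge_0|lra]).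
assert (0 <= x ^ 2 * (3 - 2 * x)) by (apply Rmult_le_pos; [apply pow2_ge_0|lra]). lra.
Qed.

Lemma cutoff_0 t : t <= 0 -> cutoff t = 0.
Proof.
intros H. unfold cutoff. destruct (clamp_cases t) as [[? ->]|[[? ->]|[? ->]]]; nra.
Qed.

Lemma cutoff_1 t : 1 <= t -> cutoff t = 1.
Proof.
intros H. unfold cutoff. destruct (clamp_cases t) as [[? ->]|[[? ->]|[? ->]]]; nra.
Qed.

(** It passes from 0 to 1 between the radii r and 2 r. The square |z|^2 is used because it is smooth
    at the origin; |z|^2 / r^2 runs from 1 to 4, whence the division by 3. *)
Definition radial_cutoff (r : R) (z : C) : R :=
  cutoff (((Re z ^ 2 + Im z ^ 2) / r ^ 2 - 1) / 3).

Lemma radial_cutoff_0 r z : 0 < r -> Cmod z <= r -> radial_cutoff r z = 0.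
Proof.
intros Hr H. apply cutoff_0. rewrite <- Cmod2_alt.
assert (Cmod z ^ 2 <= r ^ 2) by (apply pow_incr; split; [apply Cmod_ge_0|trivial]).
assert (P : 0 < r ^ 2) by (apply pow_lt; trivial).
assert (Cmod z ^ 2 / r ^ 2 <= 1) by (apply Rle_div_l; lra). lra.
Qed.

Lemma radial_cutoff_1 r z : 0 < r -> 2 * r <= Cmod z -> radial_cutoff r z = 1.
Proof.
intros Hr H. apply cutoff_1. rewrite <- Cmod2_alt.
assert ((2 * r) ^ 2 <= Cmod z ^ 2) by (apply pow_incr; lra).
assert (P : 0 < r ^ 2) by (apply pow_lt; trivial).
assert (4 <= Cmod z ^ 2 / r ^ 2) by (apply (proj1 (Rle_div_r _ _ _ P)); lra). lra.
Qed.

Lemma continuous_Re (z : C) : continuous (T := C_UniformSpace) Re z.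
Proof. exact (continuous_fst (U := R_UniformSpace) (V := R_UniformSpace) (fst z) (snd z)). Qed.

Lemma continuous_Im (z : C) : continuous (T := C_UniformSpace) Im z.
Proof. exact (continuous_snd (U := R_UniformSpace) (V := R_UniformSpace) (fst z) (snd z)). Qed.

Lemma radial_cutoff_C1 r : 0 < r -> Ck 1 everywhere (radial_cutoff r).
Proof.
intros Hr.
set (q := fun z : C => ((Re z ^ 2 + Im z ^ 2) / r ^ 2 - 1) / 3).
assert (P : 0 < r ^ 2) by (apply pow_lt; trivial).
assert (qc : forall z, continuous (T := C_UniformSpace) q z).
{ intros z. unfold q.
  apply (continuous_comp_2 Re Im (fun x y => ((x ^ 2 + y ^ 2) / r ^ 2 - 1) / 3) z);
   [apply continuous_Re|apply continuous_Im|].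
  unfold Rdiv, Rminus.
  apply (continuous_mult (K := R_AbsRing)); [|apply continuous_const].
  apply (continuous_plus (V := R_NormedModule)); [|apply continuous_const].
  apply (continuous_mult (K := R_AbsRing)); [|apply continuous_const].
  apply (continuous_plus (V := R_NormedModule)).
  - apply (continuous_comp fst (fun x => x ^ 2)); [apply continuous_fst|].
    apply (ex_derive_continuous (K := R_AbsRing) (V := R_NormedModule)). auto_derive. trivial.
  - apply (continuous_comp snd (fun x => x ^ 2)); [apply continuous_snd|].
    apply (ex_derive_continuous (K := R_AbsRing) (V := R_NormedModule)). auto_derive. trivial. }
assert (Dx : forall z : C, is_derive (fun x => radial_cutoff r (x, Im z)) (Re z) (2 / (3 * r ^ 2) * Re z * dcutoff (q z))).
{ intros z. apply (is_derive_comp cutoff (fun x => ((x ^ 2 + Im z ^ 2) / r ^ 2 - 1) / 3)).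
  - apply cutoff_der.
  - auto_derive; trivial. simpl. field. lra. }
assert (Dy : forall z : C, is_derive (fun y => radial_cutoff r (Re z, y)) (Im z) (2 / (3 * r ^ 2) * Im z * dcutoff (q z))).
{ intros z. apply (is_derive_comp cutoff (fun y => ((Re z ^ 2 + y ^ 2) / r ^ 2 - 1) / 3)).
  - apply cutoff_der.
  - auto_derive; trivial. simpl. field. lra. }
assert (dc : forall z, continuous (T := C_UniformSpace) (fun z => dcutoff (q z)) z).
{ intros z. apply continuous_comp; [apply qc|apply dcutoff_cont]. }
split; [|split; [|split; split; trivial]].
- intros z _. apply (continuous_comp q cutoff); [apply qc|].
  apply (ex_derive_continuous (K := R_AbsRing) (V := R_NormedModule)). eexists. apply cutoff_der.
- intros z _. split; eexists; [apply Dx|apply Dy].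
- intros z _. apply (continuous_ext (fun z : C => 2 / (3 * r ^ 2) * Re z * dcutoff (q z))).
  + intros w. symmetry. apply is_derive_unique, Dx.
  + apply (continuous_mult (K := R_AbsRing)); [|apply dc].
    apply (continuous_mult (K := R_AbsRing)); [apply continuous_const|apply continuous_Re].
- intros z _. apply (continuous_ext (fun z : C => 2 / (3 * r ^ 2) * Im z * dcutoff (q z))).
  + intros w. symmetry. apply is_derive_unique, Dy.
  + apply (continuous_mult (K := R_AbsRing)); [|apply dc].
    apply (continuous_mult (K := R_AbsRing)); [apply continuous_const|apply continuous_Im].
Qed.

(** * The Cauchy-Riemann equation with a source bounded by the Poincare density *)

Fixpoint psum (a : nat -> R) (n : nat) : R :=
  match n with O => 0 | S m => psum a m + a m end.

(** The telescoping majorant controls the tail by e n = K / (n + 1); the limit is the supremum of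
    the lower bounds [psum a n - e n]. The explicit rate is what later makes the convergence uniform
    in z. *)
Lemma psum_limit (a : nat -> R) K : (forall j, Rabs (a j) <= K * (/ (INR j + 1) - / (INR j + 2))) ->
  exists l, forall n, Rabs (l - psum a n) <= K / (INR n + 1).
Proof.
intros H.
set (e := fun n => K / (INR n + 1)).
assert (step : forall n, Rabs (psum a (S n) - psum a n) <= e n - e (S n)).
{ intros n. simpl psum. replace (psum a n + a n - psum a n) with (a n) by ring.
  eapply Rle_trans; [apply H|]. right. unfold e. rewrite S_INR.
  assert (N := pos_INR n). field. lra. }
assert (e0 : forall n k, e (n + k)%nat <= e n /\ Rabs (psum a (n + k)%nat - psum a n) <= e n - e (n + k)%nat).
{ intros n k. induction k as [|k IH].
  - rewrite Nat.add_0_r, Rminus_diag, Rabs_R0. lra.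
  - rewrite Nat.add_succ_r. specialize (step (n + k)%nat).
    assert (P := Rabs_pos (psum a (S (n + k)) - psum a (n + k)%nat)). split; [lra|].
    replace (psum a (S (n + k)) - psum a n) with
      ((psum a (S (n + k)) - psum a (n + k)%nat) + (psum a (n + k)%nat - psum a n)) by ring.
    eapply Rle_trans; [apply Rabs_triang|]. lra. }
assert (pe : 0 <= K).
{ assert (X := H 0%nat). simpl in X. assert (Y := Rabs_pos (a 0%nat)).
  replace (/ (0 + 1) - / (0 + 2)) with (/ 2) in X by field. lra. }
assert (ep : forall n, 0 <= e n).
{ intros n. apply Rdiv_le_0_compat; trivial. generalize (pos_INR n). lra. }
assert (B : forall m n, psum a m - e m <= psum a n + e n).
{ intros m n. destruct (Nat.le_ge_cases m n) as [E|E].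
  - replace n with (m + (n - m))%nat by lia. destruct (e0 m (n - m)%nat) as [_ E2].
    apply Rabs_le_between in E2.
    generalize (ep (m + (n - m))%nat). lra.
  - replace m with (n + (m - n))%nat by lia. destruct (e0 n (m - n)%nat) as [_ E2].
    apply Rabs_le_between in E2.
    generalize (ep (n + (m - n))%nat). lra. }
destruct (completeness (fun y => exists n, y = psum a n - e n)) as [l [L1 L2]].
- exists (psum a 0 + e 0%nat). intros y [n ->]. apply B.
- exists (psum a 0 - e 0%nat), 0%nat. reflexivity.
- exists l. intros n. apply Rabs_le. fold (e n). split.
  + assert (psum a n - e n <= l) by (apply L1; now exists n). lra.
  + assert (l <= psum a n + e n) by (apply L2; intros y [m ->]; apply B). lra.
Qed.

Lemma Rder_psum (a : nat -> C -> R) (l : nat -> C) z :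
  (forall j, Rder (a j) z (l j)) ->
  forall n, Rder (fun w => psum (fun j => a j w) n) z
    (psum (fun j => Re (l j)) n, psum (fun j => Im (l j)) n).
Proof.
intros H n. induction n as [|n IH]; simpl.
- intros eps He. exists 1. split; [lra|]. intros w _.
  change (Re ((0, 0) * (w - z))%C) with (0 * Re (w - z)%C - 0 * Im (w - z)%C).
  replace (0 - 0 - (0 * Re (w - z)%C - 0 * Im (w - z)%C)) with 0 by ring.
  rewrite Rabs_R0. apply Rmult_le_pos; [lra|apply Cmod_ge_0].
- eapply Rder_eq; [|apply Rder_plus; [exact IH|apply H]].
  destruct (l n). reflexivity.
Qed.

Lemma psum_bound (a : nat -> C -> R) : (forall j, exists B, forall z, Rabs (a j z) <= B) ->
  forall n, exists B, forall z, Rabs (psum (fun j => a j z) n) <= B.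
Proof.
intros H n. induction n as [|n [B IH]]; simpl.
- exists 0. intros _. rewrite Rabs_R0. lra.
- destruct (H n) as [B' HB]. exists (B + B'). intros z.
  eapply Rle_trans; [apply Rabs_triang|]. specialize (IH z). specialize (HB z). lra.
Qed.

Lemma psum_plus a b n : psum a n + psum b n = psum (fun j => a j + b j) n.
Proof. induction n as [|n IH]; simpl; [ring|]. rewrite <- IH. ring. Qed.

Lemma psum_ext a b n : (forall j, a j = b j) -> psum a n = psum b n.
Proof. intros H. induction n as [|n IH]; simpl; [trivial|]. now rewrite IH, H. Qed.

Lemma psum_scal k a n : psum (fun j => k * a j) n = k * psum a n.
Proof. induction n as [|n IH]; simpl; [ring|]. rewrite IH. ring. Qed.

Lemma psum_telescope a n : psum (fun j => a (S j) - a j) n = a n - a 0%nat.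
Proof. induction n as [|n IH]; simpl; [ring|]. rewrite IH. ring. Qed.

Lemma open_Cmod_lt r : open (fun z : C => Cmod z < r).
Proof.
apply open_Copen. intros z Hz. exists (r - Cmod z). split; [lra|].
intros w Hw. generalize (Cmod_rev_tri w z). lra.
Qed.

Lemma open_Cmod_gt r : open (fun z : C => r < Cmod z).
Proof.
apply open_Copen. intros z Hz. exists (Cmod z - r). split; [lra|].
intros w Hw. generalize (Cmod_rev_tri z w). rewrite Cmod_sub_sym. lra.
Qed.

Lemma open_punctured_disc : open punctured_disc.
Proof.
apply open_Copen. intros z [Hz N]. apply Cmod_gt_0 in N.
exists (Rmin (1 - Cmod z) (Cmod z)). split; [apply Rmin_glb_lt; lra|].
intros w Hw. assert (A := Rmin_l (1 - Cmod z) (Cmod z)). assert (B := Rmin_r (1 - Cmod z) (Cmod z)).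
split.
- generalize (Cmod_rev_tri w z). lra.
- intros ->. rewrite Cmod_sub_sym in Hw. replace (z - 0)%C with z in Hw by ring. lra.
Qed.

Section Dyadic.
Variables (g : C -> R) (M : R).
Hypothesis gC1 : Ck 1 punctured_disc g.
Hypothesis gM : forall z, punctured_disc z -> Rabs (g z) <= M / (Cmod z ^ 2 * ln (Cmod z) ^ 2).

Definition rad (j : nat) : R := (/ 2) ^ (j + 2).

Lemma rad_pos j : 0 < rad j.
Proof. apply pow_lt. lra. Qed.

Lemma rad_S j : rad (S j) = rad j / 2.
Proof. unfold rad. simpl. field. Qed.

Lemma rad_le j : rad j <= / 4.
Proof.
induction j as [|j IH]; [unfold rad; simpl; lra|]. rewrite rad_S. generalize (rad_pos j). lra.
Qed.

(** The pieces telescope: the first N sum to g times a difference of two cutoffs, which is 1 where 2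
    rad N <= |z| <= 1 / 4. Each piece lives on the annulus rad (j + 1) <= |z| <= 2 rad j, compact in
    the punctured disc, as 2 rad j <= 1 / 2. *)
Definition piece (j : nat) (z : C) : R :=
  (radial_cutoff (rad (S j)) z - radial_cutoff (rad j) z) * g z.

Lemma piece_inner j z : Cmod z <= rad (S j) -> piece j z = 0.
Proof.
intros H. unfold piece. assert (P := rad_pos j). rewrite rad_S in *.
rewrite !radial_cutoff_0; lra.
Qed.

Lemma piece_outer j z : 2 * rad j <= Cmod z -> piece j z = 0.
Proof.
intros H. unfold piece. assert (P := rad_pos j). rewrite rad_S.
rewrite !radial_cutoff_1; lra.
Qed.

Lemma piece_C1 j : Ck 1 everywhere (piece j).
Proof.
assert (P := rad_pos j). assert (P' := rad_pos (S j)). assert (L := rad_le j).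
assert (Z : forall V : C -> Prop, open V -> (forall z, V z -> piece j z = 0) -> Ck 1 V (piece j)).
{ intros V HV H. apply (Ck_ext V HV) with (fun _ => 0); [intros; symmetry; auto|apply Ck_0]. }
apply Ck_local. intros z _.
destruct (Rlt_dec (Cmod z) (rad (S j))) as [H|H].
{ exists (fun z => Cmod z < rad (S j)). split; trivial. apply Z; [apply open_Cmod_lt|].
  intros w Hw. apply piece_inner. lra. }
destruct (Rlt_dec (2 * rad j) (Cmod z)) as [H2|H2].
{ exists (fun z => 2 * rad j < Cmod z). split; trivial. apply Z; [apply open_Cmod_gt|].
  intros w Hw. apply piece_outer. lra. }
exists punctured_disc. split.
{ split; [lra|]. intros ->. rewrite Cmod_0 in H. lra. }
assert (R : forall r, 0 < r -> Ck 1 punctured_disc (radial_cutoff r)).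
{ intros r Hr. apply (Ck_sub _ everywhere); [intros; exact I|]. now apply radial_cutoff_C1. }
apply (Ck_mult _ open_punctured_disc); trivial.
apply (Ck_plus _ open_punctured_disc); auto. apply (Ck_opp _ open_punctured_disc); auto.
Qed.

(** The Poincare bound on the annulus: there |z| >= (2 rad j) / 4, whence 16 = 4^2, and - ln |z| >=
    (j + 1) ln 2. *)
Definition sup_piece (j : nat) : R := 16 * M / ((2 * rad j) ^ 2 * ((INR j + 1) * ln 2) ^ 2).

Lemma ln2_pos : 0 < ln 2.
Proof. rewrite <- ln_1. apply ln_increasing; lra. Qed.

Lemma M_ge0 : 0 <= M.
Proof.
assert (A : Cmod (RtoC (/ 2)) = / 2) by (rewrite Cmod_R, Rabs_pos_eq; lra).
assert (H := gM (RtoC (/ 2)) ltac:(split; [lra|apply RtoC_neq; lra])).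
rewrite A in H. assert (K := Rabs_pos (g (RtoC (/ 2)))). assert (L := ln2_pos).
rewrite ln_Rinv in H by lra.
assert (P : 0 < (/ 2) ^ 2 * (- ln 2) ^ 2) by (apply Rmult_lt_0_compat; nra).
apply Rnot_lt_le. intros N.
assert (0 < (- M) / ((/ 2) ^ 2 * (- ln 2) ^ 2)) by (apply Rdiv_lt_0_compat; lra).
unfold Rdiv in *. lra.
Qed.

Lemma ln_rad j : ln (2 * rad j) = - ((INR j + 1) * ln 2).
Proof.
replace (2 * rad j) with ((/ 2) ^ (j + 1)).
- rewrite ln_pow by lra. rewrite ln_Rinv by lra. rewrite plus_INR. simpl. ring.
- unfold rad. rewrite !pow_add. simpl. field.
Qed.

Lemma piece_bound j z : Rabs (piece j z) <= sup_piece j.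
Proof.
assert (P := rad_pos j). assert (L := rad_le j). assert (L2 := ln2_pos). assert (HM := M_ge0).
assert (NJ := pos_INR j).
assert (Q : 0 < (2 * rad j) ^ 2 * ((INR j + 1) * ln 2) ^ 2).
{ apply Rmult_lt_0_compat; apply pow_lt; [lra|]. apply Rmult_lt_0_compat; lra. }
assert (S0 : 0 <= sup_piece j) by (apply Rdiv_le_0_compat; lra).
destruct (Rle_dec (Cmod z) (rad (S j))) as [H|H]; [rewrite piece_inner, Rabs_R0; trivial|].
destruct (Rle_dec (2 * rad j) (Cmod z)) as [H2|H2]; [rewrite piece_outer, Rabs_R0; trivial|].
rewrite rad_S in H.
set (m := Cmod z) in *.
assert (Pz : punctured_disc z).
{ split; [fold m; lra|]. intros E. unfold m in H. rewrite E, Cmod_0 in H. lra. }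
unfold piece. rewrite Rabs_mult.
assert (X : Rabs (radial_cutoff (rad (S j)) z - radial_cutoff (rad j) z) <= 1).
{ assert (A := cutoff_range (((Re z ^ 2 + Im z ^ 2) / rad (S j) ^ 2 - 1) / 3)).
  assert (B := cutoff_range (((Re z ^ 2 + Im z ^ 2) / rad j ^ 2 - 1) / 3)).
  fold (radial_cutoff (rad (S j)) z) in A. fold (radial_cutoff (rad j) z) in B.
  apply Rabs_le. lra. }
apply Rle_trans with (1 * (M / (m ^ 2 * ln m ^ 2))).
{ apply Rmult_le_compat; auto using Rabs_pos. }
rewrite Rmult_1_l. unfold sup_piece.
assert (Lm : ln m <= - ((INR j + 1) * ln 2)).
{ rewrite <- ln_rad. left. apply ln_increasing; lra. }
set (t := (INR j + 1) * ln 2) in *. assert (Ht : 0 < t) by (apply Rmult_lt_0_compat; lra).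
assert (A1 : t ^ 2 <= ln m ^ 2) by nra.
assert (A2 : (2 * rad j) ^ 2 <= 16 * m ^ 2) by nra.
apply Rle_trans with (M / (m ^ 2 * t ^ 2)).
- apply Rmult_le_compat_l; trivial. apply Rinv_le_contravar; [nra|]. apply Rmult_le_compat_l; nra.
- assert (0 < m) by lra.
  replace (M / (m ^ 2 * t ^ 2)) with (16 * M / (16 * m ^ 2 * t ^ 2)) by (field; lra).
  apply Rmult_le_compat_l; [lra|]. apply Rinv_le_contravar; trivial. apply Rmult_le_compat_r; nra.
Qed.

(** [CT_decay] divided by 2 pi gives 64 pi M / (ln 2)^2 times 1 / (j + 1)^2. The factor is doubled
    because 1 / (2 (j + 1)^2) <= 1 / (j + 1) - 1 / (j + 2). *)
Definition CRconst : R := 128 * PI * M / ln 2 ^ 2.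

Section Kernel.
Variable k : R -> R.
Hypothesis kc : forall t, continuous k t.
Hypothesis kb : forall t, Rabs (k t) <= 1.
Hypothesis kp : forall t, k (t + 2 * PI) = k t.

Definition term (j : nat) (z : C) : R := / (2 * PI) * CT k (piece j) z.

Lemma term_bound j : exists B, forall z, Rabs (term j z) <= B.
Proof.
assert (HPI := PI_RGT_0). assert (P := rad_pos j).
exists (/ (2 * PI) * (4 * PI ^ 2 * sup_piece j * (2 * rad j))). intros z. unfold term.
assert (I := Rinv_0_lt_compat (2 * PI) ltac:(lra)).
rewrite Rabs_mult, (Rabs_pos_eq (/ (2 * PI))) by lra. apply Rmult_le_compat_l; [lra|].
apply CT_bound; trivial; [apply p_cont, piece_C1|lra|apply piece_bound|].
intros w Hw. apply piece_outer. lra.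
Qed.

(** The radius cancels between the height and the area of the support of the piece, so only the
    logarithmic factor 1 / (j + 1)^2 is left. It is summable, which is all that the Poincare growth
    of g allows. *)
Lemma term_decay j (z : C) : z <> 0 ->
  Rabs (term j z) <= CRconst / Cmod z * (/ (INR j + 1) - / (INR j + 2)).
Proof.
intros N. apply Cmod_gt_0 in N.
assert (HPI := PI_RGT_0). assert (P := rad_pos j). assert (L2 := ln2_pos). assert (HM := M_ge0).
assert (NJ := pos_INR j). assert (I := Rinv_0_lt_compat (2 * PI) ltac:(lra)).
assert (D : Cmod z * Rabs (CT k (piece j) z) <= 8 * PI ^ 2 * sup_piece j * (2 * rad j) ^ 2).
{ apply CT_decay; trivial; [apply p_cont, piece_C1|lra|apply piece_bound|].
  intros w Hw. apply piece_outer. lra. }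
unfold term. rewrite Rabs_mult, (Rabs_pos_eq (/ (2 * PI))) by lra.
apply (Rmult_le_reg_l (Cmod z)); trivial.
apply Rle_trans with (/ (2 * PI) * (8 * PI ^ 2 * sup_piece j * (2 * rad j) ^ 2)).
{ replace (Cmod z * (/ (2 * PI) * Rabs (CT k (piece j) z))) with
    (/ (2 * PI) * (Cmod z * Rabs (CT k (piece j) z))) by ring. apply Rmult_le_compat_l; lra. }
unfold sup_piece, CRconst.
replace (/ (2 * PI) * (8 * PI ^ 2 * (16 * M / ((2 * rad j) ^ 2 * ((INR j + 1) * ln 2) ^ 2)) * (2 * rad j) ^ 2))
  with ((128 * PI * M / ln 2 ^ 2) * (/ 2 * / (INR j + 1) ^ 2)) by (field; lra).
replace (Cmod z * (128 * PI * M / ln 2 ^ 2 / Cmod z * (/ (INR j + 1) - / (INR j + 2))))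
  with ((128 * PI * M / ln 2 ^ 2) * (/ ((INR j + 1) * (INR j + 2)))) by (field; lra).
apply Rmult_le_compat_l.
{ apply Rdiv_le_0_compat; [|apply pow_lt; lra]. apply Rmult_le_pos; lra. }
rewrite <- Rinv_mult. apply Rinv_le_contravar; nra.
Qed.

Lemma term_Rder j z : Cmod z < 1 ->
  Rder (term j) z (/ (2 * PI) * CT k (dx (piece j)) z, - (/ (2 * PI) * CT k (dy (piece j)) z)).
Proof.
intros Hz. eapply Rder_eq; [|apply Rder_scal, CT_Rder; trivial; apply piece_C1].
unfold RtoC, Cmult. simpl. f_equal; ring.
Qed.

End Kernel.

(** The limit [D] solves [(d/dx + i d/dy) D = g] near the puncture, with
    [D = o(1/|z|)]: the partial sums [X N + i Y N] converge to [D], and the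
    equation holds for them exactly where the first [N] pieces exhaust [g]. *)
Lemma CR_solution : exists (X Y : nat -> C -> R) (D : C -> C) (K : R),
  (forall N (z : C), z <> 0 -> Cmod (D z - (X N z, Y N z))%C <= K / (INR N + 1) / Cmod z) /\
  (forall N, exists B, forall z, Cmod ((X N z, Y N z) : C) <= B) /\
  (forall N z, Cmod z <= / 4 -> 2 * rad N <= Cmod z ->
     exists l m, Rder (X N) z l /\ Rder (Y N) z m /\ Re l + Im m = g z /\ Re m = Im l).
Proof.
assert (HPI := PI_RGT_0).
assert (c1 := continuous_cos). assert (s1 := continuous_sin).
assert (cb : forall t, Rabs (cos t) <= 1) by (intros; apply Rabs_le, COS_bound).
assert (sb : forall t, Rabs (sin t) <= 1) by (intros; apply Rabs_le, SIN_bound).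
assert (cp : forall t, cos (t + 2 * PI) = cos t).
{ intros t. rewrite cos_plus, cos_2PI, sin_2PI. ring. }
assert (sp : forall t, sin (t + 2 * PI) = sin t).
{ intros t. rewrite sin_plus, cos_2PI, sin_2PI. ring. }
set (A := term cos). set (B := fun j z => -1 * term sin j z).
set (X := fun N z => psum (fun j => A j z) N). set (Y := fun N z => psum (fun j => B j z) N).
assert (Bb : forall j z, Rabs (B j z) = Rabs (term sin j z)).
{ intros j z. unfold B. rewrite Rabs_mult, Rabs_left1 by lra. ring. }
assert (lim : forall z : C, exists d : C, z <> 0 -> forall N,
   Cmod (d - (X N z, Y N z))%C <= 2 * CRconst / (INR N + 1) / Cmod z).
{ intros z. destruct (Ceq_dec z 0) as [E|N]; [exists 0; intros F; contradiction|].
  destruct (psum_limit (fun j => A j z) (CRconst / Cmod z)) as [u Hu].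
  { intros j. now apply term_decay. }
  destruct (psum_limit (fun j => B j z) (CRconst / Cmod z)) as [v Hv].
  { intros j. rewrite Bb. now apply term_decay. }
  exists (u, v). intros _ n. eapply Rle_trans; [apply Cmod_Rabs_le|].
  change (Re ((u, v) - (X n z, Y n z))%C) with (u - X n z).
  change (Im ((u, v) - (X n z, Y n z))%C) with (v - Y n z).
  specialize (Hu n). specialize (Hv n). fold (X n z) in Hu. fold (Y n z) in Hv.
  apply Cmod_gt_0 in N. assert (P := pos_INR n).
  replace (2 * CRconst / (INR n + 1) / Cmod z) with
    (CRconst / Cmod z / (INR n + 1) + CRconst / Cmod z / (INR n + 1)) by (field; lra).
  lra. }
set (D := fun z : C => epsilon (inhabits (RtoC 0)) (fun d : C => z <> 0 -> forall N,
   Cmod (d - (X N z, Y N z))%C <= 2 * CRconst / (INR N + 1) / Cmod z)).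
exists X, Y, D, (2 * CRconst). split; [|split].
- intros N z Hz. exact (epsilon_spec (inhabits (RtoC 0)) _ (lim z) Hz N).
- intros N. destruct (psum_bound A (fun j => term_bound cos c1 cb j) N) as [B1 H1].
  destruct (psum_bound B) with (n := N) as [B2 H2].
  { intros j. destruct (term_bound sin s1 sb j) as [B2 H2]. exists B2. intros z. now rewrite Bb. }
  exists (B1 + B2). intros z. eapply Rle_trans; [apply Cmod_Rabs_le|]. simpl.
  specialize (H1 z). specialize (H2 z). unfold X, Y. lra.
- intros N z Hz1 Hz2.
  assert (HA : forall j, Rder (A j) z (/ (2 * PI) * CT cos (dx (piece j)) z, - (/ (2 * PI) * CT cos (dy (piece j)) z))).
  { intros j. apply term_Rder; trivial. lra. }
  assert (HB : forall j, Rder (B j) z (- (/ (2 * PI) * CT sin (dx (piece j)) z), / (2 * PI) * CT sin (dy (piece j)) z)).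
  { intros j. eapply Rder_eq; [|apply Rder_scal, term_Rder; trivial; lra].
    unfold RtoC, Cmult. simpl. f_equal; ring. }
  (* In the convention of [Rder] the last two claims are X_x - Y_y = g and Y_x = - X_y, the real and
     imaginary parts of the equation; they come from [CT_div] and [CT_curl]. *)
  eexists. eexists. split; [|split; [|split]].
  + exact (Rder_psum A _ z HA N).
  + exact (Rder_psum B _ z HB N).
  + cbn [Re Im fst snd]. rewrite psum_plus.
    transitivity (psum (fun j => piece j z) N).
    * apply psum_ext. intros j. unfold Re, Im. simpl.
      rewrite <- Rmult_plus_distr_l, CT_div; [field; lra|apply piece_C1| |lra].
      intros w Hw. apply piece_outer. generalize (rad_le j). lra.
    * unfold piece. transitivity (psum (fun j => g z * (radial_cutoff (rad (S j)) z - radial_cutoff (rad j) z)) N).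
      { apply psum_ext. intros; ring. }
      rewrite psum_scal, (psum_telescope (fun j => radial_cutoff (rad j) z)).
      rewrite radial_cutoff_1, radial_cutoff_0; trivial; try apply rad_pos; [ring|].
      unfold rad. simpl. lra.
  + cbn [Re Im fst snd]. apply psum_ext. intros j. unfold Re, Im. simpl.
    assert (E := CT_curl (piece j) (piece_C1 j) z). f_equal. f_equal. lra.
Qed.

End Dyadic.

(** * Sections of the pull-back by the exponential *)

Definition Cexp (w : C) : C := (exp (Re w) * cos (Im w), exp (Re w) * sin (Im w)).

Lemma Cexp_der w : Cder Cexp w (Cexp w).
Proof.
set (p := fun w : C => exp (Re w) * cos (Im w)). set (q := fun w : C => exp (Re w) * sin (Im w)).
assert (pc : forall w, continuous (T := C_UniformSpace) p w).
{ intros z. apply (continuous_mult (K := R_AbsRing)).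
  - apply continuous_comp; [apply continuous_Re|]. apply continuous_exp.
  - apply continuous_comp; [apply continuous_Im|]. apply continuous_cos. }
assert (qc : forall w, continuous (T := C_UniformSpace) q w).
{ intros z. apply (continuous_mult (K := R_AbsRing)).
  - apply continuous_comp; [apply continuous_Re|]. apply continuous_exp.
  - apply continuous_comp; [apply continuous_Im|]. apply continuous_sin. }
assert (px : forall w : C, is_derive (fun x => p (x, Im w)) (Re w) (p w)).
{ intros z. unfold p. simpl. auto_derive; trivial. unfold Re, Im. ring. }
assert (py : forall w : C, is_derive (fun y => p (Re w, y)) (Im w) (- q w)).
{ intros z. unfold p, q. simpl. auto_derive; trivial. unfold Re, Im. ring. }
assert (qx : forall w : C, is_derive (fun x => q (x, Im w)) (Re w) (q w)).
{ intros z. unfold q. simpl. auto_derive; trivial. unfold Re, Im. ring. }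
assert (qy : forall w : C, is_derive (fun y => q (Re w, y)) (Im w) (p w)).
{ intros z. unfold p, q. simpl. auto_derive; trivial. unfold Re, Im. ring. }
assert (Cp : Ck 1 everywhere p).
{ split; [intros; apply pc|]. split.
  { intros z _. split; eexists; [apply px|apply py]. }
  split; split; trivial; intros z _.
  - apply (continuous_ext p); [|apply pc]. intros v. symmetry. apply is_derive_unique, px.
  - apply (continuous_ext (fun v => - q v)); [|apply (continuous_opp (V := R_NormedModule)), qc].
    intros v. symmetry. apply is_derive_unique, py. }
assert (Cq : Ck 1 everywhere q).
{ split; [intros; apply qc|]. split.
  { intros z _. split; eexists; [apply qx|apply qy]. }
  split; split; trivial; intros z _.
  - apply (continuous_ext q); [|apply qc]. intros v. symmetry. apply is_derive_unique, qx.
  - apply (continuous_ext p); [|apply pc]. intros v. symmetry. apply is_derive_unique, qy. }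
apply (Cder_of_Rder p q).
- eapply Rder_eq; [|apply (C1_Rder everywhere); trivial; [apply open_everywhere|exact I]].
  assert (e1 : dx p w = p w) by exact (is_derive_unique _ _ _ (px w)).
  assert (e2 : dy p w = - q w) by exact (is_derive_unique _ _ _ (py w)).
  unfold grad. rewrite e1, e2.
  unfold Cexp. fold (p w) (q w). now rewrite Ropp_involutive.
- eapply Rder_eq; [|apply (C1_Rder everywhere); trivial; [apply open_everywhere|exact I]].
  assert (e1 : dx q w = q w) by exact (is_derive_unique _ _ _ (qx w)).
  assert (e2 : dy q w = p w) by exact (is_derive_unique _ _ _ (qy w)).
  unfold grad. rewrite e1, e2.
  unfold Cexp. fold (p w) (q w). unfold Cmult, Copp, Ci. simpl. f_equal; ring.
Qed.

Lemma Cmod_Cexp w : Cmod (Cexp w) = exp (Re w).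
Proof.
change (Cexp w) with (circ (exp (Re w)) (Im w)). rewrite Cmod_circ.
apply Rabs_pos_eq. left. apply exp_pos.
Qed.

Lemma Cexp_neq0 w : Cexp w <> 0.
Proof. apply Cmod_gt_0. rewrite Cmod_Cexp. apply exp_pos. Qed.

Lemma Cexp_plus a b : Cexp (a + b)%C = (Cexp a * Cexp b)%C.
Proof.
destruct a as [x y], b as [u v]. unfold Cexp. simpl.
rewrite exp_plus, cos_plus, sin_plus. unfold Cmult. simpl. f_equal; ring.
Qed.

Definition two_pi_i : C := (0, 2 * PI).

Lemma Cexp_2pi_i : Cexp two_pi_i = 1.
Proof. unfold Cexp, two_pi_i. simpl. now rewrite exp_0, cos_2PI, sin_2PI, Rmult_0_r, Rmult_1_l. Qed.

Lemma Cexp_period w : Cexp (w + two_pi_i)%C = Cexp w.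
Proof. rewrite Cexp_plus, Cexp_2pi_i. ring. Qed.

Lemma Cexp_onto (z : C) : z <> 0 -> exists w, Cexp w = z.
Proof.
intros N. apply Cmod_gt_0 in N. destruct (polar z) as [a Ea].
exists (ln (Cmod z), a). rewrite Ea at 2. unfold Cexp, circ. simpl. now rewrite exp_ln.
Qed.

(** Morera's argument: the rectangle integrals of f vanish as limits of those of the approximants,
    and [primitive_rect] asks for no more than this and continuity. The third hypothesis supplies
    the estimate on full neighbourhoods, for continuity at the boundary of the rectangle; N0 is
    there because the approximants are differentiable only from some index on. *)
Lemma uniform_limit_primitive (fN dfN : nat -> C -> C) (f : C -> C) a b c d N0 K :
  a <= b -> c <= d ->
  (forall n z, (N0 <= n)%nat -> in_rect a b c d z -> Cder (fN n) z (dfN n z)) ->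
  (forall n z, in_rect a b c d z -> Cmod (f z - fN n z)%C <= K / (INR n + 1)) ->
  (forall z, in_rect a b c d z -> exists e, 0 < e /\ forall w, Cmod (w - z)%C < e ->
     forall n, Cmod (f w - fN n w)%C <= K / (INR n + 1)) ->
  exists F, forall z, in_orect a b c d z -> Cder F z (f z).
Proof.
intros Hab Hcd Hd Hf Hloc.
assert (small : forall eps, 0 < eps -> exists n, (N0 <= n)%nat /\ K / (INR n + 1) < eps).
{ intros eps He. destruct (INR_unbounded (Rabs K / eps)) as [m Hm].
  exists (Nat.max N0 m). split; [lia|].
  assert (A : INR m <= INR (Nat.max N0 m)) by (apply le_INR; lia).
  assert (P := pos_INR m). apply Rlt_div_l; [lra|].
  apply (Rmult_lt_compat_r eps) in Hm; trivial.
  replace (Rabs K / eps * eps) with (Rabs K) in Hm by (field; lra).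
  assert (B := Rle_abs K). nra. }
assert (fc : forall z, in_rect a b c d z -> Ccont f z).
{ intros z Hz eps He. destruct (small (eps / 3)) as (n & Hn & Kn); [lra|].
  destruct (Hloc z Hz) as (e & He1 & L).
  destruct (Cder_cont _ _ _ (Hd n z Hn Hz) (eps / 3)) as (e2 & He2 & A); [lra|].
  exists (Rmin e e2). split; [now apply Rmin_glb_lt|]. intros w Hw.
  specialize (L w (Rlt_le_trans _ _ _ Hw (Rmin_l _ _)) n).
  specialize (A w (Rlt_le_trans _ _ _ Hw (Rmin_r _ _))).
  specialize (Hf n z Hz). rewrite Cmod_sub_sym in Hf.
  replace (f w - f z)%C with ((f w - fN n w) + (fN n w - fN n z) + (fN n z - f z))%C by ring.
  eapply Rle_lt_trans; [apply Cmod_triangle|].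
  eapply Rle_lt_trans; [apply Rplus_le_compat_r, Cmod_triangle|]. lra. }
apply primitive_rect; trivial.
intros x y Hx Hy. apply Cmod_eq_0. apply Rle_antisym; [|apply Cmod_ge_0].
apply Rnot_lt_le. intros P. set (r := Cmod (rect_int f a x c y)) in *.
set (s := 2 * ((x - a) + (y - c)) + 1). assert (Hs : 0 < s) by (unfold s; lra).
destruct (small (r / s)) as (n & Hn & Kn); [now apply Rdiv_lt_0_compat|].
assert (sub : forall z, in_rect a x c y z -> in_rect a b c d z) by (intros z [? ?]; split; lra).
assert (fNc : forall z, in_rect a x c y z -> Ccont (fN n) z).
{ intros z Hz. eapply Cder_cont. apply Hd; auto. }
assert (G : rect_int (fN n) a x c y = 0).
{ apply (Goursat _ (dfN n)); try lra. intros z Hz. apply Hd; auto. }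
assert (E := rect_int_minus f (fN n) a x c y ltac:(lra) ltac:(lra) (fun z Hz => fc z (sub z Hz)) fNc).
rewrite G in E. replace (rect_int f a x c y - 0)%C with (rect_int f a x c y) in E by ring.
assert (B : r <= 2 * ((x - a) + (y - c)) * (K / (INR n + 1))).
{ unfold r. rewrite <- E. apply rect_int_bound; try lra.
  - intros z Hz. apply Ccont_minus; [apply fc; auto|auto].
  - intros z Hz. apply Hf; auto. }
apply (Rmult_lt_compat_r s) in Kn; trivial.
replace (r / s * s) with r in Kn by (field; lra).
assert (0 <= K / (INR n + 1)).
{ eapply Rle_trans; [apply Cmod_ge_0|]. apply (Hf n (a, c)). split; simpl; lra. }
unfold s in Kn. lra.
Qed.

(** * Local frames whose norm has the prescribed logarithmic differential *)

Lemma dx_dy_comm (U : C -> Prop) (u : C -> R) z : open U -> Ck 2 U u -> U z ->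
  dx (dy u) z = dy (dx u) z.
Proof.
intros HU (_ & H1 & Hx & Hy) Hz.
destruct Hx as (_ & Hx1 & [Hxx _] & [Hxy _]). destruct Hy as (_ & Hy1 & [Hyx _] & [Hyy _]).
apply (Schwarz (fun a b => u (a, b)) (Re z) (Im z)).
- destruct (proj1 (open_Copen U) HU z Hz) as (d & Hd & K).
  assert (Hd2 : 0 < d / 2) by lra. exists (mkposreal _ Hd2). intros a b Ha Hb.
  simpl in Ha, Hb. assert (Uv : U (a, b)).
  { apply K. eapply Rle_lt_trans; [apply Cmod_Rabs_le|].
    change (Rabs (a - Re z) + Rabs (b - Im z) < d). lra. }
  destruct (H1 _ Uv) as [A1 A2]. destruct (Hx1 _ Uv) as [B1 B2]. destruct (Hy1 _ Uv) as [C1 C2].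
  repeat split; trivial.
- exact (continuous_2d (dx (dy u)) z (Hyx z Hz)).
- exact (continuous_2d (dy (dx u)) z (Hxy z Hz)).
Qed.

Lemma trans_id (L : line_bundle) i z : chart L i z -> trans L i i z = 1.
Proof.
intros Hi. assert (E := trans_cocycle L i i i z Hi Hi Hi).
assert (N := trans_neq0 L i i z Hi Hi).
transitivity (/ trans L i i z * (trans L i i z * trans L i i z))%C; [field; trivial|].
rewrite E. field. trivial.
Qed.

Section Bundle.
Variables (L : line_bundle) (h : hermitian_metric L).

Definition lnorm (S : section L) (w : C) : R :=
  ln (weight h (chart_at L (Cexp w)) (Cexp w) * Cmod (S (chart_at L (Cexp w)) w) ^ 2).

(** [S] is a section of the pull-back of [L] by [exp] over [W], whose squared
    norm has logarithmic differential [Re (D dz)]. *)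
Record lifted (D : C -> C) (W : C -> Prop) (S : section L) : Prop := {
  lf_sub : forall w, W w -> punctured_disc (Cexp w);
  lf_holo : forall i w, W w -> chart L i (Cexp w) -> exists l, Cder (S i) w l;
  lf_trans : forall i j w, W w -> chart L i (Cexp w) -> chart L j (Cexp w) ->
    S i w = (trans L i j (Cexp w) * S j w)%C;
  lf_neq0 : forall i w, W w -> chart L i (Cexp w) -> S i w <> 0;
  lf_norm : forall w, W w -> Rder (lnorm S) w (D (Cexp w) * Cexp w)%C
}.

Lemma lnorm_chart (S : section L) i w : punctured_disc (Cexp w) -> chart L i (Cexp w) ->
  (forall i j, chart L i (Cexp w) -> chart L j (Cexp w) ->
    S i w = (trans L i j (Cexp w) * S j w)%C) ->
  lnorm S w = ln (weight h i (Cexp w) * Cmod (S i w) ^ 2).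
Proof.
intros P Hi T. unfold lnorm. set (j := chart_at L (Cexp w)).
assert (Hj : chart L j (Cexp w)) by now apply chart_cover.
rewrite (T i j Hi Hj), Cmod_mult, Rpow_mult_distr.
rewrite (weight_trans L h i j) by trivial. f_equal. ring.
Qed.

Variables (g : C -> R) (X Y : nat -> C -> R) (D : C -> C) (K : R).
Hypothesis lap : forall i z, chart L i z ->
  dx (dx (fun z => ln (weight h i z))) z + dy (dy (fun z => ln (weight h i z))) z = g z.
Hypothesis Dlim : forall N (z : C), z <> 0 ->
  Cmod (D z - (X N z, Y N z))%C <= K / (INR N + 1) / Cmod z.
Hypothesis CR : forall N z, Cmod z <= / 4 -> 2 * rad N <= Cmod z ->
  exists l m, Rder (X N) z l /\ Rder (Y N) z m /\ Re l + Im m = g z /\ Re m = Im l.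

(** With u = log h(e_i, e_i), the operator d/dx + i d/dy sends [grad u] to the Laplacian of u, that
    is g, and so [grad u] minus the partial sum is holomorphic where the partial sum solves the
    equation. The limit f = grad u - D then has a primitive Q, and the frame exp (- Q / 2) e_i has
    logarithmic norm u - Re Q, with differential Re (D dz). *)
Lemma lifted_local w0 : Cmod (Cexp w0) < / 4 ->
  exists e S, 0 < e /\ lifted D (fun w => Cmod (w - w0)%C < e) S.
Proof.
intros H0. set (z0 := Cexp w0) in *.
assert (Nz : z0 <> 0) by apply Cexp_neq0. assert (Pz : 0 < Cmod z0) by now apply Cmod_gt_0.
assert (Dz : punctured_disc z0) by (split; [lra|trivial]).
set (i := chart_at L z0). assert (Ci0 : chart L i z0) by now apply chart_cover.
set (u := fun z => ln (weight h i z)).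
assert (Uo := chart_open L i).
assert (Cu : forall n, Ck n (chart L i) u).
{ intros n. apply Ck_ln; trivial; [apply weight_pos|apply weight_smooth]. }
destruct (proj1 (open_Copen _) Uo z0 Ci0) as (d & Hd & Kd).
(* The square of half-side dl around z0 has radius at most 2 dl; the third dl is the margin for the
   neighbourhoods of its points. *)
set (dl := Rmin d (Rmin (Cmod z0 / 2) (/ 4 - Cmod z0)) / 3).
assert (Hdl : 0 < dl).
{ unfold dl. assert (0 < Rmin d (Rmin (Cmod z0 / 2) (/ 4 - Cmod z0))) by (repeat apply Rmin_glb_lt; lra). lra. }
assert (Ldl : 3 * dl <= d /\ 3 * dl <= Cmod z0 / 2 /\ 3 * dl <= / 4 - Cmod z0).
{ unfold dl. generalize (Rmin_l d (Rmin (Cmod z0 / 2) (/ 4 - Cmod z0)))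
   (Rmin_r d (Rmin (Cmod z0 / 2) (/ 4 - Cmod z0))) (Rmin_l (Cmod z0 / 2) (/ 4 - Cmod z0))
   (Rmin_r (Cmod z0 / 2) (/ 4 - Cmod z0)). lra. }
assert (near : forall z, Cmod (z - z0)%C < 3 * dl ->
  chart L i z /\ Cmod z < / 4 /\ Cmod z0 / 2 <= Cmod z /\ z <> 0).
{ intros z Hz. assert (A := Cmod_rev_tri z z0). assert (B := Cmod_rev_tri z0 z).
  rewrite Cmod_sub_sym in B. split; [apply Kd; lra|]. split; [lra|]. split; [lra|].
  apply Cmod_gt_0. lra. }
set (a := Re z0 - dl). set (b := Re z0 + dl). set (c := Im z0 - dl). set (d' := Im z0 + dl).
assert (sq : forall z, in_rect a b c d' z -> Cmod (z - z0)%C <= 2 * dl).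
{ intros z [Z1 Z2]. eapply Rle_trans; [apply Cmod_Rabs_le|].
  change (Rabs (Re z - Re z0) + Rabs (Im z - Im z0) <= 2 * dl).
  assert (Rabs (Re z - Re z0) <= dl) by (apply Rabs_le; unfold a, b in Z1; lra).
  assert (Rabs (Im z - Im z0) <= dl) by (apply Rabs_le; unfold c, d' in Z2; lra). lra. }
set (fN := fun N z => (grad u z - (X N z, Y N z))%C).
set (f := fun z => (grad u z - D z)%C).
assert (est : forall z, Cmod (z - z0)%C < 3 * dl -> forall n,
  Cmod (f z - fN n z)%C <= (2 * K / Cmod z0) / (INR n + 1)).
{ intros z Hz n. destruct (near z Hz) as (_ & _ & B & N). unfold f, fN.
  replace (grad u z - D z - (grad u z - (X n z, Y n z)))%C with (- (D z - (X n z, Y n z)))%C by ring.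
  rewrite Cmod_opp. assert (T := Dlim n z N). eapply Rle_trans; [exact T|].
  assert (Pn := pos_INR n). assert (P2 : 0 < Cmod z) by lra.
  assert (KK : 0 <= K / (INR n + 1)).
  { assert (Q : 0 <= K / (INR n + 1) / Cmod z) by (eapply Rle_trans; [apply Cmod_ge_0|exact T]).
    apply (Rmult_le_compat_r (Cmod z)) in Q; [|lra].
    replace (K / (INR n + 1) / Cmod z * Cmod z) with (K / (INR n + 1)) in Q by (field; lra). lra. }
  replace (2 * K / Cmod z0 / (INR n + 1)) with (K / (INR n + 1) * / (Cmod z0 / 2)) by (field; lra).
  apply Rmult_le_compat_l; trivial. apply Rinv_le_contravar; lra. }
(* From N0 on, 2 rad N <= |z0| / 2, so the pieces summed so far exhaust g on the whole square. *)
destruct (pow2_small 1 (Cmod z0 / 4)) as [N0 HN0]; [lra|].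
assert (radN : forall N, (N0 <= N)%nat -> 2 * rad N <= Cmod z0 / 2).
{ intros N HN. assert (R1 : rad N <= (/ 2) ^ N0).
  { unfold rad. replace (N + 2)%nat with (N0 + (N + 2 - N0))%nat by lia. rewrite pow_add.
    assert (P1 : 0 < (/ 2) ^ N0) by (apply pow_lt; lra).
    assert (P2 : (/ 2) ^ (N + 2 - N0) <= 1 ^ (N + 2 - N0)) by (apply pow_incr; lra).
    rewrite pow1 in P2. nra. }
  assert (P2 : 0 < 2 ^ N0) by (apply pow_lt; lra).
  rewrite pow_inv in R1. unfold Rdiv in HN0. lra. }
assert (dN : forall n z, exists l, (N0 <= n)%nat -> in_rect a b c d' z -> Cder (fN n) z l).
{ intros n z. destruct (excluded_middle_informative ((N0 <= n)%nat /\ in_rect a b c d' z)) as [[Hn Hz]|N].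
  2:{ exists (RtoC 0). intros; exfalso; auto. }
  destruct (near z) as (B1 & B2 & B3 & B4). { apply sq in Hz. lra. }
  destruct (CR n z) as (l & m & Hl & Hm & E1 & E2); [lra|specialize (radN n Hn); lra|].
  assert (Cx : Ck 1 (chart L i) (dx u)) by apply (Cu 2%nat).
  assert (Cy : Ck 1 (chart L i) (dy u)) by apply (Cu 2%nat).
  assert (Gx := C1_Rder _ _ z Uo Cx B1). assert (Gy := C1_Rder _ _ z Uo Cy B1).
  assert (Com := dx_dy_comm _ _ z Uo (Cu 2%nat) B1).
  assert (Lp := lap i z B1). fold u in Lp.
  eexists. intros _ _.
  apply (Cder_ext (fun w => (dx u w - X n w, -1 * dy u w - Y n w))).
  { intros w. unfold fN, grad, Cminus, Cplus, Copp. simpl. f_equal; ring. }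
  apply Cder_of_Rder.
  - apply Rder_minus; [exact Gx|exact Hl].
  (* The Cauchy-Riemann equations for [fN]: the Laplace equation [Lp] cancels against [E1], and the
     mixed derivatives, equal by [Com], against [E2]. *)
  - eapply Rder_eq; [|apply Rder_minus; [apply Rder_scal; exact Gy|exact Hm]].
    destruct l as [l1 l2], m as [m1 m2]. unfold Re, Im in E1, E2. simpl in E1, E2. unfold grad.
    unfold Cminus, Cplus, Copp, Cmult, Ci, RtoC. simpl. f_equal; [rewrite Com|]; lra. }
set (dfN := fun n z => epsilon (inhabits (RtoC 0))
   (fun l => (N0 <= n)%nat -> in_rect a b c d' z -> Cder (fN n) z l)).
destruct (uniform_limit_primitive fN dfN f a b c d' N0 (2 * K / Cmod z0)) as [Q HQ].
- unfold a, b; lra.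
- unfold c, d'; lra.
- intros n z. exact (epsilon_spec (inhabits (RtoC 0)) _ (dN n z)).
- intros n z Hz. apply est. apply sq in Hz. lra.
- intros z Hz. exists dl. split; trivial. intros w Hw. apply est.
  apply sq in Hz. generalize (Cmod_tri3 w z z0). lra.
- destruct (Cder_cont _ _ _ (Cexp_der w0) dl Hdl) as (e & He & Ke).
  (* The section whose coordinate in the chart i is exp (- Q / 2), transported to the other
     charts. *)
  set (S := fun j w => (trans L j i (Cexp w) * Cexp (- Q (Cexp w) / 2))%C).
  exists e, S. split; trivial.
  assert (inn : forall w, Cmod (w - w0)%C < e -> Cmod (Cexp w - z0)%C < dl) by exact Ke.
  assert (ch : forall w, Cmod (w - w0)%C < e -> chart L i (Cexp w) /\ punctured_disc (Cexp w)).
  { intros w Hw. destruct (near (Cexp w)) as (B1 & B2 & B3 & B4); [specialize (inn w Hw); lra|].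
    split; trivial. split; [lra|trivial]. }
  assert (dQ : forall w, Cmod (w - w0)%C < e -> Cder (fun w => Q (Cexp w)) w (f (Cexp w) * Cexp w)%C).
  { intros w Hw. apply (Cder_comp Q Cexp); [|apply Cexp_der]. apply HQ.
    specialize (inn w Hw). assert (A1 := re_le_Cmod (Cexp w - z0)%C). assert (A2 := Im_le_Cmod (Cexp w - z0)%C).
    change (Rabs (Re (Cexp w) - Re z0) <= Cmod (Cexp w - z0)%C) in A1.
    change (Rabs (Im (Cexp w) - Im z0) <= Cmod (Cexp w - z0)%C) in A2.
    assert (A1' : - dl < Re (Cexp w) - Re z0 < dl) by (apply Rabs_lt_between; lra).
    assert (A2' : - dl < Im (Cexp w) - Im z0 < dl) by (apply Rabs_lt_between; lra).
    unfold a, b, c, d'. split; lra. }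
  assert (St : forall w, Cmod (w - w0)%C < e -> forall j k, chart L j (Cexp w) -> chart L k (Cexp w) ->
    S j w = (trans L j k (Cexp w) * S k w)%C).
  { intros w Hw j k Hj Hk. unfold S. rewrite Cmult_assoc, trans_cocycle; trivial. now apply ch. }
  split.
  + intros w Hw. now apply ch.
  + intros j w Hw Hj. destruct (ch w Hw) as [Hi _].
    destruct (proj1 (ex_derive_Cder _ _) (trans_holo L j i (Cexp w) (conj Hj Hi))) as [l Hl].
    eexists. apply Cder_mult.
    * apply (Cder_comp (trans L j i) Cexp); [exact Hl|apply Cexp_der].
    * apply (Cder_comp Cexp (fun w => - Q (Cexp w) / 2)%C); [apply Cexp_der|].
      apply (Cder_ext (fun w => (- / 2) * Q (Cexp w))%C); [intros; field|].
      apply Cder_scal. now apply dQ.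
  + intros j k w Hw. now apply St.
  + intros j w Hw Hj. apply Cmult_neq_0; [|apply Cexp_neq0].
    apply trans_neq0; trivial. now apply ch.
  + intros w Hw. destruct (ch w Hw) as [Hi Hp].
    apply Rder_ext_loc with (fun w => u (Cexp w) - Re (Q (Cexp w))).
    * exists (e - Cmod (w - w0)%C). split; [lra|]. intros v Hv.
      assert (Hv' : Cmod (v - w0)%C < e) by (generalize (Cmod_tri3 v w w0); lra).
      destruct (ch v Hv') as [Hiv Hpv].
      rewrite (lnorm_chart S i v Hpv Hiv (St v Hv')). unfold S.
      rewrite trans_id, Cmult_1_l, Cmod_Cexp by trivial.
      assert (Wp := weight_pos L h i _ Hiv).
      rewrite ln_mult; [|trivial|apply pow_lt, exp_pos].
      rewrite ln_pow by apply exp_pos. rewrite ln_exp. unfold u.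
      replace (- Q (Cexp v) / 2)%C with (RtoC (- / 2) * Q (Cexp v))%C.
      -- rewrite re_scal_l. simpl INR. field.
      -- rewrite RtoC_opp, RtoC_inv by lra. field.
    * eapply Rder_eq; [|apply Rder_minus; [apply (Rder_comp u Cexp); [|apply Cexp_der]|apply Rder_Re; now apply dQ]].
      2:{ apply (C1_Rder (chart L i)); trivial. }
      unfold f. ring.
Qed.

End Bundle.

(** * Rigidity of these frames, and their gluing over a half-plane *)

Lemma Rder_Cmod2 (F : C -> C) z l : Cder F z l ->
  Rder (fun w => Cmod (F w) ^ 2) z (2 * Cconj (F z) * l)%C.
Proof.
intros H.
assert (A : Rder (fun w => Re (F w)) z l) by now apply Rder_Re.
assert (B : Rder (fun w => Im (F w)) z (- Ci * l)%C).
{ apply Rder_ext_loc with (fun w => Re (- Ci * F w)%C).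
  - exists 1. split; [lra|]. intros w _. symmetry. apply Im_Re.
  - apply Rder_Re. now apply Cder_scal. }
apply (Rder_comp1 (fun x => x ^ 2) _ _ _ (2 * Re (F z))) in A; [|auto_derive; trivial; ring].
apply (Rder_comp1 (fun x => x ^ 2) _ _ _ (2 * Im (F z))) in B; [|auto_derive; trivial; ring].
assert (E := Rder_plus _ _ _ _ _ A B).
apply Rder_ext_loc with (fun w => Re (F w) ^ 2 + Im (F w) ^ 2).
- exists 1. split; [lra|]. intros w _. now rewrite Cmod2_alt.
- eapply Rder_eq; [|exact E]. destruct (F z) as [x y], l as [p q].
  unfold Cconj, Cplus, Cmult, Copp, Ci, RtoC. simpl. f_equal; ring.
Qed.

(** The differential of |F|^2 is represented by 2 conj(F) F', and by 0 as well once that of log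
    |F|^2 vanishes. *)
Lemma Cder_log_modulus_0 (F : C -> C) z l : F z <> 0 -> Cder F z l ->
  Rder (fun w => ln (Cmod (F w) ^ 2)) z 0 -> l = 0.
Proof.
intros N H K.
apply (Rder_comp1 exp _ _ _ (exp (ln (Cmod (F z) ^ 2)))) in K; [|apply is_derive_exp].
assert (E : (2 * Cconj (F z) * l)%C = (RtoC (exp (ln (Cmod (F z) ^ 2))) * 0)%C).
{ apply (Rder_unique (fun w => Cmod (F w) ^ 2) z); [now apply Rder_Cmod2|].
  destruct (Ccont_neq0 F z (Cder_cont _ _ _ H) N) as (d & Hd & A).
  eapply Rder_ext_loc; [|exact K]. exists d. split; trivial. intros w Hw.
  apply exp_ln. apply pow_lt. apply Cmod_gt_0. auto. }
rewrite Cmult_0_r in E.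
assert (Nc : Cconj (F z) <> 0).
{ apply Cmod_gt_0. rewrite Cmod_conj. now apply Cmod_gt_0. }
transitivity (/ (2 * Cconj (F z)) * (2 * Cconj (F z) * l))%C; [field; auto|].
rewrite E. ring.
Qed.

Definition convex (W : C -> Prop) : Prop :=
  forall z w t, W z -> W w -> 0 <= t <= 1 -> W (z + RtoC t * (w - z))%C.

Lemma orect_convex a b c d : convex (in_orect a b c d).
Proof.
intros z w t [Z1 Z2] [W1 W2] Ht.
replace (z + RtoC t * (w - z))%C with
  ((Re z + t * (Re w - Re z), Im z + t * (Im w - Im z)) : C).
- assert (T : forall x y, Rmin x y <= x + t * (y - x) <= Rmax x y).
  { intros x y. unfold Rmin, Rmax. destruct (Rle_dec x y); split; nra. }
  assert (A := T (Re z) (Re w)). assert (B := T (Im z) (Im w)).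
  assert (a < Rmin (Re z) (Re w) /\ Rmax (Re z) (Re w) < b).
  { split; [apply Rmin_glb_lt|apply Rmax_lub_lt]; lra. }
  assert (c < Rmin (Im z) (Im w) /\ Rmax (Im z) (Im w) < d).
  { split; [apply Rmin_glb_lt|apply Rmax_lub_lt]; lra. }
  split; simpl; lra.
- destruct z, w. unfold Cplus, Cminus, Copp, Cmult, RtoC. simpl. f_equal; ring.
Qed.

Section Glue.
Variables (L : line_bundle) (h : hermitian_metric L) (D : C -> C).

Lemma chart_near i w : chart L i (Cexp w) ->
  exists e, 0 < e /\ forall v, Cmod (v - w)%C < e -> chart L i (Cexp v).
Proof.
intros Hi. destruct (proj1 (open_Copen _) (chart_open L i) _ Hi) as (d & Hd & K).
destruct (Cder_cont _ _ _ (Cexp_der w) d Hd) as (e & He & A). exists e. split; auto.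
Qed.

Lemma lifted_sub (W V : C -> Prop) S : (forall w, V w -> W w) ->
  lifted L h D W S -> lifted L h D V S.
Proof.
intros E [A1 A2 A3 A4 A5]. split; auto; try (intros; apply A3; auto); try (intros; apply A4; auto);
intros; eapply A2; auto.
Qed.

Lemma lifted_chart W S i w : lifted L h D W S -> W w -> chart L i (Cexp w) ->
  lnorm L h S w = ln (weight h i (Cexp w) * Cmod (S i w) ^ 2).
Proof.
intros H Hw Hi. apply lnorm_chart; trivial.
- now apply (lf_sub _ _ _ _ _ H).
- intros j k Hj Hk. now apply (lf_trans _ _ _ _ _ H).
Qed.

Lemma lifted_of_local (W : C -> Prop) (S : section L) :
  (forall w, W w -> exists T e, 0 < e /\ lifted L h D (fun v => Cmod (v - w)%C < e) T /\
     forall v i, Cmod (v - w)%C < e -> chart L i (Cexp v) -> S i v = T i v) ->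
  lifted L h D W S.
Proof.
intros H.
assert (self : forall w, Cmod (w - w)%C = 0).
{ intros w. unfold Cminus. now rewrite Cplus_opp_r, Cmod_0. }
split.
- intros w Hw. destruct (H w Hw) as (T & e & He & HT & E).
  apply (lf_sub _ _ _ _ _ HT). now rewrite self.
- intros i w Hw Hi. destruct (H w Hw) as (T & e & He & HT & E).
  destruct (lf_holo _ _ _ _ _ HT i w) as [l Hl]; [now rewrite self|trivial|].
  exists l. apply Cder_ext_loc with (T i); trivial.
  destruct (chart_near i w Hi) as (d & Hd & K).
  exists (Rmin e d). split; [now apply Rmin_glb_lt|]. intros v Hv. symmetry. apply E.
  + eapply Rlt_le_trans; [exact Hv|apply Rmin_l].
  + apply K. eapply Rlt_le_trans; [exact Hv|apply Rmin_r].
- intros i j w Hw Hi Hj. destruct (H w Hw) as (T & e & He & HT & E).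
  rewrite !E; trivial; try (now rewrite self).
  apply (lf_trans _ _ _ _ _ HT); trivial. now rewrite self.
- intros i w Hw Hi. destruct (H w Hw) as (T & e & He & HT & E).
  rewrite E; trivial; try (now rewrite self).
  apply (lf_neq0 _ _ _ _ _ HT); trivial. now rewrite self.
- intros w Hw. destruct (H w Hw) as (T & e & He & HT & E).
  apply Rder_ext_loc with (lnorm L h T).
  + exists e. split; trivial. intros v Hv. unfold lnorm. rewrite E; trivial.
    apply chart_cover. now apply (lf_sub _ _ _ _ _ HT).
  + apply (lf_norm _ _ _ _ _ HT). now rewrite self.
Qed.

Lemma lifted_pos W S i w : lifted L h D W S -> W w -> chart L i (Cexp w) ->
  0 < weight h i (Cexp w) * Cmod (S i w) ^ 2.
Proof.
intros H Hw Hi. apply Rmult_lt_0_compat; [now apply weight_pos|].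
apply pow_lt, Cmod_gt_0. now apply (lf_neq0 _ _ _ _ _ H).
Qed.

Lemma lifted_scal W S (k : C) : Copen W -> k <> 0 -> lifted L h D W S ->
  lifted L h D W (fun i w => k * S i w)%C.
Proof.
intros HW N H. split.
- apply (lf_sub _ _ _ _ _ H).
- intros i w Hw Hi. destruct (lf_holo _ _ _ _ _ H i w Hw Hi) as [l Hl].
  exists (k * l)%C. now apply Cder_scal.
- intros i j w Hw Hi Hj. rewrite (lf_trans _ _ _ _ _ H i j w Hw Hi Hj). ring.
- intros i w Hw Hi. apply Cmult_neq_0; trivial. now apply (lf_neq0 _ _ _ _ _ H).
- intros w Hw. destruct (HW w Hw) as (e & He & K).
  apply Rder_ext_loc with (fun v => lnorm L h S v - (- ln (Cmod k ^ 2))).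
  + exists e. split; trivial. intros v Hv. apply K in Hv. unfold lnorm.
    set (i := chart_at L (Cexp v)).
    assert (Hi : chart L i (Cexp v)) by (apply chart_cover; now apply (lf_sub _ _ _ _ _ H)).
    rewrite Cmod_mult, Rpow_mult_distr.
    replace (weight h i (Cexp v) * (Cmod k ^ 2 * Cmod (S i v) ^ 2)) with
      (weight h i (Cexp v) * Cmod (S i v) ^ 2 * Cmod k ^ 2) by ring.
    set (q := weight h i (Cexp v) * Cmod (S i v) ^ 2).
    rewrite (ln_mult q); [ring|now apply (lifted_pos W)|]. apply pow_lt. now apply Cmod_gt_0.
  + eapply Rder_eq; [|apply Rder_minus; [apply (lf_norm _ _ _ _ _ H w Hw)|
      apply (Rder_Re (fun _ => RtoC (- ln (Cmod k ^ 2)))), Cder_const]]. ring.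
Qed.

(** The ratio T / S does not depend on the chart. Its modulus squared has logarithmic differential
    Re (D dz) - Re (D dz) = 0, so its derivative vanishes, and the mean value inequality along
    segments of W makes it constant. *)
Lemma lifted_unique W S T : Copen W -> convex W -> lifted L h D W S -> lifted L h D W T ->
  exists k : C, k <> 0 /\ forall i w, W w -> chart L i (Cexp w) -> T i w = (k * S i w)%C.
Proof.
intros HW HC HS HT.
destruct (excluded_middle_informative (exists w, W w)) as [[w0 H0]|N].
2:{ exists (RtoC 1). split; [apply C1_nz|]. intros i w Hw. exfalso; eauto. }
set (F := fun w => (T (chart_at L (Cexp w)) w / S (chart_at L (Cexp w)) w)%C).
assert (cov : forall w, W w -> chart L (chart_at L (Cexp w)) (Cexp w)).
{ intros w Hw. apply chart_cover. now apply (lf_sub _ _ _ _ _ HS). }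
assert (FE : forall i w, W w -> chart L i (Cexp w) -> F w = (T i w / S i w)%C).
{ intros i w Hw Hi. unfold F. set (j := chart_at L (Cexp w)). assert (Hj := cov w Hw). fold j in Hj.
  rewrite (lf_trans _ _ _ _ _ HS i j w), (lf_trans _ _ _ _ _ HT i j w) by trivial.
  assert (N1 := trans_neq0 L i j _ Hi Hj). assert (N2 := lf_neq0 _ _ _ _ _ HS j w Hw Hj).
  field. auto. }
assert (F0 : forall w, W w -> F w <> 0).
{ intros w Hw. unfold F. apply Cmult_neq_0.
  - apply (lf_neq0 _ _ _ _ _ HT); auto.
  - assert (N1 := lf_neq0 _ _ _ _ _ HS _ w Hw (cov w Hw)).
    intros E. apply C1_nz. rewrite <- (Cinv_r _ N1), E. ring. }
assert (dF : forall w, W w -> Cder F w 0).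
{ intros w Hw. set (i := chart_at L (Cexp w)). assert (Hi := cov w Hw). fold i in Hi.
  destruct (chart_near i w Hi) as (d & Hd & K). destruct (HW w Hw) as (e & He & Ke).
  destruct (lf_holo _ _ _ _ _ HS i w Hw Hi) as [l Hl].
  destruct (lf_holo _ _ _ _ _ HT i w Hw Hi) as [m Hm].
  assert (N1 := lf_neq0 _ _ _ _ _ HS i w Hw Hi).
  assert (X : exists q, Cder F w q).
  { eexists. apply Cder_ext_loc with (fun v => T i v / S i v)%C; [|apply Cder_div; eassumption].
    exists (Rmin e d). split; [now apply Rmin_glb_lt|]. intros v Hv. symmetry. apply FE.
    - apply Ke. eapply Rlt_le_trans; [exact Hv|apply Rmin_l].
    - apply K. eapply Rlt_le_trans; [exact Hv|apply Rmin_r]. }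
  destruct X as [q Hq]. rewrite <- (Cder_log_modulus_0 F w q (F0 w Hw) Hq); trivial.
  eapply Rder_ext_loc; [|eapply Rder_eq; [|apply Rder_minus;
    [apply (lf_norm _ _ _ _ _ HT w Hw)|apply (lf_norm _ _ _ _ _ HS w Hw)]]]; [|ring].
  exists e. split; trivial. intros v Hv. apply Ke in Hv. cbv beta.
  set (j := chart_at L (Cexp v)). assert (Hj := cov v Hv). fold j in Hj.
  rewrite (lifted_chart W T j v), (lifted_chart W S j v), (FE j v) by trivial.
  assert (N2 := lf_neq0 _ _ _ _ _ HS j v Hv Hj). assert (N3 := lf_neq0 _ _ _ _ _ HT j v Hv Hj).
  apply Cmod_gt_0 in N3. assert (P2 := proj1 (Cmod_gt_0 _) N2).
  assert (Wp := weight_pos L h j _ Hj).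
  rewrite Cmod_div by trivial. unfold Rdiv. rewrite Rpow_mult_distr, pow_inv.
  rewrite !ln_mult, ln_Rinv; try (apply pow_lt; trivial); trivial.
  { ring. } apply Rinv_0_lt_compat. now apply pow_lt. }
exists (F w0). split; [now apply F0|]. intros i w Hw Hi.
assert (E : F w = F w0).
{ apply Ceq_minus. apply Cmod_eq_0. apply Rle_antisym; [|apply Cmod_ge_0].
  rewrite <- (Rmult_0_l (Cmod (w - w0)%C)). apply (Cder_MVT F (fun _ => 0)).
  intros t Ht p. split; [apply dF, HC; trivial|]. rewrite Cmod_0. lra. }
rewrite <- E, (FE i w) by trivial. assert (N1 := lf_neq0 _ _ _ _ _ HS i w Hw Hi). field. trivial.
Qed.

(** Convexity of the overlap makes the ratio of the two frames one single constant there; rescaling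
    S1 by it makes the frames agree. *)
Lemma lifted_glue (W1 W2 : C -> Prop) S1 S2 : Copen W1 -> Copen W2 ->
  convex (fun w => W1 w /\ W2 w) ->
  lifted L h D W1 S1 -> lifted L h D W2 S2 -> exists S, lifted L h D (fun w => W1 w \/ W2 w) S.
Proof.
intros O1 O2 HC H1 H2.
assert (O : Copen (fun w => W1 w /\ W2 w)).
{ intros w [A B]. destruct (O1 w A) as (e1 & He1 & K1). destruct (O2 w B) as (e2 & He2 & K2).
  exists (Rmin e1 e2). split; [now apply Rmin_glb_lt|]. intros v Hv. split.
  - apply K1. eapply Rlt_le_trans; [exact Hv|apply Rmin_l].
  - apply K2. eapply Rlt_le_trans; [exact Hv|apply Rmin_r]. }
destruct (lifted_unique _ S1 S2 O HC) as (k & Nk & E).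
{ apply (lifted_sub W1); [now intros w []|trivial]. }
{ apply (lifted_sub W2); [now intros w []|trivial]. }
exists (fun i w => if excluded_middle_informative (W2 w) then S2 i w else (k * S1 i w)%C).
apply lifted_of_local. intros w Hw.
destruct (excluded_middle_informative (W2 w)) as [B|B].
- destruct (O2 w B) as (e & He & K). exists S2, e. split; trivial. split.
  + now apply (lifted_sub W2).
  + intros v i Hv Hi. destruct (excluded_middle_informative (W2 v)) as [|N]; trivial.
    elim N. auto.
- assert (A : W1 w) by tauto. destruct (O1 w A) as (e & He & K).
  exists (fun i w => k * S1 i w)%C, e. split; trivial. split.
  + apply (lifted_sub W1); trivial. now apply lifted_scal.
  + intros v i Hv Hi. destruct (excluded_middle_informative (W2 v)) as [Q|N]; trivial.
    apply E; auto.
Qed.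

Lemma orect_Copen a b c d : Copen (in_orect a b c d).
Proof. intros z. apply orect_open. Qed.

(** The margin e around the closed rectangle lets two adjacent rectangles overlap in an open convex
    set, as gluing requires. *)
Definition liftable (a b c d : R) : Prop :=
  exists e S, 0 < e /\ lifted L h D (in_orect (a - e) (b + e) (c - e) (d + e)) S.

Lemma liftable_h a m b c d : a <= m <= b -> liftable a m c d -> liftable m b c d -> liftable a b c d.
Proof.
intros Hm (e1 & S1 & He1 & H1) (e2 & S2 & He2 & H2).
set (e := Rmin e1 e2). assert (E1 : e <= e1) by apply Rmin_l. assert (E2 : e <= e2) by apply Rmin_r.
assert (He : 0 < e) by now apply Rmin_glb_lt.
apply (lifted_sub _ (in_orect (a - e) (m + e) (c - e) (d + e))) in H1; [|intros w [? ?]; split; lra].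
apply (lifted_sub _ (in_orect (m - e) (b + e) (c - e) (d + e))) in H2; [|intros w [? ?]; split; lra].
edestruct (fun Q => lifted_glue _ _ S1 S2 (orect_Copen _ _ _ _) (orect_Copen _ _ _ _) Q H1 H2) as [S HS].
{ intros z w t [A1 A2] [B1 B2] Ht. split; now apply orect_convex. }
exists e, S. split; trivial. apply (lifted_sub _ _ _) with (2 := HS).
intros w [? ?]. destruct (Rlt_dec (Re w) (m + e)); [left|right]; split; lra.
Qed.

Lemma liftable_v a b c m d : c <= m <= d -> liftable a b c m -> liftable a b m d -> liftable a b c d.
Proof.
intros Hm (e1 & S1 & He1 & H1) (e2 & S2 & He2 & H2).
set (e := Rmin e1 e2). assert (E1 : e <= e1) by apply Rmin_l. assert (E2 : e <= e2) by apply Rmin_r.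
assert (He : 0 < e) by now apply Rmin_glb_lt.
apply (lifted_sub _ (in_orect (a - e) (b + e) (c - e) (m + e))) in H1; [|intros w [? ?]; split; lra].
apply (lifted_sub _ (in_orect (a - e) (b + e) (m - e) (d + e))) in H2; [|intros w [? ?]; split; lra].
edestruct (fun Q => lifted_glue _ _ S1 S2 (orect_Copen _ _ _ _) (orect_Copen _ _ _ _) Q H1 H2) as [S HS].
{ intros z w t [A1 A2] [B1 B2] Ht. split; now apply orect_convex. }
exists e, S. split; trivial. apply (lifted_sub _ _ _) with (2 := HS).
intros w [? ?]. destruct (Rlt_dec (Im w) (m + e)); [left|right]; split; lra.
Qed.

Variable x0 : R.
Hypothesis local_lift : forall w, Re w < x0 ->
  exists e S, 0 < e /\ lifted L h D (fun v => Cmod (v - w)%C < e) S.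

Lemma lift_rect a b c d : a <= b -> c <= d -> b < x0 -> liftable a b c d.
Proof.
intros Hab Hcd Hb. apply (quartering liftable); trivial.
- intros a' b' c' d' H1 H2 H3 H4 m n P1 P2 P3 P4.
  apply (liftable_v a' b' c' n d'); [unfold n; lra| |].
  + apply (liftable_h a' m b'); trivial. unfold m; lra.
  + apply (liftable_h a' m b'); trivial. unfold m; lra.
- intros x y Hx Hy. destruct (local_lift (x, y)) as (e & S & He & HS); [simpl; lra|].
  exists (e / 4). split; [lra|]. intros a' b' c' d' H1 H2 H3 H4 H5 H6.
  exists (e / 8), S. split; [lra|]. apply (lifted_sub _ _ _) with (2 := HS).
  intros w [W1 W2]. eapply Rle_lt_trans; [apply Cmod_Rabs_le|].
  change (Rabs (Re w - x) + Rabs (Im w - y) < e).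
  assert (Rabs (Re w - x) <= 3 * e / 8) by (apply Rabs_le; lra).
  assert (Rabs (Im w - y) <= 3 * e / 8) by (apply Rabs_le; lra). lra.
Qed.

Definition half_plane (w : C) : Prop := Re w < x0.

Definition box (n : nat) : C -> Prop :=
  in_orect (x0 - 3 - INR n) (x0 - / (INR n + 2)) (- INR n - 1) (INR n + 1).

Lemma box_mono n m w : (n <= m)%nat -> box n w -> box m w.
Proof.
intros H [[A1 A2] [B1 B2]]. apply le_INR in H. assert (P := pos_INR n).
assert (/ (INR m + 2) <= / (INR n + 2)) by (apply Rinv_le_contravar; lra).
split; lra.
Qed.

Lemma box_exhaust w : half_plane w -> exists n, box n w.
Proof.
intros H. unfold half_plane in H.
destruct (INR_unbounded (Rabs (x0 - Re w) + Rabs (Im w) + / (x0 - Re w))) as [n Hn].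
assert (P := Rinv_0_lt_compat (x0 - Re w) ltac:(lra)).
assert (A := Rle_abs (x0 - Re w)). assert (B := Rle_abs (Im w)). assert (B' := Rle_abs (- Im w)).
rewrite Rabs_Ropp in B'. assert (C1 := Rabs_pos (Im w)). assert (C2 := Rabs_pos (x0 - Re w)).
exists n. assert (Q : / (INR n + 2) < x0 - Re w).
{ rewrite <- (Rinv_inv (x0 - Re w)). apply Rinv_lt_contravar; [|lra].
  apply Rmult_lt_0_compat; lra. }
split; lra.
Qed.

(** The boxes exhaust the half-plane. The frame on each is normalised to agree with a fixed S0 on
    the smallest box; two such frames differ by a constant, and comparison at one point p of the
    smallest box shows that it is 1. The frames are therefore coherent and define one on the
    union. *)
Lemma lift_half_plane : exists S, lifted L h D half_plane S.
Proof.
set (p := (x0 - 1, 0) : C).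
assert (Hp : box 0 p). { split; simpl; lra. }
assert (ex : forall n, exists S, lifted L h D (box n) S).
{ intros n. assert (P := pos_INR n).
  assert (Q : 0 < / (INR n + 2)) by (apply Rinv_0_lt_compat; lra).
  assert (Q2 : / (INR n + 2) <= 1) by (rewrite <- Rinv_1; apply Rinv_le_contravar; lra).
  destruct (lift_rect (x0 - 3 - INR n) (x0 - / (INR n + 2)) (- INR n - 1) (INR n + 1))
    as (e & S & He & HS); try lra.
  exists S. apply (lifted_sub _ _ _) with (2 := HS). intros w [? ?]. split; lra. }
destruct (ex 0%nat) as [S0 HS0].
assert (ex2 : forall n, exists S, lifted L h D (box n) S /\
  forall i w, box 0 w -> chart L i (Cexp w) -> S i w = S0 i w).
{ intros n. destruct (ex n) as [S HS].
  assert (HS' : lifted L h D (box 0) S).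
  { apply (lifted_sub (box n)); trivial. intros w. apply box_mono. lia. }
  destruct (lifted_unique _ S S0 (orect_Copen _ _ _ _) (orect_convex _ _ _ _) HS' HS0) as (k & Nk & E).
  exists (fun i w => k * S i w)%C. split.
  - apply lifted_scal; trivial. apply orect_Copen.
  - intros i w Hw Hi. symmetry. now apply E. }
set (T := fun n => epsilon (inhabits S0) (fun S => lifted L h D (box n) S /\
  forall i w, box 0 w -> chart L i (Cexp w) -> S i w = S0 i w)).
assert (HT : forall n, lifted L h D (box n) (T n) /\
  forall i w, box 0 w -> chart L i (Cexp w) -> T n i w = S0 i w).
{ intros n. exact (epsilon_spec (inhabits S0) _ (ex2 n)). }
assert (coh : forall n m i w, (n <= m)%nat -> box n w -> chart L i (Cexp w) -> T m i w = T n i w).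
{ intros n m i w Hnm Hw Hi. destruct (HT n) as [H1 H2]. destruct (HT m) as [H3 H4].
  assert (H3' : lifted L h D (box n) (T m)).
  { apply (lifted_sub (box m)); trivial. intros v. now apply box_mono. }
  destruct (lifted_unique _ (T n) (T m) (orect_Copen _ _ _ _) (orect_convex _ _ _ _) H1 H3') as (k & Nk & E).
  assert (Cp : chart L (chart_at L (Cexp p)) (Cexp p)).
  { apply chart_cover. now apply (lf_sub _ _ _ _ _ HS0). }
  set (j := chart_at L (Cexp p)) in *.
  assert (Ep := E j p (box_mono 0 n p (Nat.le_0_l n) Hp) Cp).
  rewrite H2, H4 in Ep by trivial.
  assert (N0 := lf_neq0 _ _ _ _ _ HS0 j p Hp Cp).
  assert (k1 : k = 1).
  { transitivity (k * S0 j p / S0 j p)%C; [field; trivial|]. rewrite <- Ep. field. trivial. }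
  rewrite E by trivial. rewrite k1. ring. }
set (N := fun w => epsilon (inhabits 0%nat) (fun n => box n w)).
exists (fun i w => T (N w) i w). apply lifted_of_local. intros w Hw.
destruct (box_exhaust w Hw) as [n Hn].
destruct (orect_Copen _ _ _ _ w Hn) as (e & He & K).
exists (T n), e. split; trivial. split.
- apply (lifted_sub (box n)); [exact K|apply HT].
- intros v i Hv Hi. apply K in Hv. change (box n v) in Hv.
  assert (Nv : box (N v) v) by (apply (epsilon_spec (inhabits 0%nat)); now exists n).
  destruct (Nat.le_ge_cases n (N v)) as [Q|Q]; [now apply coh|symmetry; now apply coh].
Qed.

End Glue.

(** * Monodromy and the adapted frame *)

Lemma shift_invariant {A : Type} (Q : C -> Prop) (F : C -> A) (tau : C) :
  (forall w, Q w <-> Q (w + tau)%C) -> (forall w, Q w -> F (w + tau)%C = F w) ->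
  forall (n : Z) w, Q w -> F (w + RtoC (IZR n) * tau)%C = F w.
Proof.
intros HQ HF.
assert (nat_case : forall (n : nat) w, (Q w <-> Q (w + RtoC (INR n) * tau)%C) /\
   (Q w -> F (w + RtoC (INR n) * tau)%C = F w)).
{ induction n as [|n IH]; intros w.
  - simpl INR. replace (w + RtoC 0 * tau)%C with w by ring. tauto.
  - replace (w + RtoC (INR (S n)) * tau)%C with (w + RtoC (INR n) * tau + tau)%C
      by (rewrite S_INR, RtoC_plus; ring).
    destruct (IH w) as [I1 I2]. split.
    + rewrite I1. apply HQ.
    + intros Hw. rewrite HF by now apply I1. auto. }
intros n w Hw. destruct (Z_le_dec 0 n) as [P|P].
- rewrite <- (Z2Nat.id n) by trivial. rewrite <- INR_IZR_INZ. now apply nat_case.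
- set (k := Z.to_nat (- n)).
  assert (E : IZR n = - INR k).
  { unfold k. rewrite INR_IZR_INZ, Z2Nat.id by lia. rewrite <- opp_IZR. f_equal. lia. }
  set (w' := (w + RtoC (IZR n) * tau)%C).
  assert (Ew : w = (w' + RtoC (INR k) * tau)%C) by (unfold w'; rewrite E, RtoC_opp; ring).
  destruct (nat_case k w') as [I1 I2]. rewrite <- Ew in I1, I2. symmetry. apply I2. now apply I1.
Qed.

Lemma Cexp_shift (n : Z) w : Cexp (w + RtoC (IZR n) * two_pi_i)%C = Cexp w.
Proof. apply (shift_invariant (fun _ => True)); trivial; [tauto|]. intros. apply Cexp_period. Qed.

Lemma Cexp_eq1 (d : C) : Cexp d = 1 -> exists n : Z, d = (RtoC (IZR n) * two_pi_i)%C.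
Proof.
intros H. assert (HPI := PI_RGT_0).
set (n := Int_part (Im d / (2 * PI))). exists n.
destruct (base_Int_part (Im d / (2 * PI))) as [B1 B2]. fold n in B1, B2.
set (d' := (d + RtoC (IZR (- n)) * two_pi_i)%C).
assert (H' : Cexp d' = 1) by (unfold d'; now rewrite Cexp_shift).
assert (Ed' : d' = (Re d, Im d - IZR n * (2 * PI))).
{ unfold d', two_pi_i. rewrite opp_IZR. destruct d. unfold Cplus, Cmult, RtoC. simpl. f_equal; ring. }
set (y := Im d - IZR n * (2 * PI)) in *.
assert (Hy : 0 <= y < 2 * PI).
{ unfold y. assert (E : Im d = Im d / (2 * PI) * (2 * PI)) by (field; lra). split; nra. }
assert (M : Re d = 0).
{ assert (X := f_equal Cmod H). rewrite Cmod_Cexp, Cmod_1 in X. rewrite <- exp_0 in X.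
  now apply exp_inv in X. }
rewrite Ed', M in H'. unfold Cexp, RtoC in H'. simpl in H'. rewrite exp_0, !Rmult_1_l in H'.
injection H' as Hc Hs.
assert (Y0 : y = 0).
{ destruct (Req_dec y 0) as [|Ny]; trivial. exfalso.
  assert (P : 0 < sin (y / 2)) by (apply sin_gt_0; lra).
  replace y with (2 * (y / 2)) in Hc by field. rewrite cos_2a_sin in Hc. nra. }
assert (Im d = IZR n * (2 * PI)) by (unfold y in Y0; lra).
unfold two_pi_i. destruct d as [p q]. unfold Re, Im in *. simpl in *.
unfold Cmult, RtoC. simpl. f_equal; [lra|rewrite H0; ring].
Qed.

Lemma Cexp_opp w : Cexp (- w)%C = (/ Cexp w)%C.
Proof.
assert (N := Cexp_neq0 w).
assert (E : (Cexp (- w) * Cexp w)%C = 1).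
{ rewrite <- Cexp_plus. replace (- w + w)%C with (RtoC 0) by ring.
  unfold Cexp, RtoC. simpl. rewrite exp_0, cos_0, sin_0. f_equal; ring. }
transitivity (Cexp (- w) * Cexp w * / Cexp w)%C; [field; trivial|]. rewrite E. ring.
Qed.

Lemma Cexp_fiber (w w' : C) : Cexp w = Cexp w' -> exists n : Z, w = (w' + RtoC (IZR n) * two_pi_i)%C.
Proof.
intros E. destruct (Cexp_eq1 (w - w')%C) as [n Hn].
- unfold Cminus. rewrite Cexp_plus, Cexp_opp, E. field. apply Cexp_neq0.
- exists n. rewrite <- Hn. ring.
Qed.

(** The branch is the primitive of 1 / z with value w0 at exp w0; it inverts the exponential because
    z exp (- l z) has derivative 0 and the value 1 at exp w0. *)
Lemma local_log (w0 : C) : exists e l, 0 < e /\ l (Cexp w0) = w0 /\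
  forall z, Cmod (z - Cexp w0)%C < e -> Cder l z (/ z)%C /\ Cexp (l z) = z.
Proof.
set (z0 := Cexp w0). assert (N := Cexp_neq0 w0). fold z0 in N.
assert (P : 0 < Cmod z0) by now apply Cmod_gt_0.
set (e := Cmod z0 / 3).
destruct (primitive_holo (fun w => / w)%C (fun w => - / (w * w))%C
  (Re z0 - e) (Re z0 + e) (Im z0 - e) (Im z0 + e)) as [l Hl]; try (unfold e; lra).
{ intros z [H1 H2]. apply Cder_inv_id. intros ->.
  change (Re z0 - e <= 0 <= Re z0 + e) in H1. change (Im z0 - e <= 0 <= Im z0 + e) in H2.
  assert (A := Cmod_Rabs_le z0).
  assert (Rabs (Re z0) <= e) by (apply Rabs_le; lra).
  assert (Rabs (Im z0) <= e) by (apply Rabs_le; lra). unfold e in *. lra. }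
assert (inr : forall z, Cmod (z - z0)%C < e -> in_orect (Re z0 - e) (Re z0 + e) (Im z0 - e) (Im z0 + e) z).
{ intros z Hz. assert (A := re_le_Cmod (z - z0)%C). assert (B := Im_le_Cmod (z - z0)%C).
  change (Rabs (Re z - Re z0) <= Cmod (z - z0)%C) in A.
  change (Rabs (Im z - Im z0) <= Cmod (z - z0)%C) in B.
  assert (A' : - e < Re z - Re z0 < e) by (apply Rabs_lt_between; lra).
  assert (B' : - e < Im z - Im z0 < e) by (apply Rabs_lt_between; lra). split; lra. }
set (m := fun z => (l z + (w0 - l z0))%C).
assert (dm : forall z, Cmod (z - z0)%C < e -> Cder m z (/ z)%C).
{ intros z Hz. eapply Cder_eq; [|apply Cder_plus; [apply Hl, inr, Hz|apply Cder_const]]. ring. }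
assert (m0 : m z0 = w0) by (unfold m; ring).
exists e, m. split; [unfold e; lra|]. split; trivial.
intros z Hz. split; [auto|].
set (F := fun z => (z * Cexp (- m z))%C).
assert (dF : forall z, Cmod (z - z0)%C < e -> Cder F z 0).
{ intros v Hv. assert (Nv : v <> 0).
  { intros ->. rewrite Cmod_sub_sym in Hv. replace (z0 - 0)%C with z0 in Hv by ring. unfold e in Hv. lra. }
  eapply Cder_eq; [|apply (Cder_mult (fun z => z)); [apply Cder_id|apply (Cder_comp Cexp (fun z => - m z)%C);
    [apply Cexp_der|apply (Cder_ext (fun z => RtoC (-1) * m z)%C); [intros; ring|apply Cder_scal, dm, Hv]]]].
  cbv beta. field. trivial. }
assert (Ez : F z = F z0).
{ apply Ceq_minus. apply Cmod_eq_0. apply Rle_antisym; [|apply Cmod_ge_0].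
  rewrite <- (Rmult_0_l (Cmod (z - z0)%C)). apply (Cder_MVT F (fun _ => 0)).
  intros t Ht p. split; [apply dF|rewrite Cmod_0; lra].
  unfold p. replace (z0 + RtoC t * (z - z0) - z0)%C with (RtoC t * (z - z0))%C by ring.
  rewrite Cmod_mult, Cmod_R, Rabs_pos_eq by lra. generalize (Cmod_ge_0 (z - z0)%C). nra. }
assert (E0 : F z0 = 1).
{ unfold F. rewrite m0, Cexp_opp. fold z0. field. trivial. }
rewrite E0 in Ez. unfold F in Ez. rewrite Cexp_opp in Ez.
transitivity (Cexp (m z) * (z * / Cexp (m z)))%C; [rewrite Ez; ring|]. field. apply Cexp_neq0.
Qed.

(** The logarithm is placed in one period strip, because the norm of the lifted frame is estimated
    there only. *)
Lemma Cexp_log (z : C) : z <> 0 -> exists w, Cexp w = z /\ 0 <= Im w <= 2 * PI.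
Proof.
intros N. destruct (Cexp_onto z N) as [w Hw]. assert (HPI := PI_RGT_0).
set (n := Int_part (Im w / (2 * PI))).
destruct (base_Int_part (Im w / (2 * PI))) as [B1 B2]. fold n in B1, B2.
exists (w + RtoC (IZR (- n)) * two_pi_i)%C. split; [now rewrite Cexp_shift|].
replace (Im (w + RtoC (IZR (- n)) * two_pi_i)%C) with (Im w - IZR n * (2 * PI)).
- assert (E : Im w = Im w / (2 * PI) * (2 * PI)) by (field; lra). split; nra.
- unfold two_pi_i. rewrite opp_IZR. destruct w. unfold Cplus, Cmult, RtoC. simpl. ring.
Qed.

(** A holomorphic frame near the puncture with [log h(v, v) ~ - 2 gam log |z|]. *)
Definition adapted {L : line_bundle} (h : hermitian_metric L) (gam r : R) (v : section L) : Prop :=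
  0 < r < 1 /\
  is_section L (fun z => Cmod z < r /\ z <> RtoC 0) v /\
  (forall i z, Cmod z < r -> z <> RtoC 0 -> chart L i z -> v i z <> RtoC 0) /\
  (forall eta, 0 < eta -> exists d, 0 < d /\ forall z : C, Cmod z < d -> z <> RtoC 0 ->
     Rabs (ln (hsq h v z) + 2 * gam * ln (Cmod z)) <= eta * - ln (Cmod z)).

Section Frame.
Variables (L : line_bundle) (h : hermitian_metric L) (D : C -> C) (x0 : R) (S : section L).
Hypothesis HS : lifted L h D (half_plane x0) S.
Hypothesis Dsmall : forall eta, 0 < eta -> exists x1, forall w, Re w <= x1 ->
  Cmod (D (Cexp w) * Cexp w)%C <= eta.

Lemma half_plane_shift w : half_plane x0 w <-> half_plane x0 (w + two_pi_i)%C.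
Proof.
unfold half_plane. replace (Re (w + two_pi_i)%C) with (Re w); [tauto|].
destruct w. unfold two_pi_i. simpl. ring.
Qed.

Lemma half_plane_Copen : Copen (half_plane x0).
Proof.
intros w Hw. exists (x0 - Re w). split; [unfold half_plane in Hw; lra|]. intros v Hv.
assert (A := re_le_Cmod (v - w)%C). change (Rabs (Re v - Re w) <= Cmod (v - w)%C) in A.
generalize (Rle_abs (Re v - Re w)). unfold half_plane. lra.
Qed.

Lemma half_plane_convex : convex (half_plane x0).
Proof.
intros z w t Hz Hw Ht. unfold half_plane in *.
replace (Re (z + RtoC t * (w - z))%C) with (Re z + t * (Re w - Re z)).
- destruct (Rle_dec (Re z) (Re w)); nra.
- destruct z, w. simpl. ring.
Qed.

(** The mean value inequality from a base point q, along a segment on which the coefficient of the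
    differential is at most eta / 3. The other two thirds of eta absorb the value at q and the width
    2 pi of the strip, once Re w is negative enough. *)
Lemma lnorm_small eta : 0 < eta -> exists x2, x2 < 0 /\ forall w, Re w <= x2 ->
  0 <= Im w <= 2 * PI -> Rabs (lnorm L h S w) <= eta * - Re w.
Proof.
intros He. assert (HPI := PI_RGT_0). destruct (Dsmall (eta / 3)) as [x1 H1]; [lra|].
set (y := Rmin (Rmin x1 (x0 - 1)) (-1)).
assert (Y : y <= x1 /\ y <= x0 - 1 /\ y <= -1).
{ unfold y. generalize (Rmin_l (Rmin x1 (x0 - 1)) (-1)) (Rmin_r (Rmin x1 (x0 - 1)) (-1))
  (Rmin_l x1 (x0 - 1)) (Rmin_r x1 (x0 - 1)). lra. }
set (q := (y, 0) : C). set (B := Rabs (lnorm L h S q)).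
assert (HB : 0 <= B) by apply Rabs_pos.
assert (HB' : 0 <= B / (eta / 3)) by (apply Rdiv_le_0_compat; lra).
set (x2 := y - 2 * PI - B / (eta / 3)).
exists x2. split; [unfold x2; lra|]. intros w Hw Hi.
assert (V : Rabs (lnorm L h S w - lnorm L h S q) <= eta / 3 * Cmod (w - q)%C).
{ apply (Rder_MVT _ (fun p => D (Cexp p) * Cexp p)%C). intros t Ht p.
  assert (Rp : Re p <= y).
  { unfold p. replace (Re (q + RtoC t * (w - q))%C) with (y + t * (Re w - y)).
    - assert (Re w <= y) by (unfold x2 in Hw; lra). nra.
    - unfold q. destruct w. simpl. ring. }
  split.
  - apply (lf_norm _ _ _ _ _ HS). unfold half_plane. lra.
  - apply H1. lra. }
assert (W : Cmod (w - q)%C <= - Re w + 2 * PI).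
{ eapply Rle_trans; [apply Cmod_Rabs_le|].
  change (Re (w - q)%C) with (Re w - y). change (Im (w - q)%C) with (Im w - 0).
  rewrite Rminus_0_r, (Rabs_pos_eq (Im w)) by lra.
  rewrite Rabs_left1 by (unfold x2 in Hw; lra). lra. }
replace (lnorm L h S w) with ((lnorm L h S w - lnorm L h S q) + lnorm L h S q) by ring.
eapply Rle_trans; [apply Rabs_triang|]. fold B.
assert (X1 : eta / 3 * Cmod (w - q)%C <= eta / 3 * (- Re w + 2 * PI)) by (apply Rmult_le_compat_l; lra).
assert (X2 : B <= eta / 3 * (- Re w)).
{ replace B with (eta / 3 * (B / (eta / 3))) by (field; lra). apply Rmult_le_compat_l; [lra|].
  unfold x2 in Hw. lra. }
assert (X3 : eta / 3 * (2 * PI) <= eta / 3 * (- Re w)).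
{ apply Rmult_le_compat_l; [lra|]. unfold x2 in Hw. lra. }
lra.
Qed.

(** The translate of S by the period is again a lifted frame with the same D, so [lifted_unique]
    applies on the half-plane. *)
Lemma monodromy : exists c : C, c <> 0 /\ forall i w, half_plane x0 w -> chart L i (Cexp w) ->
  S i (w + two_pi_i)%C = (c * S i w)%C.
Proof.
assert (HT : lifted L h D (half_plane x0) (fun i w => S i (w + two_pi_i)%C)).
{ split.
  - apply (lf_sub _ _ _ _ _ HS).
  - intros i w Hw Hi.
    destruct (lf_holo _ _ _ _ _ HS i (w + two_pi_i)%C) as [l Hl].
    { now apply (half_plane_shift w). } { now rewrite Cexp_period. }
    exists (l * (1 + 0))%C. apply (Cder_comp (S i) (fun w => w + two_pi_i)%C); trivial.
    apply Cder_plus; [apply Cder_id|apply Cder_const].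
  - intros i j w Hw Hi Hj. rewrite <- (Cexp_period w) in *.
    apply (lf_trans _ _ _ _ _ HS); trivial. now apply (half_plane_shift w).
  - intros i w Hw Hi. rewrite <- (Cexp_period w) in *.
    apply (lf_neq0 _ _ _ _ _ HS); trivial. now apply (half_plane_shift w).
  - intros w Hw. apply Rder_ext_loc with (fun w => lnorm L h S (w + two_pi_i)%C).
    + exists 1. split; [lra|]. intros v _. unfold lnorm. now rewrite Cexp_period.
    + eapply Rder_eq; [|apply (Rder_comp (lnorm L h S) (fun w => w + two_pi_i)%C);
        [apply (lf_norm _ _ _ _ _ HS); now apply (half_plane_shift w)|
         apply Cder_plus; [apply Cder_id|apply Cder_const]]].
      cbv beta. rewrite Cexp_period. ring. }
destruct (lifted_unique L h D _ S _ half_plane_Copen half_plane_convex HS HT) as (c & Nc & E).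
exists c. auto.
Qed.

Lemma adapted_frame a : exp x0 < 1 -> exists gam v, a - 1 < gam <= a /\ adapted h gam (exp x0) v.
Proof.
intros Hx. assert (HPI := PI_RGT_0). destruct monodromy as (c & Nc & Mc).
destruct (Cexp_onto c Nc) as [b Hb].
assert (Nt : two_pi_i <> 0).
{ unfold two_pi_i, RtoC. intros E. injection E as E. lra. }
(* The exponent beta is determined by c up to an integer; taking the integer part here puts its real
   part in the half-open interval (a - 1, a]. *)
set (n := Int_part (a - Re (b / two_pi_i)%C)).
destruct (base_Int_part (a - Re (b / two_pi_i)%C)) as [B1 B2]. fold n in B1, B2.
set (beta := (b / two_pi_i + RtoC (IZR n))%C).
assert (Eb : Cexp (beta * two_pi_i)%C = c).
{ replace (beta * two_pi_i)%C with (b + RtoC (IZR n) * two_pi_i)%C by (unfold beta; field; trivial).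
  now rewrite Cexp_shift. }
set (gam := Re beta).
assert (Hg : a - 1 < gam <= a).
{ unfold gam, beta. rewrite re_plus, re_RtoC. lra. }
(* Multiplication by exp (- beta w), the lift of z^(-beta), cancels the factor c of the period. *)
set (T := fun i w => (Cexp (- (beta * w)) * S i w)%C).
assert (per : forall i w, half_plane x0 w -> chart L i (Cexp w) -> T i (w + two_pi_i)%C = T i w).
{ intros i w Hw Hi. unfold T. rewrite (Mc i w Hw Hi).
  replace (- (beta * (w + two_pi_i)))%C with (- (beta * w) + - (beta * two_pi_i))%C by ring.
  rewrite Cexp_plus, (Cexp_opp (beta * two_pi_i)%C), Eb. field. trivial. }
assert (fib : forall i w w', half_plane x0 w' -> chart L i (Cexp w') -> Cexp w = Cexp w' -> T i w = T i w').
{ intros i w w' Hw Hi E. destruct (Cexp_fiber w w' E) as [k ->].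
  apply (shift_invariant (fun w => half_plane x0 w /\ chart L i (Cexp w))); auto.
  - intros v. rewrite Cexp_period, <- half_plane_shift. tauto.
  - intros v [Hv1 Hv2]. now apply per. }
(* This logarithm jumps across a cut, but T takes equal values over equal points, so near each point
   it can be replaced by a holomorphic branch. *)
set (lg := fun z => epsilon (inhabits (RtoC 0)) (fun w => Cexp w = z /\ 0 <= Im w <= 2 * PI)).
assert (Hlg : forall z : C, z <> 0 -> Cexp (lg z) = z /\ 0 <= Im (lg z) <= 2 * PI).
{ intros z N. exact (epsilon_spec (inhabits (RtoC 0)) _ (Cexp_log z N)). }
assert (Rlg : forall z : C, z <> 0 -> Re (lg z) = ln (Cmod z)).
{ intros z N. destruct (Hlg z N) as [E _]. rewrite <- E at 2. now rewrite Cmod_Cexp, ln_exp. }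
set (v := fun i z => T i (lg z)).
assert (hp : forall w, Cmod (Cexp w) < exp x0 -> half_plane x0 w).
{ intros w H. rewrite Cmod_Cexp in H. now apply exp_lt_inv. }
assert (vE : forall i w, chart L i (Cexp w) -> half_plane x0 w -> v i (Cexp w) = T i w).
{ intros i w Hi Hw. unfold v. apply fib; trivial. apply Hlg. apply Cexp_neq0. }
exists gam, v. split; trivial. split; [split; [apply exp_pos|trivial]|]. split; [split|split].
- intros i z [[Hz N] Hi]. apply ex_derive_Cder. destruct (Hlg z N) as [E _].
  set (w0 := lg z) in *. rewrite <- E in Hz, Hi.
  assert (Hw0 := hp w0 Hz).
  destruct (local_log w0) as (e & l & He & l0 & Hl). rewrite E in l0, Hl.
  destruct (lf_holo _ _ _ _ _ HS i w0 Hw0 Hi) as [s Hs].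
  destruct (Hl z) as [dl _]. { unfold Cminus. now rewrite Cplus_opp_r, Cmod_0. }
  assert (dT : exists q, Cder (T i) w0 q).
  { eexists. apply Cder_mult; [apply (Cder_comp Cexp (fun w => - (beta * w))%C); [apply Cexp_der|
      apply (Cder_ext (fun w => (- beta) * w)%C); [intros; ring|apply Cder_scal, Cder_id]]|exact Hs]. }
  destruct dT as [q Hq]. exists (q * / z)%C.
  apply Cder_ext_loc with (fun z => T i (l z)).
  + rewrite E in Hi. destruct (proj1 (open_Copen _) (chart_open L i) z Hi) as (d & Hd & K).
    rewrite E in Hz.
    exists (Rmin e (Rmin d (exp x0 - Cmod z))). split; [repeat apply Rmin_glb_lt; lra|].
    intros u Hu. assert (U1 := Rlt_le_trans _ _ _ Hu (Rmin_l _ _)).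
    assert (U2 := Rlt_le_trans _ _ _ Hu (Rmin_r _ _)).
    assert (U3 := Rlt_le_trans _ _ _ U2 (Rmin_l _ _)). assert (U4 := Rlt_le_trans _ _ _ U2 (Rmin_r _ _)).
    destruct (Hl u U1) as [_ Eu]. rewrite <- Eu at 2. symmetry. apply vE.
    * rewrite Eu. auto.
    * apply hp. rewrite Eu. generalize (Cmod_rev_tri u z). lra.
  + apply (Cder_comp (T i) l); trivial. now rewrite l0.
- intros i j z [Hz N] Hi Hj. destruct (Hlg z N) as [E _]. unfold v, T.
  rewrite (lf_trans _ _ _ _ _ HS i j (lg z)); rewrite ?E; trivial; [ring|].
  apply hp. now rewrite E.
- intros i z Hz N Hi. destruct (Hlg z N) as [E _]. unfold v, T.
  apply Cmult_neq_0; [apply Cexp_neq0|]. apply (lf_neq0 _ _ _ _ _ HS); rewrite ?E; trivial.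
  apply hp. now rewrite E.
- intros eta He. destruct (lnorm_small (eta / 2)) as (x2 & X2 & H2); [lra|].
  (* Re (beta w) = gam Re w - Im beta Im w, and the last term is bounded on the strip; it costs the
     constant B only. *)
  set (B := 2 * Rabs (Im beta) * (2 * PI)).
  assert (HB : 0 <= B) by (unfold B; assert (Q := Rabs_pos (Im beta)); nra).
  set (x3 := Rmin (Rmin x2 (x0 - 1)) (- (B / (eta / 2)))).
  assert (X3 : x3 <= x2 /\ x3 <= x0 - 1 /\ x3 <= - (B / (eta / 2))).
  { unfold x3. generalize (Rmin_l (Rmin x2 (x0 - 1)) (- (B / (eta / 2))))
     (Rmin_r (Rmin x2 (x0 - 1)) (- (B / (eta / 2)))) (Rmin_l x2 (x0 - 1)) (Rmin_r x2 (x0 - 1)). lra. }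
  exists (exp x3). split; [apply exp_pos|]. intros z Hz N.
  destruct (Hlg z N) as [E Hi]. assert (R := Rlg z N). set (w := lg z) in *.
  assert (Hw : Re w < x3).
  { rewrite R. rewrite <- (ln_exp x3). apply ln_increasing; trivial. now apply Cmod_gt_0. }
  assert (Hwh : half_plane x0 w) by (unfold half_plane; lra).
  assert (hq : ln (hsq h v z) = lnorm L h S w - 2 * Re (beta * w)%C).
  { unfold hsq, lnorm. rewrite <- E. set (i := chart_at L (Cexp w)).
    assert (Ci : chart L i (Cexp w)) by (apply chart_cover; now apply (lf_sub _ _ _ _ _ HS)).
    rewrite vE by trivial. unfold T. rewrite Cmod_mult, Cmod_Cexp, Rpow_mult_distr.
    assert (Q := lifted_pos L h D _ S i w HS Hwh Ci).
    replace (weight h i (Cexp w) * (exp (Re (- (beta * w))%C) ^ 2 * Cmod (S i w) ^ 2))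
      with (weight h i (Cexp w) * Cmod (S i w) ^ 2 * exp (Re (- (beta * w))%C) ^ 2) by ring.
    set (qq := weight h i (Cexp w) * Cmod (S i w) ^ 2) in *.
    rewrite ln_mult; [|exact Q|apply pow_lt, exp_pos].
    rewrite ln_pow by apply exp_pos. rewrite ln_exp, re_opp. simpl INR. ring. }
  rewrite hq, <- R, re_mult. fold gam.
  replace (lnorm L h S w - 2 * (gam * Re w - Im beta * Im w) + 2 * gam * Re w)
    with (lnorm L h S w + 2 * Im beta * Im w) by ring.
  eapply Rle_trans; [apply Rabs_triang|].
  assert (A1 := H2 w ltac:(lra) Hi).
  assert (A2 : Rabs (2 * Im beta * Im w) <= B).
  { rewrite !Rabs_mult, (Rabs_pos_eq 2), (Rabs_pos_eq (Im w)) by lra. unfold B.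
    apply Rmult_le_compat_l; [|lra]. generalize (Rabs_pos (Im beta)). lra. }
  assert (A3 : B <= eta / 2 * - Re w).
  { replace B with (eta / 2 * (B / (eta / 2))) by (field; lra). apply Rmult_le_compat_l; lra. }
  lra.
Qed.

End Frame.

Theorem adapted_frame_exists (L : line_bundle) (h : hermitian_metric L) (a : R) : acceptable h ->
  exists gam r v, a - 1 < gam <= a /\ adapted h gam r v.
Proof.
intros (f & Hf & M & HM).
(* The curvature coefficient is minus a quarter of the Laplacian of log h. *)
set (g := fun z => - 4 * (f z * omegaP z)).
assert (lap : forall i z, chart L i z ->
  dx (dx (fun z => ln (weight h i z))) z + dy (dy (fun z => ln (weight h i z))) z = g z).
{ intros i z Hi. specialize (Hf i z Hi). unfold g. rewrite <- Hf. unfold curvature. field. }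
(* The function f of the hypothesis is only bounded; regularity of g comes from its being the
   Laplacian of a smooth function in every chart. *)
assert (gC1 : Ck 1 punctured_disc g).
{ apply Ck_local. intros z Hz. set (i := chart_at L z). exists (chart L i).
  split; [now apply chart_cover|].
  apply (Ck_ext _ (chart_open L i)) with (1 := lap i).
  assert (Cu : Ck 3 (chart L i) (fun z => ln (weight h i z))).
  { apply Ck_ln; [apply chart_open|apply weight_pos|apply weight_smooth]. }
  apply Ck_plus; [apply chart_open| |].
  - apply Cu.
  - apply Cu. }
(* The factor 4 cancels against the square of log |z|^2 = 2 log |z|. *)
assert (gM : forall z, punctured_disc z -> Rabs (g z) <= M / (Cmod z ^ 2 * ln (Cmod z) ^ 2)).
{ intros z Hz. destruct (Hz) as [H1 N]. apply Cmod_gt_0 in N.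
  assert (Hl : ln (Cmod z) < 0) by (rewrite <- ln_1; apply ln_increasing; trivial).
  unfold g, omegaP. rewrite ln_pow by trivial. simpl INR.
  set (l := ln (Cmod z)) in *. set (m := Cmod z) in *.
  assert (P1 : 0 < m ^ 2) by (apply pow_lt; trivial). assert (P2 : 0 < l ^ 2) by nra.
  replace (-4 * (f z * / (m ^ 2 * (- ((1 + 1) * l)) ^ 2))) with (- (f z / (m ^ 2 * l ^ 2)))
    by (field; lra).
  rewrite Rabs_Ropp. unfold Rdiv. rewrite Rabs_mult, (Rabs_pos_eq (/ _)).
  - apply Rmult_le_compat_r; [|now apply HM]. left. apply Rinv_0_lt_compat. nra.
  - left. apply Rinv_0_lt_compat. nra. }
destruct (CR_solution g M gC1 gM) as (X & Y & D & K & Dlim & Dbd & CR).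
(* The pieces add up to g only for |z| <= 1 / 4, so the frame is built on Re w < ln (1 / 4). *)
set (x0 := ln (/ 4)).
assert (Ex : exp x0 = / 4) by (apply exp_ln; lra).
destruct (lift_half_plane L h D x0) as [S HS].
{ intros w Hw. apply (lifted_local L h g X Y D K); trivial. rewrite Cmod_Cexp, <- Ex.
  now apply exp_increasing. }
destruct (adapted_frame L h D x0 S HS) with (a := a) as (gam & v & Hg & Hv).
(* To see that z D(z) tends to 0, N is fixed so that the tail of the series contributes at most eta
   / 2; the partial sum is bounded by B, so its product with z is at most eta / 2 for small z. *)
- intros eta He.
  destruct (INR_unbounded (Rabs K / (eta / 2))) as [N HN].
  destruct (Dbd N) as [B HB].
  assert (HB0 : 0 <= B) by (eapply Rle_trans; [apply Cmod_ge_0|apply (HB 0)]).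
  set (x1 := ln (eta / 2 / (B + 1))).
  assert (P : 0 < eta / 2 / (B + 1)) by (apply Rdiv_lt_0_compat; lra).
  exists x1. intros w Hw. set (z := Cexp w).
  assert (Nz : z <> 0) by apply Cexp_neq0. assert (Pz := proj1 (Cmod_gt_0 z) Nz).
  assert (Lz : Cmod z <= eta / 2 / (B + 1)).
  { unfold z. rewrite Cmod_Cexp. rewrite <- (exp_ln _ P). fold x1.
    destruct Hw as [Hw| ->]; [left; now apply exp_increasing|right; trivial]. }
  replace (D z * z)%C with ((D z - (X N z, Y N z)) * z + (X N z, Y N z) * z)%C by ring.
  eapply Rle_trans; [apply Cmod_triangle|]. rewrite !Cmod_mult.
  assert (T := Dlim N z Nz). assert (PN := pos_INR N).
  assert (T1 : Cmod (D z - (X N z, Y N z))%C * Cmod z <= K / (INR N + 1)).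
  { apply (Rmult_le_compat_r (Cmod z)) in T; [|lra].
    replace (K / (INR N + 1) / Cmod z * Cmod z) with (K / (INR N + 1)) in T by (field; lra). exact T. }
  assert (T2 : K / (INR N + 1) <= eta / 2).
  { apply Rle_div_l; [lra|]. apply (Rmult_lt_compat_r (eta / 2)) in HN; [|lra].
    replace (Rabs K / (eta / 2) * (eta / 2)) with (Rabs K) in HN by (field; lra).
    assert (Q := Rle_abs K). nra. }
  assert (T3 : Cmod ((X N z, Y N z) : C) * Cmod z <= (B + 1) * (eta / 2 / (B + 1))).
  { apply Rmult_le_compat; try apply Cmod_ge_0; trivial. specialize (HB z). lra. }
  replace ((B + 1) * (eta / 2 / (B + 1))) with (eta / 2) in T3 by (field; lra). lra.
- rewrite Ex. lra.
- exists gam, (exp x0), v. auto.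
Qed.

(** * Prolongations in terms of an adapted frame *)

Lemma Cminus_0_r (z : C) : (z - 0)%C = z.
Proof. ring. Qed.

Lemma locally'_0 (P : C -> Prop) : locally' (T := C_UniformSpace) (RtoC 0) P <->
  exists d, 0 < d /\ forall z : C, Cmod z < d -> z <> 0 -> P z.
Proof.
rewrite locally'_Cmod. split; intros (d & Hd & H); exists d; split; trivial; intros z Hz.
- apply H. now rewrite Cminus_0_r.
- apply H. now rewrite Cminus_0_r in Hz.
Qed.

Lemma Rpower_small (e M eps : R) : 0 < e -> 0 < eps ->
  exists d, 0 < d /\ forall x, 0 < x < d -> M * Rpower x e <= eps.
Proof.
intros He Heps. set (q := eps / (Rabs M + 1)).
assert (P : 0 < Rabs M + 1) by (generalize (Rabs_pos M); lra).
assert (Hq : 0 < q) by now apply Rdiv_lt_0_compat.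
exists (exp (ln q / e)). split; [apply exp_pos|]. intros x [Hx1 Hx2].
assert (L : ln x < ln q / e) by (rewrite <- (ln_exp (ln q / e)); now apply ln_increasing).
assert (R : Rpower x e < q).
{ unfold Rpower. rewrite <- (exp_ln q Hq). apply exp_increasing.
  apply (Rmult_lt_compat_l e) in L; trivial.
  replace (e * (ln q / e)) with (ln q) in L by (field; lra). exact L. }
assert (R0 : 0 < Rpower x e) by apply exp_pos.
assert (A := Rle_abs M). assert (Q : (Rabs M + 1) * q = eps) by (unfold q; field; lra). nra.
Qed.

Lemma Rpower_exponent_le x a b : 0 < x <= 1 -> a <= b -> Rpower x b <= Rpower x a.
Proof.
intros [H1 H2] H. assert (L : ln x <= 0).
{ rewrite <- ln_1. destruct H2 as [H2| ->]; [left; now apply ln_increasing|right; trivial]. }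
unfold Rpower. assert (K : b * ln x <= a * ln x) by nra.
destruct K as [K|K]; [left; now apply exp_increasing|right; now rewrite K].
Qed.

Lemma liminf0_limit (u : C -> R) (l : R) :
  (forall eta, 0 < eta -> exists d, 0 < d /\ forall z : C, Cmod z < d -> z <> 0 -> Rabs (u z - l) <= eta) ->
  liminf0 u = Finite l.
Proof.
intros H. unfold liminf0. apply is_lub_Rbar_unique. split.
- intros m Hm. apply locally'_0 in Hm. destruct Hm as (d & Hd & K). simpl.
  apply Rnot_lt_le. intros N. destruct (H ((m - l) / 2)) as (d' & Hd' & K'); [lra|].
  set (t := Rmin d d' / 2). assert (P : 0 < Rmin d d') by now apply Rmin_glb_lt.
  assert (T : Cmod (RtoC t) = t) by (rewrite Cmod_R, Rabs_pos_eq; unfold t; lra).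
  assert (T1 := Rmin_l d d'). assert (T2 := Rmin_r d d').
  assert (Nt : RtoC t <> 0) by (apply RtoC_neq; unfold t; lra).
  specialize (K (RtoC t)). specialize (K' (RtoC t)). rewrite T in K, K'.
  specialize (K ltac:(unfold t; lra) Nt). specialize (K' ltac:(unfold t; lra) Nt).
  apply Rabs_le_between in K'. lra.
- intros b Hb. destruct b as [b| |]; simpl; trivial.
  + apply Rnot_lt_le. intros N. 
    assert (E : Rbar_le (l - (l - b) / 2) b).
    { apply Hb. apply locally'_0. destruct (H ((l - b) / 2)) as (d & Hd & K); [lra|].
      exists d. split; trivial. intros z Hz Nz. specialize (K z Hz Nz).
      apply Rabs_le_between in K. lra. }
    simpl in E. lra.
  + assert (E : Rbar_le (l - 1) m_infty).
    { apply Hb. apply locally'_0. destruct (H 1) as (d & Hd & K); [lra|].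
      exists d. split; trivial. intros z Hz Nz. specialize (K z Hz Nz).
      apply Rabs_le_between in K. lra. }
    exact E.
Qed.

Lemma Ccont_agree (f g : C -> C) z d : 0 < d -> Ccont f z -> Ccont g z ->
  (forall w, Cmod (w - z)%C < d -> w <> z -> f w = g w) -> f z = g z.
Proof.
intros Hd Hf Hg H. apply Ceq_minus, Cmod_small_0. intros eps He.
destruct (Hf (eps / 2)) as (d1 & Hd1 & K1); [lra|]. destruct (Hg (eps / 2)) as (d2 & Hd2 & K2); [lra|].
set (m := Rmin d (Rmin d1 d2)). assert (Hm : 0 < m) by (unfold m; repeat apply Rmin_glb_lt; lra).
assert (T : m <= d /\ m <= d1 /\ m <= d2).
{ unfold m. generalize (Rmin_l d (Rmin d1 d2)) (Rmin_r d (Rmin d1 d2)) (Rmin_l d1 d2) (Rmin_r d1 d2). lra. }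
set (w := (z + RtoC (m / 2))%C).
assert (E : Cmod (w - z)%C = m / 2).
{ unfold w. replace (z + RtoC (m / 2) - z)%C with (RtoC (m / 2)) by ring. rewrite Cmod_R, Rabs_pos_eq; lra. }
assert (N : w <> z).
{ intros X. rewrite X in E. unfold Cminus in E. rewrite Cplus_opp_r, Cmod_0 in E. lra. }
specialize (K1 w ltac:(lra)). specialize (K2 w ltac:(lra)). rewrite <- (H w ltac:(lra) N) in K2.
rewrite Cmod_sub_sym in K1.
replace (f z - g z)%C with ((f z - f w) + (f w - g z))%C by ring.
eapply Rle_trans; [apply Cmod_triangle|]. lra.
Qed.

Lemma Ccont_bounded (f : C -> C) z : Ccont f z ->
  exists d, 0 < d /\ forall w, Cmod (w - z)%C < d -> Cmod (f w) <= Cmod (f z) + 1.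
Proof.
intros H. destruct (H 1 Rlt_0_1) as (d & Hd & K). exists d. split; trivial. intros w Hw.
specialize (K w Hw). generalize (Cmod_rev_tri (f w) (f z)). lra.
Qed.

Definition growth {L : line_bundle} (h : hermitian_metric L) (lam : R) (s : section L) : Prop :=
  forall eps, 0 < eps -> exists M d, 0 < d /\ forall z : C, Cmod z < d -> z <> 0 ->
    sqrt (hsq h s z) <= M * Rpower (Cmod z) (- (lam + eps)).

Lemma prolong_growth {L : line_bundle} (h : hermitian_metric L) lam U s :
  prolong h lam U s <-> is_section L (remove0 U) s /\ (U (RtoC 0) -> growth h lam s).
Proof.
unfold prolong, growth. split; intros [H K]; split; trivial; intros U0 eps He;
 destruct (K U0 eps He) as [M HM]; exists M.
- now apply locally'_0.
- destruct HM as (d & Hd & HM). apply locally'_0. now exists d.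
Qed.

Lemma growth_mono {L : line_bundle} (h : hermitian_metric L) lam mu s :
  lam <= mu -> growth h lam s -> growth h mu s.
Proof.
intros Hl H eps He. destruct (H eps He) as (M & d & Hd & K).
exists (Rabs M), (Rmin d 1). split; [apply Rmin_glb_lt; lra|]. intros z Hz N.
assert (Z1 := Rlt_le_trans _ _ _ Hz (Rmin_l _ _)). assert (Z2 := Rlt_le_trans _ _ _ Hz (Rmin_r _ _)).
eapply Rle_trans; [now apply K|]. apply Cmod_gt_0 in N.
assert (P : 0 < Rpower (Cmod z) (- (lam + eps))) by apply exp_pos.
assert (Q : Rpower (Cmod z) (- (lam + eps)) <= Rpower (Cmod z) (- (mu + eps))).
{ apply Rpower_exponent_le; lra. }
assert (A := Rle_abs M). assert (B := Rabs_pos M). nra.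
Qed.

Lemma prolong_mono {L : line_bundle} (h : hermitian_metric L) lam mu U s :
  lam <= mu -> prolong h lam U s -> prolong h mu U s.
Proof.
rewrite !prolong_growth. intros Hl [H K]. split; trivial. intros U0. apply (growth_mono h lam); auto.
Qed.

Lemma is_section_sub (L : line_bundle) (U V : C -> Prop) s : (forall z, V z -> U z) ->
  is_section L U s -> is_section L V s.
Proof.
intros E [H K]. split.
- intros i z [Vz Hi]. apply H. auto.
- intros i j z Vz. apply K. auto.
Qed.

Lemma prolong_restrict {L : line_bundle} (h : hermitian_metric L) lam (U V : C -> Prop) s :
  (forall z, V z -> U z) -> prolong h lam U s -> prolong h lam V s.
Proof.
rewrite !prolong_growth. intros E [H K]. split; auto.
apply (is_section_sub L (remove0 U)); trivial. intros z [Vz N]. split; auto.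
Qed.

Lemma is_section_der (L : line_bundle) U s i z : is_section L U s -> U z -> chart L i z ->
  exists l, Cder (s i) z l.
Proof. intros [H _] Uz Hi. apply ex_derive_Cder. now apply H. Qed.

Lemma is_section_lincomb (L : line_bundle) U (s t : section L) (f : C -> C) :
  (forall z, U z -> exists l, Cder f z l) -> is_section L U s -> is_section L U t ->
  is_section L U (fun i z => s i z + f z * t i z)%C.
Proof.
intros Hf Hs Ht. split.
- intros i z [Uz Hi]. apply ex_derive_Cder. destruct (Hf z Uz) as [l Hl].
  destruct (is_section_der L U s i z Hs Uz Hi) as [m Hm].
  destruct (is_section_der L U t i z Ht Uz Hi) as [n Hn].
  eexists. apply Cder_plus; [exact Hm|apply Cder_mult; [exact Hl|exact Hn]].
- intros i j z Uz Hi Hj. destruct Hs as [_ Hs]. destruct Ht as [_ Ht].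
  rewrite (Hs i j z), (Ht i j z) by trivial. ring.
Qed.

Section Model.
Variables (L : line_bundle) (h : hermitian_metric L) (gam r : R) (v : section L).
Hypothesis Hv : adapted h gam r v.

Definition near0 (z : C) : Prop := Cmod z < r /\ z <> RtoC 0.

Lemma near0_punctured z : near0 z -> punctured_disc z.
Proof. destruct Hv as (Hr & _). intros [H N]. split; [lra|trivial]. Qed.

Lemma near0_cover z : near0 z -> chart L (chart_at L z) z.
Proof. intros H. now apply chart_cover, near0_punctured. Qed.

Lemma v_neq0 i z : near0 z -> chart L i z -> v i z <> 0.
Proof. destruct Hv as (_ & _ & H & _). intros [? ?]. now apply H. Qed.

Lemma hsq_v_pos z : near0 z -> 0 < hsq h v z.
Proof.
intros H. assert (Ci := near0_cover z H). apply Rmult_lt_0_compat; [now apply weight_pos|].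
apply pow_lt, Cmod_gt_0. now apply v_neq0.
Qed.

(** The asymptotics of [adapted] concern the squared norm, so they are invoked with 2 eta. *)
Lemma v_bounds eta : 0 < eta -> exists d, 0 < d <= r /\ forall z : C, Cmod z < d -> z <> 0 ->
  Rpower (Cmod z) (- gam + eta) <= sqrt (hsq h v z) <= Rpower (Cmod z) (- gam - eta).
Proof.
intros He. destruct Hv as (Hr & _ & _ & H). destruct (H (2 * eta)) as (d & Hd & K); [lra|].
exists (Rmin d r). split; [split; [apply Rmin_glb_lt; lra|apply Rmin_r]|]. intros z Hz N.
assert (Z1 := Rlt_le_trans _ _ _ Hz (Rmin_l _ _)). assert (Z2 := Rlt_le_trans _ _ _ Hz (Rmin_r _ _)).
specialize (K z Z1 N). apply Rabs_le_between in K.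
assert (P := hsq_v_pos z (conj Z2 N)).
rewrite <- Rpower_sqrt by trivial. unfold Rpower.
set (l := ln (Cmod z)) in *. set (m := ln (hsq h v z)) in *.
assert (mono : forall a b, a <= b -> exp a <= exp b).
{ intros a b [X| ->]; [left; now apply exp_increasing|right; trivial]. }
split; apply mono; lra.
Qed.

Definition coeff (t : section L) (z : C) : C := (t (chart_at L z) z / v (chart_at L z) z)%C.

Lemma coeff_spec (V : C -> Prop) t i z : is_section L V t -> V z -> near0 z -> chart L i z ->
  t i z = (coeff t z * v i z)%C.
Proof.
intros [_ Ht] Vz Hz Hi. unfold coeff. set (j := chart_at L z). assert (Hj := near0_cover z Hz). fold j in Hj.
destruct Hv as (_ & [_ Hv2] & _).
rewrite (Ht i j z), (Hv2 i j z) by trivial. assert (N := v_neq0 j z Hz Hj). field. trivial.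
Qed.

Lemma near0_open : Copen near0.
Proof.
intros z [H N]. apply Cmod_gt_0 in N.
exists (Rmin (r - Cmod z) (Cmod z)). split; [apply Rmin_glb_lt; lra|]. intros w Hw.
assert (W1 := Rlt_le_trans _ _ _ Hw (Rmin_l _ _)). assert (W2 := Rlt_le_trans _ _ _ Hw (Rmin_r _ _)).
split.
- generalize (Cmod_rev_tri w z). lra.
- intros ->. rewrite Cmod_sub_sym, Cminus_0_r in W2. lra.
Qed.

Lemma coeff_der (V : C -> Prop) t z : is_section L V t -> Copen V -> V z -> near0 z ->
  exists l, Cder (coeff t) z l.
Proof.
intros Ht HV Vz Hz. set (i := chart_at L z). assert (Hi := near0_cover z Hz). fold i in Hi.
destruct (is_section_der L V t i z Ht Vz Hi) as [l Hl].
destruct Hv as (_ & Hv1 & _).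
destruct (is_section_der L near0 v i z Hv1 Hz Hi) as [m Hm].
assert (N := v_neq0 i z Hz Hi).
eexists. apply Cder_ext_loc with (fun z => t i z / v i z)%C; [|apply Cder_div; eassumption].
destruct (HV z Vz) as (d1 & Hd1 & K1). destruct (near0_open z Hz) as (d2 & Hd2 & K2).
destruct (proj1 (open_Copen _) (chart_open L i) z Hi) as (d3 & Hd3 & K3).
exists (Rmin d1 (Rmin d2 d3)). split; [repeat apply Rmin_glb_lt; trivial|]. intros w Hw.
assert (W1 := Rlt_le_trans _ _ _ Hw (Rmin_l _ _)). assert (W2 := Rlt_le_trans _ _ _ Hw (Rmin_r _ _)).
assert (W3 := Rlt_le_trans _ _ _ W2 (Rmin_r _ _)). apply (fun H => Rlt_le_trans _ _ _ H (Rmin_l _ _)) in W2.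
rewrite (coeff_spec V t i w Ht (K1 w W1) (K2 w W2) (K3 w W3)).
assert (N2 := v_neq0 i w (K2 w W2) (K3 w W3)). field. trivial.
Qed.

Lemma hsq_coeff (t : section L) (f : C -> C) z : near0 z ->
  t (chart_at L z) z = (f z * v (chart_at L z) z)%C ->
  sqrt (hsq h t z) = Cmod (f z) * sqrt (hsq h v z).
Proof.
intros Hz E. assert (P := hsq_v_pos z Hz). unfold hsq. rewrite E, Cmod_mult.
rewrite <- (sqrt_pow2 (Cmod (f z)) (Cmod_ge_0 _)), <- sqrt_mult.
- f_equal. rewrite sqrt_pow2 by apply Cmod_ge_0. unfold hsq. ring.
- apply pow2_ge_0.
- left. exact P.
Qed.

(** Together with [coeff_bound] this translates growth orders of sections into orders of their
    coefficients along v, with an arbitrarily small loss that the definition of [growth]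
    tolerates. *)
Lemma growth_of_coeff (t : section L) (f : C -> C) e M d : 0 < d ->
  (forall z : C, Cmod z < d -> z <> 0 -> t (chart_at L z) z = (f z * v (chart_at L z) z)%C /\
     Cmod (f z) <= M * Rpower (Cmod z) e) ->
  growth h (gam - e) t.
Proof.
intros Hd H eps He. destruct (v_bounds eps He) as (d' & Hd' & K).
exists M, (Rmin d d'). split; [apply Rmin_glb_lt; lra|]. intros z Hz N.
assert (Z1 := Rlt_le_trans _ _ _ Hz (Rmin_l _ _)). assert (Z2 := Rlt_le_trans _ _ _ Hz (Rmin_r _ _)).
destruct (H z Z1 N) as [E B]. destruct (K z Z2 N) as [_ B2].
assert (Hz0 : near0 z) by (split; [lra|trivial]).
rewrite (hsq_coeff t f z Hz0 E).
replace (- (gam - e + eps)) with (e + (- gam - eps)) by ring. rewrite Rpower_plus.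
rewrite <- Rmult_assoc. apply Rmult_le_compat; trivial; [apply Cmod_ge_0|apply sqrt_pos].
Qed.

Lemma coeff_bound (V : C -> Prop) t lam eps : is_section L V t ->
  (exists d, 0 < d /\ forall z : C, Cmod z < d -> z <> 0 -> V z) ->
  growth h lam t -> 0 < eps ->
  exists M d, 0 < d /\ forall z : C, Cmod z < d -> z <> 0 ->
    Cmod (coeff t z) <= M * Rpower (Cmod z) (gam - lam - eps).
Proof.
intros Ht (d0 & Hd0 & HV) G He. destruct (G (eps / 2)) as (M & d & Hd & K); [lra|].
destruct (v_bounds (eps / 2)) as (d' & Hd' & K'); [lra|].
exists M, (Rmin d0 (Rmin d d')). split; [repeat apply Rmin_glb_lt; lra|]. intros z Hz N.
assert (Z1 := Rlt_le_trans _ _ _ Hz (Rmin_l _ _)). assert (Z2 := Rlt_le_trans _ _ _ Hz (Rmin_r _ _)).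
assert (Z3 := Rlt_le_trans _ _ _ Z2 (Rmin_r _ _)). apply (fun H => Rlt_le_trans _ _ _ H (Rmin_l _ _)) in Z2.
specialize (K z Z2 N). destruct (K' z Z3 N) as [B _].
assert (Hz0 : near0 z) by (split; [lra|trivial]).
rewrite (hsq_coeff t (coeff t) z Hz0) in K by (apply (coeff_spec V); auto using near0_cover).
set (A := Rpower (Cmod z) (- gam + eps / 2)) in *. assert (HA : 0 < A) by apply exp_pos.
assert (X : Cmod (coeff t z) * A <= M * Rpower (Cmod z) (- (lam + eps / 2))).
{ eapply Rle_trans; [|exact K]. apply Rmult_le_compat_l; [apply Cmod_ge_0|trivial]. }
apply (Rmult_le_reg_r A); trivial. eapply Rle_trans; [exact X|]. right.
rewrite Rmult_assoc. unfold A. rewrite <- Rpower_plus. f_equal. f_equal. field.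
Qed.

(** The coefficient is O(|z|^(gam - lam - e)) for every e > 0. As lam < gam + 1, the exponent can be
    kept above -1, so z times the coefficient tends to 0 and the singularity is removable. *)
Lemma coeff_extends (V : C -> Prop) t lam : Copen V -> V 0 -> (forall z, V z -> Cmod z < r) ->
  lam < gam + 1 -> prolong h lam V t ->
  exists q : C -> C, (forall z, V z -> exists l, Cder q z l) /\
    (forall z : C, z <> 0 -> q z = coeff t z).
Proof.
intros HV V0 Vr Hl Hp. apply prolong_growth in Hp. destruct Hp as [Ht G]. specialize (G V0).
destruct (HV _ V0) as (d0 & Hd0 & K0).
assert (Vn : forall z : C, Cmod z < d0 -> V z) by (intros; apply K0; now rewrite Cminus_0_r).
assert (der : forall z : C, V z -> z <> 0 -> exists l, Cder (coeff t) z l).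
{ intros z Vz N. apply (coeff_der (remove0 V)); trivial.
  - intros w [Vw Nw]. destruct (HV w Vw) as (e & He & K). apply Cmod_gt_0 in Nw.
    exists (Rmin e (Cmod w)). split; [now apply Rmin_glb_lt|]. intros u Hu. split.
    + apply K. eapply Rlt_le_trans; [exact Hu|apply Rmin_l].
    + intros ->. rewrite Cmod_sub_sym, Cminus_0_r in Hu.
      generalize (Rmin_r e (Cmod w)). lra.
  - split; auto. - split; auto. }
destruct (removable_singularity (coeff t) d0 Hd0) as (q & Q1 & Q2).
- intros z Hz N. apply der; auto.
- intros eps He. set (e := (gam + 1 - lam) / 2).
  destruct (coeff_bound (remove0 V) t lam e Ht) as (M & d & Hd & B); trivial.
  { exists d0. split; trivial. intros z Hz N. split; auto. }
  { unfold e; lra. }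
  destruct (Rpower_small (1 + (gam - lam - e)) M eps) as (d1 & Hd1 & K1); [unfold e; lra|trivial|].
  exists (Rmin d d1). split; [now apply Rmin_glb_lt|]. intros z Hz N.
  assert (Z1 := Rlt_le_trans _ _ _ Hz (Rmin_l _ _)). assert (Z2 := Rlt_le_trans _ _ _ Hz (Rmin_r _ _)).
  assert (P := proj1 (Cmod_gt_0 z) N).
  rewrite Cmod_mult. eapply Rle_trans; [|apply (K1 (Cmod z)); lra].
  rewrite Rpower_plus, Rpower_1 by trivial.
  replace (M * (Cmod z * Rpower (Cmod z) (gam - lam - e))) with
    (Cmod z * (M * Rpower (Cmod z) (gam - lam - e))) by ring.
  apply Rmult_le_compat_l; [lra|auto].
- exists q. split; trivial. intros z Vz. destruct (Ceq_dec z 0) as [->|N].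
  + apply Q2. now rewrite Cmod_0.
  + destruct (der z Vz N) as [l Hl']. exists l. apply Cder_ext_loc with (coeff t); trivial.
    exists (Cmod z). split; [now apply Cmod_gt_0|]. intros w Hw. symmetry. apply Q1. intros ->.
    rewrite Cmod_sub_sym, Cminus_0_r in Hw. lra.
Qed.

Definition ball0 (z : C) : Prop := Cmod z < r.

Lemma ball0_open : Copen ball0.
Proof. apply open_Copen, open_Cmod_lt. Qed.

Lemma ball0_0 : ball0 0.
Proof. destruct Hv as (Hr & _). unfold ball0. rewrite Cmod_0. lra. Qed.

Lemma ball0_in_disc : open_in_disc ball0.
Proof.
split; [apply open_Cmod_lt|]. destruct Hv as (Hr & _). intros z Hz. unfold Defs.disc. unfold ball0 in Hz. lra.
Qed.

Lemma Copen_inter (U V : C -> Prop) : Copen U -> Copen V -> Copen (fun z => U z /\ V z).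
Proof.
intros HU HV z [Uz Vz]. destruct (HU z Uz) as (d & Hd & K). destruct (HV z Vz) as (e & He & K').
exists (Rmin d e). split; [now apply Rmin_glb_lt|]. intros w Hw. split.
- apply K. eapply Rlt_le_trans; [exact Hw|apply Rmin_l].
- apply K'. eapply Rlt_le_trans; [exact Hw|apply Rmin_r].
Qed.

Lemma Copen_remove0 (V : C -> Prop) : Copen V -> Copen (remove0 V).
Proof.
intros HV. apply Copen_inter; trivial. intros w Nw. apply Cmod_gt_0 in Nw.
exists (Cmod w). split; trivial. intros u Hu ->. rewrite Cmod_sub_sym, Cminus_0_r in Hu. lra.
Qed.

Lemma prolong_local (U : C -> Prop) t lam : Copen U -> U 0 -> lam < gam + 1 -> prolong h lam U t ->
  exists (q : C -> C) d, 0 < d <= r /\ (forall z, Cmod z < d -> U z /\ exists l, Cder q z l) /\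
    (forall i (z : C), Cmod z < d -> z <> 0 -> chart L i z -> t i z = (q z * v i z)%C) /\
    (forall z : C, z <> 0 -> q z = coeff t z).
Proof.
intros HU U0 Hl Ht. set (V := fun z => U z /\ ball0 z).
assert (OV : Copen V) by (apply Copen_inter; trivial; apply ball0_open).
assert (V0 : V 0) by (split; trivial; apply ball0_0).
assert (Hp : prolong h lam V t) by (apply (prolong_restrict h lam U); trivial; now intros z []).
destruct (coeff_extends V t lam OV V0 ltac:(now intros z []) Hl Hp) as (q & Q1 & Q2).
destruct (OV _ V0) as (d & Hd & K).
assert (K' : forall z, Cmod z < d -> V z) by (intros; apply K; now rewrite Cminus_0_r).
assert (Hr : 0 < r) by (destruct Hv; lra).
exists q, (Rmin d r). split; [split; [now apply Rmin_glb_lt|apply Rmin_r]|].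
split; [|split; trivial].
- intros z Hz. assert (Vz : V z) by (apply K'; eapply Rlt_le_trans; [exact Hz|apply Rmin_l]).
  split; [apply Vz|auto].
- intros i z Hz N Hi. rewrite Q2 by trivial.
  assert (Vz : V z) by (apply K'; eapply Rlt_le_trans; [exact Hz|apply Rmin_l]).
  apply prolong_growth in Hp. apply (coeff_spec (remove0 V)); trivial; [apply Hp| |].
  + now split. + split; [apply Vz|trivial].
Qed.

Lemma growth_of_holo (t : section L) (q : C -> C) (n : nat) M d : 0 < d <= r ->
  (forall i (z : C), Cmod z < d -> z <> 0 -> chart L i z -> t i z = (q z * v i z)%C) ->
  (forall z : C, Cmod z < d -> z <> 0 -> Cmod (q z) <= M * Cmod z ^ n) ->
  growth h (gam - INR n) t.
Proof.
intros Hd H B. apply (growth_of_coeff t q (INR n) M d); [lra|]. intros z Hz N.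
assert (Hz0 : near0 z) by (split; [lra|trivial]). split.
- apply H; trivial. now apply near0_cover.
- rewrite Rpower_pow by now apply Cmod_gt_0. auto.
Qed.

(** A coefficient that extends holomorphically is bounded near the origin, so the section grows no
    faster than v. *)
Lemma prolong_gam (U : C -> Prop) t lam : Copen U -> lam < gam + 1 ->
  prolong h lam U t -> prolong h gam U t.
Proof.
intros HU Hl Ht. assert (S := proj1 (prolong_growth _ _ _ _) Ht).
apply prolong_growth. split; [apply S|]. intros U0.
destruct (prolong_local U t lam HU U0 Hl Ht) as (q & d & Hd & Q1 & Q2 & _).
destruct (Q1 0) as [_ [l Hl0]]; [rewrite Cmod_0; lra|].
destruct (Ccont_bounded q 0 (Cder_cont _ _ _ Hl0)) as (e & He & B).
replace gam with (gam - INR 0) by (simpl; ring).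
assert (M1 := Rmin_l d e). assert (M2 := Rmin_r d e).
assert (P : 0 < Rmin d e) by (apply Rmin_glb_lt; lra).
apply (growth_of_holo t q 0 (Cmod (q 0) + 1) (Rmin d e)); [lra| |].
- intros i z Hz. apply Q2. lra.
- intros z Hz _. simpl. rewrite Rmult_1_r. apply B. rewrite Cminus_0_r. lra.
Qed.

Lemma prolong_eq lam : gam <= lam < gam + 1 -> sheaf_eq (prolong h lam) (prolong h gam).
Proof.
intros Hl U [HU _] s. apply open_Copen in HU. split.
- apply prolong_gam; trivial. lra.
- apply prolong_mono. lra.
Qed.

Lemma v_prolong lam : gam <= lam -> prolong h lam ball0 v.
Proof.
intros Hl. apply (prolong_mono h gam); trivial. apply prolong_growth. split; [apply Hv|].
intros _. replace gam with (gam - INR 0) by (simpl; ring).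
assert (Hr : 0 < r) by (destruct Hv; lra).
apply (growth_of_holo v (fun _ => 1) 0 1 r); [lra| |].
- intros; ring.
- intros. rewrite Cmod_1. simpl. lra.
Qed.

Lemma v_local_frame lam : gam <= lam < gam + 1 -> local_frame0 (prolong h lam) v.
Proof.
intros Hl. exists ball0. split; [apply ball0_in_disc|]. split; [apply ball0_0|].
split; [apply v_prolong; lra|]. intros V HV Vr t Ht. apply open_Copen in HV.
assert (S := proj1 (proj1 (prolong_growth _ _ _ _) Ht)).
assert (nz : forall i (z : C), V z -> chart L i z -> z <> 0).
{ intros i z _ Hi. now apply (chart_sub L i z). }
assert (X : exists q : C -> C, (forall z, V z -> exists l, Cder q z l) /\
   forall z : C, V z -> z <> 0 -> q z = coeff t z).
{ destruct (excluded_middle_informative (V (RtoC 0))) as [V0|V0].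
  - destruct (coeff_extends V t lam HV V0 Vr) as (q & Q1 & Q2); trivial; [lra|].
    exists q. split; auto.
  - exists (coeff t). split; trivial. intros z Vz.
    assert (N : z <> RtoC 0) by (intros ->; contradiction).
    apply (coeff_der (remove0 V)); trivial; [now apply Copen_remove0| |]; split; auto.
    now apply Vr. }
destruct X as (q & Q1 & Q2).
assert (spec : forall i z, V z -> chart L i z -> t i z = (q z * v i z)%C).
{ intros i z Vz Hi. assert (N := nz i z Vz Hi). rewrite Q2 by trivial.
  apply (coeff_spec (remove0 V)); trivial; split; auto. now apply Vr. }
exists q. split; [split; trivial|].
- intros z Vz. apply ex_derive_Cder. auto.
(* No chart contains the origin, so the equations determine f only away from it; its value there
   follows by continuity. *)
- intros f Hf Ef z Vz.
  assert (ne : forall w : C, V w -> w <> 0 -> f w = q w).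
  { intros w Vw N. assert (Hw : near0 w) by (split; [now apply Vr|trivial]).
    assert (Hi := near0_cover w Hw). set (i := chart_at L w) in *.
    assert (Nv := v_neq0 i w Hw Hi). assert (E := Ef i w Vw Hi). rewrite (spec i w Vw Hi) in E.
    transitivity (f w * v i w / v i w)%C; [field; trivial|]. rewrite <- E. field. trivial. }
  destruct (Ceq_dec z 0) as [->|N]; [|auto].
  destruct (HV _ Vz) as (d & Hd & K).
  apply (Ccont_agree f q 0 d Hd).
  + destruct (proj1 (ex_derive_Cder _ _) (Hf _ Vz)) as [l Hl']. eapply Cder_cont; exact Hl'.
  + destruct (Q1 _ Vz) as [l Hl']. eapply Cder_cont; exact Hl'.
  + intros w Hw Nw. apply ne; auto.
Qed.

(** The frame w chosen in [gamma] is unknown, but w = q v with q holomorphic. Since q(0) is not 0,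
    log h(w, w) and log h(v, v) differ by a bounded amount, negligible after division by log |z|;
    the lower limit is then a limit, namely - 2 gam. *)
Lemma gamma_prolong lam : gam <= lam < gam + 1 -> gamma h (prolong h lam) = gam.
Proof.
intros Hl. unfold gamma. set (w := some_frame0 (prolong h lam)).
assert (Fw : local_frame0 (prolong h lam) w).
{ apply (epsilon_spec (inhabits (fun _ _ => RtoC 0)) (local_frame0 (prolong h lam))).
  exists v. now apply v_local_frame. }
destruct Fw as (U & [HU Ud] & U0 & Pw & Fr). apply open_Copen in HU.
destruct (prolong_local U w lam HU U0 ltac:(lra) Pw) as (q & d & Hd & Q1 & Q2 & _).
set (V := fun z : C => Cmod z < d).
destruct (Fr V) with (t := v) as (f & [Hf Ef] & _).
{ apply open_Cmod_lt. } { intros z Vz. now apply Q1. }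
{ apply (prolong_restrict h lam ball0); [intros z Vz; unfold V, ball0 in *; lra|].
  apply v_prolong. lra. }
assert (V0 : V 0) by (unfold V; rewrite Cmod_0; lra).
destruct (Q1 0 V0) as [_ [l Hl0]].
destruct (proj1 (ex_derive_Cder _ _) (Hf 0 V0)) as [m Hm].
(* The frame property of w writes v = f w, so f q = 1 away from the origin, and at it by
   continuity. *)
assert (fq : (f 0 * q 0)%C = 1).
{ apply (Ccont_agree (fun z => f z * q z)%C (fun _ => RtoC 1) 0 d); [lra| | |].
  - eapply Cder_cont. apply Cder_mult; eassumption.
  - eapply Cder_cont. apply Cder_const.
  - intros z Hz N. rewrite Cminus_0_r in Hz.
    assert (Hz0 : near0 z) by (split; [lra|trivial]). assert (Hi := near0_cover z Hz0).
    set (i := chart_at L z) in *. assert (Nv := v_neq0 i z Hz0 Hi).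
    assert (E := Ef i z Hz Hi). rewrite (Q2 i z Hz N Hi) in E.
    transitivity (f z * (q z * v i z) / v i z)%C; [field; trivial|]. rewrite <- E. field. trivial. }
assert (Nq : q 0 <> 0).
{ intros E. rewrite E, Cmult_0_r in fq. now apply C1_nz. }
apply Cmod_gt_0 in Nq. set (c := Cmod (q 0)) in *.
destruct (Cder_cont _ _ _ Hl0 (c / 2)) as (e & He & Ke); [lra|].
assert (lim : liminf0 (fun z => ln (hsq h w z) / ln (Cmod z)) = Finite (- 2 * gam)).
{ apply liminf0_limit. intros eta Heta. destruct Hv as (Hr & _ & _ & G).
  destruct (G (eta / 2)) as (d1 & Hd1 & K1); [lra|].
  set (B := Rabs (2 * ln (c / 2)) + Rabs (2 * ln (2 * c))).
  assert (HB : 0 <= B) by (unfold B; generalize (Rabs_pos (2 * ln (c / 2))) (Rabs_pos (2 * ln (2 * c))); lra).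
  set (d2 := exp (- (B / (eta / 2)) - 1)).
  set (dd := Rmin (Rmin d e) (Rmin d1 d2)).
  assert (D : dd <= d /\ dd <= e /\ dd <= d1 /\ dd <= d2).
  { unfold dd. generalize (Rmin_l (Rmin d e) (Rmin d1 d2)) (Rmin_r (Rmin d e) (Rmin d1 d2))
     (Rmin_l d e) (Rmin_r d e) (Rmin_l d1 d2) (Rmin_r d1 d2). lra. }
  exists dd. split; [unfold dd; repeat apply Rmin_glb_lt; try lra; apply exp_pos|]. intros z Hz N.
  assert (Hz0 : near0 z) by (split; [lra|trivial]). assert (Hi := near0_cover z Hz0).
  assert (P := proj1 (Cmod_gt_0 z) N).
  assert (Ll : ln (Cmod z) < - (B / (eta / 2)) - 1).
  { rewrite <- (ln_exp (- (B / (eta / 2)) - 1)). apply ln_increasing; trivial. fold d2. lra. }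
  specialize (K1 z ltac:(lra) N). specialize (Ke z). rewrite Cminus_0_r in Ke. specialize (Ke ltac:(lra)).
  assert (C1 := Cmod_rev_tri (q z) (q 0)). assert (C2 := Cmod_rev_tri (q 0) (q z)).
  rewrite Cmod_sub_sym in C2. fold c in C1, C2.
  assert (E : ln (hsq h w z) = 2 * ln (Cmod (q z)) + ln (hsq h v z)).
  { assert (Pv := hsq_v_pos z Hz0). unfold hsq at 1.
    rewrite (Q2 _ z ltac:(lra) N Hi), Cmod_mult, Rpow_mult_distr.
    replace (weight h (chart_at L z) z * (Cmod (q z) ^ 2 * Cmod (v (chart_at L z) z) ^ 2))
      with (Cmod (q z) ^ 2 * hsq h v z) by (unfold hsq; ring).
    rewrite ln_mult; [|apply pow_lt; lra|trivial]. rewrite ln_pow by lra. simpl INR. ring. }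
  assert (Lq : Rabs (2 * ln (Cmod (q z))) <= B).
  { assert (A1 : ln (c / 2) <= ln (Cmod (q z))) by (left; apply ln_increasing; lra).
    assert (A2 : ln (Cmod (q z)) <= ln (2 * c)) by (left; apply ln_increasing; lra).
    unfold B. assert (A3 := Rle_abs (2 * ln (2 * c))). assert (A4 := Rle_abs (- (2 * ln (c / 2)))).
    rewrite Rabs_Ropp in A4. assert (A5 := Rabs_pos (2 * ln (2 * c))).
    assert (A6 := Rabs_pos (2 * ln (c / 2))). apply Rabs_le. lra. }
  set (x := ln (Cmod z)) in *.
  assert (X0 : x < 0) by (assert (0 <= B / (eta / 2)) by (apply Rdiv_le_0_compat; lra); lra).
  replace (ln (hsq h w z) / x - -2 * gam) with ((ln (hsq h w z) + 2 * gam * x) / x) by (field; lra).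
  unfold Rdiv. rewrite Rabs_mult, Rabs_inv, (Rabs_left x) by lra.
  apply Rle_div_l; [lra|]. rewrite E.
  replace (2 * ln (Cmod (q z)) + ln (hsq h v z) + 2 * gam * x)
    with (2 * ln (Cmod (q z)) + (ln (hsq h v z) + 2 * gam * x)) by ring.
  eapply Rle_trans; [apply Rabs_triang|].
  assert (B <= eta / 2 * - x).
  { replace B with (eta / 2 * (B / (eta / 2))) by (field; lra). apply Rmult_le_compat_l; lra. }
  lra. }
rewrite lim. simpl. field.
Qed.

End Model.

Lemma prolong_sub_scaled {L : line_bundle} (U : C -> Prop) (s t : section L) (c : C) :
  is_section L U s -> is_section L U t -> is_section L U (fun i z => s i z + - c * t i z)%C.
Proof.
intros Hs Ht. apply is_section_lincomb; trivial. intros z _. eexists. apply Cder_const.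
Qed.

(** * The single jump of the filtration, and the dual frame *)

Section Par.
Variables (L : line_bundle) (h : hermitian_metric L) (gam r : R) (v : section L).
Hypothesis Hv : adapted h gam r v.

(** The class of t = q v is q(0) times that of v. Indeed q - q(0) = O(|z|), so t - q(0) v has order
    gam - 1. Conversely, if t - c v has order mu < gam, then q - c tends to 0 and c = q(0). *)
Lemma quotient_dim_jump : quotient_dim (prolong h gam) (prolong_lt h gam) 1.
Proof.
exists (ball0 r), (fun _ => v). split; [eapply ball0_in_disc; exact Hv|].
split; [eapply ball0_0; exact Hv|].
split; [intros k _; eapply v_prolong; [exact Hv|lra]|].
intros V t HV V0 Vr Ht zero_mod. apply open_Copen in HV.
destruct (prolong_local L h gam r v Hv V t gam HV V0 ltac:(lra) Ht) as (q & d & Hd & Q1 & Q2 & Q3).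
assert (St := proj1 (proj1 (prolong_growth _ _ _ _) Ht)).
assert (Sv : is_section L (remove0 V) v).
{ apply (is_section_sub L (near0 r)); [|apply Hv]. intros z [Vz N]. split; trivial. now apply Vr. }
destruct (Q1 0) as [_ [l Hl]]; [rewrite Cmod_0; lra|].
assert (sub : forall c : nat -> C, sub_section t (lincomb 1 c (fun _ => v)) =
  (fun i z => t i z + - c 0%nat * v i z)%C).
{ intros c. apply functional_extensionality; intros i. apply functional_extensionality; intros z.
  unfold sub_section, lincomb. simpl. ring. }
exists (fun _ => q 0). split.
- unfold zero_mod. exists V. split; [now apply open_Copen|]. split; [trivial|]. split; [trivial|].
  exists (gam - 1). split; [lra|]. rewrite sub. apply prolong_growth.
  split; [now apply prolong_sub_scaled|]. intros _.
  replace (gam - 1) with (gam - INR 1) by (simpl; ring).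
  destruct (Hl 1 Rlt_0_1) as (e & He & K).
  assert (P : 0 < Rmin d e) by (apply Rmin_glb_lt; lra).
  assert (M1 := Rmin_l d e). assert (M2 := Rmin_r d e).
  apply (growth_of_holo L h gam r v Hv _ (fun z => q z - q 0)%C 1 (1 + Cmod l) (Rmin d e)); [lra| |].
  + intros i z Hz N Hi. rewrite (Q2 i z) by (trivial; lra). ring.
  + intros z Hz N. specialize (K z). rewrite Cminus_0_r in K. specialize (K ltac:(lra)).
    replace (q z - q 0)%C with ((q z - q 0 - l * z) + l * z)%C by ring.
    eapply Rle_trans; [apply Cmod_triangle|]. rewrite Cmod_mult, pow_1. lra.
- intros c (W & HW & W0 & WV & mu & Hmu & Hp) k Hk. replace k with 0%nat by lia.
  rewrite sub in Hp. apply open_Copen in HW. apply prolong_growth in Hp. destruct Hp as [Sp Gp].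
  set (s := (fun i z => t i z + - c 0%nat * v i z)%C) in *.
  set (e := (gam - mu) / 2).
  destruct (HW _ W0) as (d0 & Hd0 & K0).
  destruct (coeff_bound L h gam r v Hv (remove0 W) s mu e Sp) as (M & d1 & Hd1 & B).
  { exists d0. split; trivial. intros z Hz N. split; trivial. apply K0. now rewrite Cminus_0_r. }
  { auto. } { unfold e; lra. }
  symmetry. apply Ceq_minus. apply Cmod_small_0. intros eps He.
  destruct (Rpower_small (gam - mu - e) M (eps / 2)) as (d2 & Hd2 & K2); [unfold e; lra|lra|].
  destruct (Cder_cont _ _ _ Hl (eps / 2)) as (d3 & Hd3 & K3); [lra|].
  set (dd := Rmin (Rmin d d1) (Rmin d2 d3)).
  assert (P : 0 < dd) by (unfold dd; repeat apply Rmin_glb_lt; lra).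
  assert (T : dd <= d /\ dd <= d1 /\ dd <= d2 /\ dd <= d3).
  { unfold dd. generalize (Rmin_l (Rmin d d1) (Rmin d2 d3)) (Rmin_r (Rmin d d1) (Rmin d2 d3))
     (Rmin_l d d1) (Rmin_r d d1) (Rmin_l d2 d3) (Rmin_r d2 d3). lra. }
  set (z := RtoC (dd / 2)). assert (Ez : Cmod z = dd / 2) by (unfold z; rewrite Cmod_R, Rabs_pos_eq; lra).
  assert (Nz : z <> 0) by (apply Cmod_gt_0; lra).
  assert (Hz0 : near0 r z) by (split; [lra|trivial]).
  assert (Hi := near0_cover L h gam r v Hv z Hz0).
  specialize (B z ltac:(lra) Nz). specialize (K2 (Cmod z) ltac:(lra)).
  specialize (K3 z). rewrite Cminus_0_r in K3. specialize (K3 ltac:(lra)).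
  assert (Cs : coeff L v s z = (q z - c 0%nat)%C).
  { unfold coeff, s. rewrite (Q2 _ z ltac:(lra) Nz Hi).
    assert (Nv := v_neq0 L h gam r v Hv _ z Hz0 Hi). field. trivial. }
  rewrite Cs in B.
  replace (q 0 - c 0%nat)%C with (- (q z - q 0) + (q z - c 0%nat))%C by ring.
  eapply Rle_trans; [apply Cmod_triangle|]. rewrite Cmod_opp. lra.
Qed.

(** Above gam every section already has order gam. Below gam the coefficient q tends to 0, so it is
    O(|z|), and the order drops to gam - 1, which is less than lam. *)
Lemma quotient_dim_no_jump lam : gam - 1 < lam < gam + 1 -> lam <> gam ->
  quotient_dim (prolong h lam) (prolong_lt h lam) 0.
Proof.
intros Hl Nl. exists (ball0 r), (fun _ => v). split; [eapply ball0_in_disc; exact Hv|].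
split; [eapply ball0_0; exact Hv|]. split; [intros k Hk; lia|].
(* In dimension 0 the linear combination is empty; what remains is that t itself belongs to the
   smaller sheaf. *)
intros V t HV V0 Vr Ht zero_mod. exists (fun _ => RtoC 0). split; [|intros c' _ k Hk; lia].
exists V. split; [trivial|]. split; [trivial|]. split; [trivial|].
replace (sub_section t (lincomb 0 (fun _ => RtoC 0) (fun _ => v))) with t.
2:{ apply functional_extensionality; intros i. apply functional_extensionality; intros z.
  unfold sub_section, lincomb. simpl. ring. }
apply open_Copen in HV.
destruct (Rlt_dec gam lam) as [H|H].
- exists gam. split; trivial. apply (prolong_gam L h gam r v Hv V t lam); trivial. lra.
- exists (gam - 1). split; [lra|].
  destruct (prolong_local L h gam r v Hv V t lam HV V0 ltac:(lra) Ht) as (q & d & Hd & Q1 & Q2 & Q3).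
  apply prolong_growth in Ht. destruct Ht as [St Gt]. apply prolong_growth. split; trivial. intros _.
  destruct (Q1 0) as [_ [l Hl0]]; [rewrite Cmod_0; lra|].
  assert (q0 : q 0 = 0).
  { set (e := (gam - lam) / 2).
    destruct (HV _ V0) as (d0 & Hd0 & K0).
    destruct (coeff_bound L h gam r v Hv (remove0 V) t lam e St) as (M & d1 & Hd1 & B).
    { exists d0. split; trivial. intros z Hz N. split; trivial. apply K0. now rewrite Cminus_0_r. }
    { auto. } { unfold e; lra. }
    apply Cmod_small_0. intros eps He.
    destruct (Rpower_small (gam - lam - e) M (eps / 2)) as (d2 & Hd2 & K2); [unfold e; lra|lra|].
    destruct (Cder_cont _ _ _ Hl0 (eps / 2)) as (d3 & Hd3 & K3); [lra|].
    set (dd := Rmin d1 (Rmin d2 d3)).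
    assert (P : 0 < dd) by (unfold dd; repeat apply Rmin_glb_lt; lra).
    assert (T : dd <= d1 /\ dd <= d2 /\ dd <= d3).
    { unfold dd. generalize (Rmin_l d1 (Rmin d2 d3)) (Rmin_r d1 (Rmin d2 d3))
       (Rmin_l d2 d3) (Rmin_r d2 d3). lra. }
    set (z := RtoC (dd / 2)). assert (Ez : Cmod z = dd / 2) by (unfold z; rewrite Cmod_R, Rabs_pos_eq; lra).
    assert (Nz : z <> 0) by (apply Cmod_gt_0; lra).
    specialize (B z ltac:(lra) Nz). specialize (K2 (Cmod z) ltac:(lra)).
    specialize (K3 z). rewrite Cminus_0_r in K3. specialize (K3 ltac:(lra)).
    rewrite <- Q3 in B by trivial. generalize (Cmod_rev_tri (q 0) (q z)).
    rewrite Cmod_sub_sym in K3. lra. }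
  destruct (Hl0 1 Rlt_0_1) as (e & He & K).
  replace (gam - 1) with (gam - INR 1) by (simpl; ring).
  assert (P : 0 < Rmin d e) by (apply Rmin_glb_lt; lra).
  assert (M1 := Rmin_l d e). assert (M2 := Rmin_r d e).
  apply (growth_of_holo L h gam r v Hv _ q 1 (1 + Cmod l) (Rmin d e)); [lra| |].
  + intros i z Hz. apply Q2. lra.
  + intros z Hz N. specialize (K z). rewrite Cminus_0_r, q0 in K. specialize (K ltac:(lra)).
    replace (q z) with ((q z - 0 - l * z) + l * z)%C by ring.
    eapply Rle_trans; [apply Cmod_triangle|]. rewrite Cmod_mult, pow_1. lra.
Qed.

Lemma is_Par_singleton a : a - 1 < gam <= a -> is_Par h a (mset1 gam).
Proof.
intros Ha lam. unfold mset1. destruct (Req_EM_T lam gam) as [->|N]; split.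
- intros _. apply quotient_dim_jump.
- intros F. contradiction.
- intros Hl. apply quotient_dim_no_jump; trivial. lra.
- trivial.
Qed.

Lemma adapted_dual : adapted (L := dual L) (dual_metric h) (- gam) r (fun i z => / v i z)%C.
Proof.
destruct (Hv) as (Hr & Sv & Nv & G). split; [trivial|]. split; [split|split].
- intros i z [Hz Hi]. apply ex_derive_Cder. change (chart L i z) in Hi.
  destruct (is_section_der L (near0 r) v i z Sv Hz Hi) as [l Hl]. eexists.
  apply Cder_inv; [|exact Hl]. destruct Hz. now apply Nv.
- intros i j z Hz Hi Hj. change (chart L i z) in Hi. change (chart L j z) in Hj.
  change (/ v i z = trans L j i z * / v j z)%C. destruct Sv as [_ Sv]. rewrite (Sv i j z Hz Hi Hj).
  assert (N := Nv j z (proj1 Hz) (proj2 Hz) Hj). assert (T := trans_neq0 L i j z Hi Hj).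
  assert (E := trans_inv L i j z Hi Hj).
  transitivity ((trans L i j z * trans L j i z) * / (trans L i j z * v j z))%C; [rewrite E; ring|].
  field. auto.
- intros i z Hz N Hi E. change (chart L i z) in Hi.
  apply C1_nz. rewrite <- (Cinv_r _ (Nv i z Hz N Hi)), E. ring.
- intros eta He. destruct (G eta He) as (d & Hd & K).
  exists (Rmin d r). split; [apply Rmin_glb_lt; lra|]. intros z Hz N.
  assert (Z1 := Rlt_le_trans _ _ _ Hz (Rmin_l _ _)). assert (Z2 := Rlt_le_trans _ _ _ Hz (Rmin_r _ _)).
  specialize (K z Z1 N). assert (Hz0 : near0 r z) by now split.
  assert (P := hsq_v_pos L h gam r v Hv z Hz0).
  assert (Nvz := v_neq0 L h gam r v Hv _ z Hz0 (near0_cover L h gam r v Hv z Hz0)).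
  assert (Wp := weight_pos L h _ z (near0_cover L h gam r v Hv z Hz0)).
  assert (E : hsq (dual_metric h) (fun i z => / v i z)%C z = / hsq h v z).
  { change (/ weight h (chart_at L z) z * Cmod (/ v (chart_at L z) z)%C ^ 2 = / hsq h v z).
    unfold hsq. apply Cmod_gt_0 in Nvz. rewrite Cmod_inv by now apply Cmod_gt_0.
    field. lra. }
  rewrite E, ln_Rinv by trivial.
  replace (- ln (hsq h v z) + 2 * - gam * ln (Cmod z)) with (- (ln (hsq h v z) + 2 * gam * ln (Cmod z))) by ring.
  now rewrite Rabs_Ropp.
Qed.

End Par.

(** * The dual of a prolongation *)

Section Dual.
Variables (L : line_bundle) (h : hermitian_metric L) (gam r : R) (v : section L).
Hypothesis Hv : adapted h gam r v.

Lemma pairing_chart (U : C -> Prop) (s : section (dual L)) (t : section L) i j z :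
  is_section (dual L) (remove0 U) s -> is_section L (remove0 U) t ->
  remove0 U z -> chart L i z -> chart L j z -> (s i z * t i z)%C = (s j z * t j z)%C.
Proof.
intros [_ Hs] [_ Ht] Uz Hi Hj. rewrite (Hs i j z), (Ht i j z) by trivial.
change (trans (dual L) i j z) with (trans L j i z).
transitivity ((trans L i j z * trans L j i z) * (s j z * t j z))%C; [ring|].
rewrite trans_inv by trivial. ring.
Qed.

Definition pairing (s : section (dual L)) (t : section L) (z : C) : C :=
  (s (chart_at L z) z * t (chart_at L z) z)%C.

(** The value at the origin is that of any continuous extension of the pairing. It does not refer to
    an open set, so a single formula gives the morphism over all open sets, and compatibility with
    restriction only concerns germs. *)
Definition extended_pairing (s : section (dual L)) (t : section L) (z : C) : C :=
  if Ceq_dec z 0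
  then epsilon (inhabits (RtoC 0)) (fun l => exists f : C -> C, f 0 = l /\ Ccont f 0 /\
    exists d, 0 < d /\ forall w : C, Cmod w < d -> w <> 0 -> f w = pairing s t w)
  else pairing s t z.

Lemma extended_pairing_0 s t (f : C -> C) d : Ccont f 0 -> 0 < d ->
  (forall w : C, Cmod w < d -> w <> 0 -> f w = pairing s t w) -> extended_pairing s t 0 = f 0.
Proof.
intros Hf Hd E. unfold extended_pairing. destruct (Ceq_dec 0 0) as [_|N]; [|now elim N].
set (P := fun l => exists f : C -> C, f 0 = l /\ Ccont f 0 /\
    exists d, 0 < d /\ forall w : C, Cmod w < d -> w <> 0 -> f w = pairing s t w).
assert (X : P (epsilon (inhabits (RtoC 0)) P)).
{ apply epsilon_spec. exists (f 0), f. split; trivial. split; trivial. now exists d. }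
destruct X as (g & <- & Hg & d' & Hd' & E').
apply (Ccont_agree g f 0 (Rmin d d')); trivial; [now apply Rmin_glb_lt|].
intros w Hw N. rewrite Cminus_0_r in Hw. transitivity (pairing s t w); [apply E'|symmetry; apply E]; trivial.
- eapply Rlt_le_trans; [exact Hw|apply Rmin_r].
- eapply Rlt_le_trans; [exact Hw|apply Rmin_l].
Qed.

Lemma extended_pairing_neq0 s t (z : C) : z <> 0 -> extended_pairing s t z = pairing s t z.
Proof. intros N. unfold extended_pairing. destruct (Ceq_dec z 0); [contradiction|trivial]. Qed.

(** Near the origin s = p v^(-1) and t = q v with p and q holomorphic, so the pairing is the product
    p q. *)
Lemma pairing_local (U V : C -> Prop) s t : Copen V -> V 0 -> (forall z, V z -> U z) -> Copen U ->
  prolong (dual_metric h) (- gam) U s -> prolong h gam V t ->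
  exists (f : C -> C) d, 0 < d /\ (exists l, Cder f 0 l) /\
    forall w : C, Cmod w < d -> w <> 0 -> f w = pairing s t w.
Proof.
intros HV V0 VU HU Hs Ht.
destruct (prolong_local L h gam r v Hv V t gam HV V0 ltac:(lra) Ht) as (q & d & Hd & Q1 & Q2 & _).
destruct (prolong_local (dual L) (dual_metric h) (- gam) r _ (adapted_dual L h gam r v Hv)
   U s (- gam) HU (VU _ V0) ltac:(lra) Hs) as (p & d' & Hd' & P1 & P2 & _).
exists (fun z => p z * q z)%C, (Rmin d d'). split; [apply Rmin_glb_lt; lra|]. split.
- destruct (Q1 0) as [_ [l Hl]]; [rewrite Cmod_0; lra|].
  destruct (P1 0) as [_ [m Hm]]; [rewrite Cmod_0; lra|].
  eexists. apply Cder_mult; eassumption.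
- intros w Hw N. assert (W1 := Rlt_le_trans _ _ _ Hw (Rmin_l _ _)).
  assert (W2 := Rlt_le_trans _ _ _ Hw (Rmin_r _ _)).
  assert (Hz0 : near0 r w) by (split; [lra|trivial]).
  assert (Hi := near0_cover L h gam r v Hv w Hz0).
  assert (Nv := v_neq0 L h gam r v Hv _ w Hz0 Hi).
  unfold pairing. rewrite (Q2 _ w W1 N Hi), (P2 _ w W2 N Hi). field. trivial.
Qed.

(** A morphism evaluated on v is the coefficient of s along the dual frame; it is holomorphic at the
    origin, hence bounded, which gives s the order - gam. Conversely the pairing of sections of
    orders - gam and gam extends across the origin. *)
Lemma dual_prolong : sheaf_eq (dual_sheaf (prolong h gam)) (prolong (dual_metric h) (- gam)).
Proof.
intros U [HU Ud] s. apply open_Copen in HU.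
assert (cov : forall z : C, U z -> z <> 0 -> chart L (chart_at L z) z).
{ intros z Uz N. apply chart_cover. split; trivial. now apply Ud. }
split.
- intros [Ss (phi & Hphi & Ephi)]. apply prolong_growth. split; trivial. intros U0.
  destruct (HU _ U0) as (d0 & Hd0 & K0).
  set (V := fun z => U z /\ ball0 r z).
  assert (OV : Copen V) by (apply Copen_inter; trivial; apply ball0_open).
  assert (V0 : V 0) by (split; [trivial|eapply ball0_0; exact Hv]).
  assert (Pv : prolong h gam V v).
  { apply (prolong_restrict h gam (ball0 r)); [now intros z []|].
    eapply v_prolong; [exact Hv|lra]. }
  destruct (Hphi V (proj2 (open_Copen V) OV) ltac:(now intros z []) v Pv) as (H1 & _ & H3).
  destruct (proj1 (ex_derive_Cder _ _) (H1 _ V0)) as [l Hl].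
  destruct (Ccont_bounded _ _ (Cder_cont _ _ _ Hl)) as (d1 & Hd1 & B).
  destruct (OV _ V0) as (d2 & Hd2 & K2).
  assert (Hr : 0 < r) by (destruct Hv; lra).
  set (d := Rmin r (Rmin d1 d2)). assert (Hd : 0 < d) by (unfold d; repeat apply Rmin_glb_lt; lra).
  assert (T : d <= r /\ d <= d1 /\ d <= d2).
  { unfold d. generalize (Rmin_l r (Rmin d1 d2)) (Rmin_r r (Rmin d1 d2)) (Rmin_l d1 d2) (Rmin_r d1 d2). lra. }
  replace (- gam) with (- gam - INR 0) by (simpl; ring).
  assert (Od := Copen_remove0 V OV).
  assert (Pv' : prolong h gam (remove0 V) v).
  { apply (prolong_restrict h gam V); trivial. now intros z []. }
  apply (growth_of_holo (dual L) (dual_metric h) (- gam) r _ (adapted_dual L h gam r v Hv)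
    s (phi V v) 0 (Cmod (phi V v 0) + 1) d); [lra| |].
  + intros i z Hz N Hi. change (chart L i z) in Hi.
    assert (Vz : V z) by (apply K2; rewrite Cminus_0_r; lra).
    (* The morphism is known to be the pairing only over open sets that avoid the origin, so it is
       first restricted to V minus the origin. *)
    rewrite <- (H3 (remove0 V) v (proj2 (open_Copen _) Od) ltac:(now intros w []) Pv' ltac:(trivial) z
      (conj Vz N)).
    rewrite (Ephi (remove0 V) v (proj2 (open_Copen _) Od)) with (i := i); trivial.
    * assert (Nv := v_neq0 L h gam r v Hv i z (conj (proj2 Vz) N) Hi). field. trivial.
    * intros w [[Uw _] Nw]. now split.
    * now split.
  + intros z Hz _. simpl. rewrite Rmult_1_r. apply B. rewrite Cminus_0_r. lra.
- intros Hs. assert (Ss := proj1 (proj1 (prolong_growth _ _ _ _) Hs)). split; trivial.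
  exists (fun _ t z => extended_pairing s t z). split.
  + intros V HV VU t Ht. apply open_Copen in HV.
    assert (St := proj1 (proj1 (prolong_growth _ _ _ _) Ht)).
    assert (SsV : is_section (dual L) (remove0 V) s).
    { apply (is_section_sub (dual L) (remove0 U)); trivial. intros z [Vz N]. split; auto. }
    split; [|split].
    * intros z Vz. apply ex_derive_Cder. destruct (Ceq_dec z 0) as [->|N].
      -- destruct (pairing_local U V s t HV Vz VU HU Hs Ht) as (f & d & Hd & [l Hl] & E).
         exists l. apply Cder_ext_loc with f; trivial. exists d. split; trivial.
         intros w Hw. rewrite Cminus_0_r in Hw. destruct (Ceq_dec w 0) as [->|Nw].
         ++ symmetry. apply (extended_pairing_0 s t f d); trivial. eapply Cder_cont; exact Hl.
         ++ rewrite extended_pairing_neq0; auto.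
      -- set (i := chart_at L z). assert (Hi : chart L i z) by (apply cov; auto).
         assert (RV := Copen_remove0 V HV z (conj Vz N)). destruct RV as (e & He & K).
         destruct (proj1 (open_Copen _) (chart_open L i) z Hi) as (e' & He' & K').
         destruct (is_section_der L (remove0 V) t i z St (conj Vz N) Hi) as [l Hl].
         destruct (is_section_der (dual L) (remove0 V) s i z SsV (conj Vz N) Hi) as [m Hm].
         eexists. apply Cder_ext_loc with (fun z => s i z * t i z)%C; [|apply Cder_mult; eassumption].
         exists (Rmin e e'). split; [now apply Rmin_glb_lt|]. intros w Hw.
         assert (W1 := K w (Rlt_le_trans _ _ _ Hw (Rmin_l _ _))).
         assert (W2 := K' w (Rlt_le_trans _ _ _ Hw (Rmin_r _ _))).
         destruct W1 as [Vw Nw]. rewrite extended_pairing_neq0 by trivial.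
         apply (pairing_chart V); trivial; [now split|]. apply cov; auto.
    * intros f t' Hf Ht' z Vz. destruct (Ceq_dec z 0) as [->|N].
      -- destruct (pairing_local U V s t HV Vz VU HU Hs Ht) as (p & d & Hd & [l Hl] & E).
         destruct (pairing_local U V s t' HV Vz VU HU Hs Ht') as (p' & d' & Hd' & [l' Hl'] & E').
         destruct (proj1 (ex_derive_Cder _ _) (Hf _ Vz)) as [m Hm].
         rewrite (extended_pairing_0 s t p d), (extended_pairing_0 s t' p' d');
           trivial; try (eapply Cder_cont; eassumption).
         apply (extended_pairing_0 s _ (fun z => f z * p z + p' z)%C (Rmin d d')).
         ++ eapply Cder_cont. apply Cder_plus; [apply Cder_mult; eassumption|exact Hl'].
         ++ now apply Rmin_glb_lt.
         ++ intros w Hw N. assert (W1 := Rlt_le_trans _ _ _ Hw (Rmin_l _ _)).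
            assert (W2 := Rlt_le_trans _ _ _ Hw (Rmin_r _ _)).
            rewrite E, E' by trivial. unfold pairing, add_scal_section. ring.
      -- rewrite !extended_pairing_neq0 by trivial. unfold pairing, add_scal_section. ring.
    * intros W t' HW WV Ht' Et z Wz. apply open_Copen in HW. destruct (Ceq_dec z 0) as [->|N].
      -- destruct (pairing_local U V s t HV (WV _ Wz) VU HU Hs Ht) as (p & d & Hd & [l Hl] & E).
         destruct (HW _ Wz) as (e & He & K).
         rewrite (extended_pairing_0 s t p d); trivial; try (eapply Cder_cont; eassumption).
         apply (extended_pairing_0 s t' p (Rmin d e)).
         ++ eapply Cder_cont; exact Hl.
         ++ now apply Rmin_glb_lt.
         ++ intros w Hw Nw. assert (W1 := Rlt_le_trans _ _ _ Hw (Rmin_l _ _)).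
            assert (W2 := Rlt_le_trans _ _ _ Hw (Rmin_r _ _)).
            rewrite E by trivial. assert (Ww : W w) by (apply K; now rewrite Cminus_0_r).
            unfold pairing. rewrite Et; trivial. apply cov; auto.
      -- rewrite !extended_pairing_neq0 by trivial. unfold pairing. rewrite Et; trivial. apply cov; auto.
  + intros V t HV VU Ht i z Vz Hi. destruct (VU z Vz) as [Uz N].
    rewrite extended_pairing_neq0 by trivial.
    assert (VV : forall w, V w -> remove0 V w) by (intros w Vw; split; [trivial|now apply VU]).
    assert (St := proj1 (proj1 (prolong_growth _ _ _ _) Ht)).
    apply (pairing_chart V); trivial; [|now apply VV|now apply cov].
    apply (is_section_sub (dual L) (remove0 U)); trivial. intros w [Vw Nw]. now apply VU.
Qed.

End Dual.

Theorem lemma1p11 (L : line_bundle) (h : hermitian_metric L) (a : R)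
    (hacc : acceptable h) :
  sheaf_eq (prolong h a) (prolong h (gamma h (prolong h a))) /\
  is_Par h a (mset1 (gamma h (prolong h a))) /\
  (exists eps0, 0 < eps0 /\ forall eps, 0 < eps < eps0 ->
     gamma (dual_metric h) (prolong (dual_metric h) (- a + 1 - eps))
       = - gamma h (prolong h a)) /\
  sheaf_eq (dual_sheaf (prolong h (gamma h (prolong h a))))
    (prolong (dual_metric h) (- gamma h (prolong h a))).
Proof.
destruct (adapted_frame_exists L h a hacc) as (gam & r & v & Hg & Hv).
rewrite (gamma_prolong L h gam r v Hv a) by lra.
split; [|split; [|split]].
- apply (prolong_eq L h gam r v Hv). lra.
- now apply (is_Par_singleton L h gam r v Hv).
(* This is the slack in a - 1 < gam: for smaller eps the level - a + 1 - eps stays above - gam, and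
   gam <= a keeps it below - gam + 1. *)
- exists (gam - (a - 1)). split; [lra|]. intros eps He.
  apply (gamma_prolong (dual L) (dual_metric h) (- gam) r _ (adapted_dual L h gam r v Hv)). lra.
- apply (dual_prolong L h gam r v Hv).
Qed.
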